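(* Let $X$ be a complex manifold of dimension $n$. The morphism $$\iota:\mathfrak{S}/\mathfrak{N}\longrightarrow\mathfrak{S}^\infty/\mathfrak{N}^\infty$$ induced by the canonical inclusions $\mathfrak{S}\hookrightarrow\mathfrak{S}^\infty$ and $\mathfrak{N}\hookrightarrow\mathfrak{N}^\infty$ is an isomorphism of sheaves (on $T^*X$).
   Context: Cones and wedges. Let $\pi:T^*X\to X$ be the projection, $T^*_XX$ the zero section, $\mathring{T}^*X=T^*X\setminus T^*_XX$, and $(z;\zeta)$ local coordinates of $T^*X$. A set $V\subset\mathring{T}^*X$ is a cone if $(z;\zeta)\in V$ implies $(z;t\zeta)\in V$ for all $t>0$. $A\Subset B$ means $A$ is relatively compact in $B$. For cones $V'\subset V$, $V'\Subset_{\mathrm{cone}}V$ means $V'=\{(z;t\zeta): t>0,(z;\zeta)\in K\}$ for some relatively compact subset $K$ of $V$. For an open cone $V$, an (open) set $W\subset V$ is an infinitesimal wedge of type $V$ if for every $K\Subset V$ there is $\delta>0$ with $\{(z;t\zeta):(z;\zeta)\in K,\ t>\delta\}\subset W$. Functions defined on wedges of type $V$ and agreeing on a smaller wedge of type $V$ are identified. Classical symbols. For an open cone $V\subset\mathring{T}^*X$, $\mathfrak{S}(V)$ is the set of functions $f(z,\zeta)$ such that (i) $f$ is holomorphic on some infinitesimal wedge $W$ of type $V$; (ii) for every open cone $V'\Subset_{\mathrm{cone}}V$ there is an infinitesimal wedge $W'\subset W$ of type $V'$ such that for every $h>0$ there is $C>0$ with $|f|\le Ce^{h|\zeta|}$ on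 $W'$. $\mathfrak{N}(V)$ is the set of $f\in\mathfrak{S}(V)$ such that for every open cone $V'\Subset_{\mathrm{cone}}V$ there are an infinitesimal wedge $W'\subset W$ of type $V'$ and $h,C>0$ with $|f|\le Ce^{-h|\zeta|}$ on $W'$. Symbols of $C^\infty$-type. $C^\infty_z\mathscr{O}_\zeta$ is the sheaf of $C^\infty$-functions $f(z,\zeta)$ that are holomorphic in the second variable $\zeta$. $\mathfrak{N}^\infty(V)$ is the set of $f$ such that (N1) $f\in C^\infty_z\mathscr{O}_\zeta(W)$ for some infinitesimal wedge $W$ of type $V$; (N2) for every open cone $V'\Subset_{\mathrm{cone}}V$ there is an infinitesimal wedge $W'\subset W$ of type $V'$ such that for all multi-indices $\alpha,\beta\in\mathbb{Z}^n_{\ge0}$ there are $h,C>0$ with $|\partial_z^\alpha\partial_{\bar z}^\beta f(z,\zeta)|\le Ce^{-h|\zeta|}$ on $W'$. $\mathfrak{S}^\infty(V)$ is the set of $f$ such that (S1) $f\in C^\infty_z\mathscr{O}_\zeta(W)$ for some infinitesimal wedge $W$ of type $V$; (S2) for every open cone $V'\Subset_{\mathrm{cone}}V$ there is an infinitesimal wedge $W'\subset W$ of type $V'$ such that for all $\alpha,\beta\in\mathbb{Z}^n_{\ge0}$ and all $h>0$ there is $C>0$ with $|\partial_z^\alpha\partial_{\bar z}^\beta f(z,\zeta)|\le Ce^{h|\zeta|}$ on $W'$; (S3) $\partial f/\partial\bar z_i\in\mathfrak{N}^\infty(V)$ for $i=1,\dots,n$. Zero section. On $T^*_XX=X$ set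 $\mathfrak{N}|_{T^*_XX}=\mathfrak{N}^\infty|_{T^*_XX}=0$ and let $\mathfrak{S}|_{T^*_XX}(U)=\mathfrak{S}^\infty|_{T^*_XX}(U)$ be the set of holomorphic $f$ on $\pi^{-1}(U)$ such that for every compact $K\subset U$ and $h>0$ there is $C>0$ with $|f|\le Ce^{h|\zeta|}$ on $\pi^{-1}(K)$. A section over an open conic subset $V$ of $T^*X$ meeting the zero section in $U$ is a section on $V\setminus T^*_XX$ together with a section on $U$ whose restriction to $\pi^{-1}(U)\setminus T^*_XX$ agrees with it. In this way $\mathfrak{S},\mathfrak{N},\mathfrak{S}^\infty,\mathfrak{N}^\infty$ are conic sheaves on $T^*X$. $\mathfrak{S}/\mathfrak{N}$ and $\mathfrak{S}^\infty/\mathfrak{N}^\infty$ are the sheaves associated with $V\mapsto\mathfrak{S}(V)/\mathfrak{N}(V)$ and $V\mapsto\mathfrak{S}^\infty(V)/\mathfrak{N}^\infty(V)$. *)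

(* Defs.v *)
From HB Require Import structures.
From mathcomp Require Import all_boot all_order all_algebra.
From mathcomp Require Import complex.
From mathcomp Require Import all_classical all_reals all_analysis.

Set Implicit Arguments.
Unset Strict Implicit.
Unset Printing Implicit Defensive.

Import Order.TTheory GRing.Theory Num.Theory numFieldNormedType.Exports.

Local Open Scope classical_set_scope.
Local Open Scope ring_scope.
Local Open Scope complex_scope.

(* Differentiability is always that of normed modules over R[i], i.e. complex *)
(* (Frechet) differentiability.                                               *)
HB.instance Definition _ (R : realType) := NormedModule.copy R[i] R[i]^o.

Section Calculus.
Variables (R : realType) (n : nat).

Definition holomorphic (V W : normedModType R[i]) (D : set V) (f : V -> W) :=
  forall p, D p -> differentiable f p.

Definition cnorm (v : 'rV[R[i]]_n) : R :=
  Num.sqrt (\sum_j Normc.normc (v 0 j) ^+ 2).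

(* (z, zeta), with zeta the coordinates of the covector sum_j zeta_j dz_j.    *)
Definition coords := ('rV[R[i]]_n * 'rV[R[i]]_n)%type.
HB.instance Definition _ := NormedModule.on coords.

Implicit Types (F : coords -> R[i]) (p v : coords) (j : 'I_n).

Definition rquot F v p : R -> R[i] :=
  fun t => (t^-1)%:C *: (F (p + t%:C *: v) - F p).

(* Derivative along a real variable: t ranges over R.                         *)
Definition rderivable F v p := cvg (rquot F v p @ (0 : R)^').
Definition rderive v F p : R[i] := lim (rquot F v p @ (0 : R)^').

(* Meaningful for open D only.                                                *)
Definition smooth (D : set coords) F :=
  forall (vs : seq coords) p, D p ->
    {for p, continuous (foldr rderive F vs)} /\
    forall v, rderivable (foldr rderive F vs) v p.

Definition re_dir j : coords := (delta_mx 0 j, 0).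
Definition im_dir j : coords := ('i *: delta_mx 0 j, 0).

Definition dz j F : coords -> R[i] := fun p =>
  2^-1 *: (rderive (re_dir j) F p - 'i *: rderive (im_dir j) F p).
Definition dzbar j F : coords -> R[i] := fun p =>
  2^-1 *: (rderive (re_dir j) F p + 'i *: rderive (im_dir j) F p).

Definition multi (D : 'I_n -> (coords -> R[i]) -> (coords -> R[i]))
    (a : 'I_n -> nat) F : coords -> R[i] :=
  foldr (fun j G => iter (a j) (D j) G) F (enum 'I_n).

End Calculus.

Arguments holomorphic {R V W} D f.

Section Manifolds.
Variables (R : realType) (n : nat).

Record chart (X : topologicalType) := Chart {
  chart_dom : set X;
  chart_fun :> X -> 'rV[R[i]]_n;
  chart_inv : 'rV[R[i]]_n -> X;
  chart_dom_open : open chart_dom;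
  chart_codom_open : open (chart_fun @` chart_dom);
  chart_funK : forall x, chart_dom x -> chart_inv (chart_fun x) = x;
  chart_fun_continuous :
    forall x, chart_dom x -> {for x, continuous chart_fun};
  chart_inv_continuous :
    forall z, (chart_fun @` chart_dom) z -> {for z, continuous chart_inv} }.

(* The atlas need not be maximal, and no countability is imposed.             *)
Record complex_manifold := ComplexManifold {
  carrier :> topologicalType;
  manifold_hausdorff : hausdorff_space carrier;
  atlas : set (chart carrier);
  atlas_cover : forall x, exists c, atlas c /\ chart_dom c x;
  atlas_holomorphic : forall c d, atlas c -> atlas d ->
    holomorphic (c @` (chart_dom c `&` chart_dom d)) (d \o chart_inv c) }.

End Manifolds.

Section Cotangent.
Variables (R : realType) (n : nat) (X : complex_manifold R n).

Definition chart_at (x : X) : chart R n X := projT1 (cid (atlas_cover x)).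

(* The covector sum_j zeta_j dz_j at x, in the coordinates z given by c,      *)
(* rewritten in the coordinates w given by d: zeta'_i is the sum over j of    *)
(* zeta_j (dz_j / dw_i).                                                      *)
Definition covector_change (c d : chart R n X) (x : X) (zeta : 'rV[R[i]]_n) :
    'rV[R[i]]_n :=
  zeta *m (jacobian (c \o chart_inv d) (d x))^T.

(* Each fibre T*_x X is identified with C^n through the coordinates of        *)
(* chart_at x.  Since chart_at x does not depend continuously on x, the       *)
(* topology below is not the product topology.                                *)
Definition cotangent := (X * 'rV[R[i]]_n)%type.
HB.instance Definition _ := Choice.on cotangent.

Implicit Types (p q : cotangent) (c d : chart R n X).

Definition base p : X := p.1.

Definition to_coords c p : coords R n :=
  (c p.1, covector_change (chart_at p.1) c p.1 p.2).

Definition of_coords c (w : coords R n) : cotangent :=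
  let x := chart_inv c w.1 in (x, covector_change c (chart_at x) x w.2).

(* The topology for which all the coordinate systems (z, zeta) induced by the *)
(* charts are homeomorphisms on open sets.                                    *)
Definition cotangent_open (A : set cotangent) := forall c, atlas c ->
  open [set w : coords R n | (c @` chart_dom c) w.1 /\ A (of_coords c w)].

Lemma cotangent_openT : cotangent_open setT.
Proof.
move=> c _.
have -> : [set w : coords R n | (c @` chart_dom c) w.1 /\ setT (of_coords c w)]
    = fst @^-1` (c @` chart_dom c) by apply/seteqP; split=> w //= -[].
apply: open_comp; last exact: chart_codom_open.
by move=> w _; exact: cvg_fst.
Qed.

Lemma cotangent_openI (A B : set cotangent) :
  cotangent_open A -> cotangent_open B -> cotangent_open (A `&` B).
Proof.
move=> oA oB c ac.
have := openI (oA c ac) (oB c ac); congr open.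
by apply/seteqP; split=> w /=; tauto.
Qed.

Lemma cotangent_open_bigcup (I : Type) (f : I -> set cotangent) :
  (forall i, cotangent_open (f i)) -> cotangent_open (\bigcup_i f i).
Proof.
move=> of_ c ac.
have -> : [set w : coords R n |
      (c @` chart_dom c) w.1 /\ (\bigcup_i f i) (of_coords c w)] =
    \bigcup_i [set w : coords R n |
      (c @` chart_dom c) w.1 /\ f i (of_coords c w)].
  apply/seteqP; split=> w /=; first by case=> cw [i _ fi]; exists i.
  by case=> i _ [cw fi]; split=> //; exists i.
by apply: bigcup_open => i _; exact: of_.
Qed.

HB.instance Definition _ := isOpenTopological.Build cotangent
  cotangent_openT cotangent_openI cotangent_open_bigcup.

Definition zero_section : set cotangent := [set p | p.2 = 0].

Definition scale (t : R) p : cotangent := (p.1, t%:C *: p.2).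

Definition over_chart c : set cotangent := base @^-1` chart_dom c.

(* Norm of the covector p in the coordinates given by c.                      *)
Definition fiber_norm c p : R := cnorm (to_coords c p).2.

End Cotangent.

Arguments zero_section {R n} X.
Arguments base {R n} X p.

Section Cones.
Variables (R : realType) (n : nat) (X : complex_manifold R n).
Local Notation T := (cotangent X).

Definition conic (V : set T) :=
  forall p (t : R), V p -> 0 < t -> V (scale t p).

Definition open_conic (V : set T) := open V /\ conic V.

Definition open_cone (V : set T) :=
  open_conic V /\ V `<=` ~` zero_section X.

Definition relatively_compact (Y : topologicalType) (A B : set Y) :=
  compact (closure A) /\ closure A `<=` B.

Definition cone_over (K : set T) : set T :=
  [set q | exists p (t : R), [/\ K p, 0 < t & q = scale t p]].

Definition cone_relatively_compact (V' V : set T) :=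
  exists K, relatively_compact K V /\ V' = cone_over K.

Definition wedge (V W : set T) :=
  [/\ open W, W `<=` V &
    forall K, relatively_compact K V ->
      exists delta : R, 0 < delta /\
        forall p t, K p -> delta < t -> W (scale t p)].

End Cones.

(* Growth and derivative conditions are expressed in the coordinates of the   *)
(* charts c, for the cones V' lying over chart_dom c.                         *)
Section Symbols.
Variables (R : realType) (n : nat) (X : complex_manifold R n).
Local Notation T := (cotangent X).
Implicit Types (V W : set T) (f g : T -> R[i]) (U : set X).

Definition in_chart (c : chart R n X) f : coords R n -> R[i] :=
  f \o of_coords c.

Definition holomorphic_on W f := forall c, atlas c ->
  holomorphic (to_coords c @` (W `&` over_chart c)) (in_chart c f).

Definition smooth_holomorphic_on W f := forall c, atlas c ->
  smooth (to_coords c @` (W `&` over_chart c)) (in_chart c f) /\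
  forall p, W p -> over_chart c p ->
    let w := to_coords c p in
    differentiable (fun zeta => in_chart c f (w.1, zeta)) w.2.

Definition bounded_by (c : chart R n X) W f (C h : R) :=
  forall p, W p -> `|f p| <= (C * expR (h * fiber_norm c p))%:C.

Definition derivative (c : chart R n X) (a b : 'I_n -> nat) f : T -> R[i] :=
  multi (@dz R n) a (multi (@dzbar R n) b (in_chart c f)) \o to_coords c.

Definition frakS_on V f W :=
  [/\ wedge V W, holomorphic_on W f &
    forall c V', atlas c -> open_cone V' ->
      cone_relatively_compact V' (V `&` over_chart c) ->
      exists W', [/\ wedge V' W', W' `<=` W &
        forall h : R, 0 < h -> exists C, 0 < C /\ bounded_by c W' f C h]].

Definition frakS V f := exists W, frakS_on V f W.

Definition frakN V f := exists W, frakS_on V f W /\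
  forall c V', atlas c -> open_cone V' ->
    cone_relatively_compact V' (V `&` over_chart c) ->
    exists W', [/\ wedge V' W', W' `<=` W &
      exists h C : R, [/\ 0 < h, 0 < C & bounded_by c W' f C (- h)]].

Definition frakNoo V f := exists W,
  [/\ wedge V W, smooth_holomorphic_on W f &
    forall c V', atlas c -> open_cone V' ->
      cone_relatively_compact V' (V `&` over_chart c) ->
      exists W', [/\ wedge V' W', W' `<=` W &
        forall a b : 'I_n -> nat, exists h C : R,
          [/\ 0 < h, 0 < C & bounded_by c W' (derivative c a b f) C (- h)]]].

Definition frakSoo V f := exists W,
  [/\ wedge V W, smooth_holomorphic_on W f,
    (forall c V', atlas c -> open_cone V' ->
      cone_relatively_compact V' (V `&` over_chart c) ->
      exists W', [/\ wedge V' W', W' `<=` W &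
        forall (a b : 'I_n -> nat) (h : R), 0 < h ->
          exists C, 0 < C /\ bounded_by c W' (derivative c a b f) C h]) &
    forall c (j : 'I_n), atlas c ->
      frakNoo (V `&` over_chart c) (dzbar j (in_chart c f) \o to_coords c)].

Definition frakS_zero U g :=
  holomorphic_on (base X @^-1` U) g /\
  forall c (K : set X) (h : R), atlas c -> compact K ->
    K `<=` U `&` chart_dom c -> 0 < h ->
    exists C, 0 < C /\ bounded_by c (base X @^-1` K) g C h.

Definition frakN_zero U g := forall p, U (base X p) -> g p = 0.

(* A section over an open conic V is represented by a pair (f, g) of total    *)
(* functions, f for V minus the zero section and g for the trace of V on the  *)
(* zero section; the values of f off a wedge and of g off pi^-1(U) are        *)
(* irrelevant, and the corresponding identifications are made by taking the   *)
(* quotient by sections_N or sections_Noo.                                    *)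
Definition rep := ((T -> R[i]) * (T -> R[i]))%type.
HB.instance Definition _ := GRing.Lmodule.on rep.

Definition zero_trace V : set X := [set x | V (x, 0)].
Definition off_zero V : set T := V `\` zero_section X.

Definition glue (A : set T -> set (T -> R[i]))
    (A0 : set X -> set (T -> R[i])) V : set rep :=
  [set u : rep | [/\ A (off_zero V) u.1, A0 (zero_trace V) u.2 &
    exists W, wedge (off_zero (base X @^-1` zero_trace V)) W /\
      forall p, W p -> u.1 p = u.2 p]].

Definition sections_S := glue frakS frakS_zero.
Definition sections_N := glue frakN frakN_zero.
Definition sections_Soo := glue frakSoo frakS_zero.
Definition sections_Noo := glue frakNoo frakN_zero.

End Symbols.

(* Sheaf associated with a presheaf V |-> A V / B V, where A V and B V, for   *)
(* V open conic, are subspaces of a fixed space M and the restriction maps    *)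
(* are the identity on representatives.  The stalk at p is the quotient of    *)
(* the union of the A V by the union of the B V (V containing p), and its     *)
(* elements are cosets in M.  Sections over any open set O of T*X are the     *)
(* functions s from O to the stalks (extended by set0 off O) which are        *)
(* locally given by elements of the presheaf.                                 *)
Section AssociatedSheaf.
Variables (R : realType) (n : nat) (X : complex_manifold R n).
Local Notation T := (cotangent X).
Variable M : lmodType R[i].
Implicit Types (A B : set T -> set M) (O : set T) (s : T -> set M).

Definition germs B (p : T) : set M :=
  [set b | exists V, [/\ open_conic V, V p & B V b]].

Definition stalk_class B (p : T) (u : M) : set M := [set v | germs B p (v - u)].

Definition quotient_sections A B O : set (T -> set M) :=
  [set s | (forall p, ~ O p -> s p = set0) /\
    forall p, O p -> exists V u, [/\ open_conic V, V p, A V u &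
      \forall q \near p, s q = stalk_class B q u]].

Definition restrict_section O s : T -> set M := fun p => [set u | O p /\ s p u].

(* a s1 + s2, computed in the stalks of A / B.                                *)
Definition lincomb B (a : R[i]) s1 s2 : T -> set M := fun p =>
  [set v | exists u1 u2, [/\ s1 p u1, s2 p u2 & germs B p (v - (a *: u1 + u2))]].

(* The map A / B -> A' / B' induced on stalks by A <= A' and B <= B', i.e.    *)
(* u + B_p |-> u + B'_p.                                                      *)
Definition induced_map B' s : T -> set M := fun p =>
  [set v | exists u, s p u /\ germs B' p (v - u)].

Record sheaf_isomorphism A B A' B' (phi : (T -> set M) -> (T -> set M)) : Prop :=
  SheafIsomorphism {
    sheaf_iso_bij : forall O, open O ->
      set_bij (quotient_sections A B O) (quotient_sections A' B' O) phi;
    sheaf_iso_restrict : forall O O' s, open O -> open O' -> O' `<=` O ->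
      quotient_sections A B O s ->
      phi (restrict_section O' s) = restrict_section O' (phi s);
    sheaf_iso_linear : forall O a s1 s2, open O ->
      quotient_sections A B O s1 -> quotient_sections A B O s2 ->
      phi (lincomb B a s1 s2) = lincomb B' a (phi s1) (phi s2) }.

End AssociatedSheaf.

(* Main.v *)
Require Import Defs.
From HB Require Import structures.
From mathcomp Require Import all_boot all_order all_algebra.
From mathcomp Require Import complex ring lra.
From mathcomp Require Import all_classical all_reals all_analysis.
Set Implicit Arguments.
Unset Strict Implicit.
Unset Printing Implicit Defensive.
Import Order.TTheory GRing.Theory Num.Theory numFieldNormedType.Exports.
Local Open Scope classical_set_scope.
Local Open Scope ring_scope.
Local Open Scope complex_scope.

(** The inclusion of the holomorphic symbols in the smooth ones becomes an
isomorphism after dividing by the exponentially decaying symbols, for the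
following reasons.

The inclusions themselves come from Cauchy's estimates: the derivatives of a
holomorphic function at a point are bounded by its values on a disc around it.
Around a relatively compact subcone there is room for discs of a fixed size in z
[fatten_cone], and this gives frakS in frakSoo [frakS_frakSoo].

Smooth symbols are governed by their values.  If all derivatives of f grow less
than any exponential and f itself decays exponentially, Landau's inequality,
which bounds a first derivative by the function and its second derivatives,
shows that all derivatives of f decay exponentially ([words_decay],
[frakNoo_decay]).  In particular frakN lies in frakNoo; conversely a holomorphic
symbol in frakNoo is in frakN, by the estimate of its values alone.  This is the
injectivity on stalks.

For the surjectivity, let f be a smooth symbol near a point off the zero section.
Its derivatives in zbar decay exponentially.  In a chart, the iterated Cauchy
integral F of f over the boundary of a polydisc in the base is holomorphic in z,
and also in zeta, which is a parameter.  By the Cauchy-Pompeiu formula, one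
variable at a time, f - F is bounded by the derivatives of f in zbar
([cauchy_pompeiu], [approx_error]), so that it decays exponentially, together
with its derivatives by the previous remark.  Thus F is a holomorphic symbol
with the class of f [local_holomorphic].  At a point of the zero section a
section of either sheaf is given by a holomorphic function on the fibres, and
there is nothing to solve.  No estimate is lost in changing charts, since the
fibre norms of two charts are equivalent on relatively compact cones
[fiber_norm_compare].

An isomorphism of stalks, compatible with local sections, gives the isomorphism
of sheaves [quotient_sheaf_isomorphism].

The one-variable theory is developed from Goursat's theorem.  Its integrals are
those of curves, defined as increments of primitives, and Cauchy's formula for
the derivative is obtained in the logarithmic coordinate [cauchy_derivative].
Holomorphy in the sense of Frechet is recovered from continuity and from
differentiability along lines [ghol_differentiable]. *)

Notation nc := Normc.normc.
Notation Re := complex.Re.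
Notation Im := complex.Im.

(** * Moduli, real-valued norms and pointwise continuity *)

Section ComplexBasics.
Variable R : realType.
Implicit Types (x y : R) (z w : R[i]).

Lemma normr_nc z : `|z| = (nc z)%:C.
Proof. by []. Qed.

Lemma nc_ge0 z : 0 <= nc z.
Proof. by rewrite -lecR -normr_nc normr_ge0. Qed.

Lemma nc0 : nc (0 : R[i]) = 0. Proof. exact: Normc.normc0. Qed.
Lemma nc1 : nc (1 : R[i]) = 1. Proof. exact: Normc.normc1. Qed.
Lemma ncM z w : nc (z * w) = nc z * nc w. Proof. exact: Normc.normcM. Qed.
Lemma ncV z : nc z^-1 = (nc z)^-1. Proof. exact: Normc.normcV. Qed.
Lemma ncN z : nc (- z) = nc z. Proof. exact: normcN. Qed.
Lemma ncD z w : nc (z + w) <= nc z + nc w. Proof. exact: le_normcD. Qed.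
Lemma ncB z w : nc (z - w) <= nc z + nc w.
Proof. by rewrite -(ncN w) ncD. Qed.
Lemma ncBC z w : nc (z - w) = nc (w - z).
Proof. by rewrite -ncN opprB. Qed.
Lemma nc_eq0 z : nc z = 0 -> z = 0. Proof. by move/Normc.eq0_normc. Qed.
Lemma nc_gt0 z : (0 < nc z) = (z != 0).
Proof.
rewrite lt0r nc_ge0 andbT; congr negb; apply/eqP/eqP => [/nc_eq0//|->].
exact: nc0.
Qed.
Lemma ncR x : nc x%:C = `|x|.
Proof. by rewrite /= expr0n /= addr0 sqrtr_sqr. Qed.
Lemma nci : nc ('i : R[i]) = 1.
Proof. by rewrite /= expr0n /= add0r expr1n sqrtr1. Qed.
Lemma ncJ z : nc (conjc z) = nc z.
Proof. by case: z => a b /=; rewrite sqrrN. Qed.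

Lemma nc_Re z : `|Re z| <= nc z.
Proof. by rewrite -lecR -normr_nc; have := normc_ge_Re z. Qed.
Lemma nc_Im z : `|Im z| <= nc z.
Proof.
rewrite -[Im z]opprK normrN -ReiNIm; apply: le_trans (nc_Re _) _.
by rewrite ncM nci mulr1.
Qed.
Lemma nc_ReIm z : nc z <= `|Re z| + `|Im z|.
Proof.
rewrite [in leLHS](complexE z); apply: le_trans (ncD _ _) _.
by rewrite ncM nci mul1r !ncR.
Qed.
Lemma nc_triangle z w u : nc (z - w) <= nc (z - u) + nc (u - w).
Proof. by rewrite (_ : z - w = (z - u) + (u - w)) ?ncD //; ring. Qed.

Lemma nc_small z : (forall e, 0 < e -> nc z <= e) -> z = 0.
Proof.
move=> h; apply: nc_eq0; apply/eqP; rewrite eq_le nc_ge0 andbT.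
by apply/ler_addgt0Pl => e e0; rewrite addr0 h.
Qed.

Lemma posC_real (e : R[i]) : 0 < e -> exists2 r : R, 0 < r & e = r%:C.
Proof.
case: e => a b; rewrite ltcE /= => /andP[/eqP -> a0].
by exists a.
Qed.

End ComplexBasics.

Section RealNorm.
Variables (R : realType) (V : normedModType R[i]).
Implicit Types (u v p q : V).

(** A module over R[i] has its norm in R[i], where the order is only partial;
estimates are made in R. *)
Definition nv (v : V) : R := Re `|v|.

Lemma normr_nv v : `|v| = (nv v)%:C.
Proof. by rewrite /nv RRe_real // ger0_real. Qed.

Lemma nv_ge0 v : 0 <= nv v.
Proof. by rewrite -lecR -normr_nv normr_ge0. Qed.
Lemma nv0 : nv 0 = 0. Proof. by rewrite /nv normr0. Qed.
Lemma nvD u v : nv (u + v) <= nv u + nv v.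
Proof. by rewrite -lecR rmorphD /= -!normr_nv ler_normD. Qed.
Lemma nvN v : nv (- v) = nv v. Proof. by rewrite /nv normrN. Qed.
Lemma nvBC u v : nv (u - v) = nv (v - u).
Proof. by rewrite -nvN opprB. Qed.
Lemma nvZ (a : R[i]) v : nv (a *: v) = nc a * nv v.
Proof. by apply: complexI; rewrite -normr_nv normrZ normr_nv normr_nc rmorphM. Qed.
Lemma nv_eq0 v : nv v = 0 -> v = 0.
Proof. by move=> h; apply/eqP; rewrite -normr_eq0 normr_nv h. Qed.
Lemma nv_triangle u v w : nv (u - v) <= nv (u - w) + nv (w - v).
Proof. by rewrite (_ : u - v = (u - w) + (w - v)) ?nvD // addrA subrK. Qed.

Lemma nbhs_nvP p (A : set V) :
  nbhs p A <-> exists2 e : R, 0 < e & forall q, nv (q - p) < e -> A q.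
Proof.
rewrite -nbhs_nbhs_norm; split.
  move=> [e /= /posC_real[r r0 ->] h]; exists r => // q hq.
  by apply: h; rewrite /ball_ /= distrC normr_nv ltcR.
move=> [e e0 h]; exists e%:C => /=; first by rewrite ltcR.
by move=> q; rewrite /ball_ /= distrC normr_nv ltcR; exact: h.
Qed.

Lemma near_nv p (e : R) : 0 < e -> \forall q \near p, nv (q - p) < e.
Proof. by move=> e0; apply/nbhs_nvP; exists e. Qed.

End RealNorm.

Lemma nvE (R : realType) (z : R[i]) : nv (z : R[i]) = nc z.
Proof. by []. Qed.

Section ComplexTopology.
Variable R : realType.

Lemma cvg_nvP (T : Type) (F : set_system T) (FF : Filter F)
    (V : normedModType R[i]) (f : T -> V) (l : V) :
  f @ F --> l <-> forall e : R, 0 < e -> \forall t \near F, nv (f t - l) < e.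
Proof.
split=> [fl e e0|h].
  by apply: (fl [set q | nv (q - l) < e]); exact: near_nv.
move=> A /nbhs_nvP[e e0 hA]; apply: filterS (h e e0) => t; exact: hA.
Qed.

Lemma continuous_real_complex : continuous (fun x : R => x%:C : R[i]).
Proof.
move=> x; apply/cvg_nvP => e e0; near=> y.
rewrite nvE -rmorphB ncR /=.
by near: y; apply/nbhs_normP; exists e => //= y; rewrite /ball_ /= distrC.
Unshelve. all: by end_near. Qed.

Lemma nonexpansive_continuous (V : normedModType R[i]) (f : V -> R) :
  (forall p q, `|f p - f q| <= nv (p - q)) -> continuous f.
Proof.
move=> fl z; apply/cvgrPdist_lt => e e0; apply: filterS (near_nv z e0) => w.
by rewrite nvBC; apply: le_lt_trans.
Qed.

Lemma continuous_Re : continuous (fun z : R[i] => Re z : R).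
Proof.
apply: (@nonexpansive_continuous R[i]) => z w.
by rewrite -(raddfB (@Re R)) nvE nc_Re.
Qed.

Lemma continuous_Im : continuous (fun z : R[i] => Im z : R).
Proof.
apply: (@nonexpansive_continuous R[i]) => z w.
by rewrite -(raddfB (@Im R)) nvE nc_Im.
Qed.

Lemma nv_dist (V : normedModType R[i]) (p q : V) : `|nv p - nv q| <= nv (p - q).
Proof.
rewrite ler_norml; apply/andP; split.
  by rewrite lerNl opprB lerBlDr nvBC; have := nvD (q - p) p; rewrite subrK.
by rewrite lerBlDr; have := nvD (p - q) q; rewrite subrK.
Qed.

Lemma continuous_nv (V : normedModType R[i]) : continuous (fun v : V => nv v).
Proof. by apply: nonexpansive_continuous => p q; exact: nv_dist. Qed.

(** The disc is a closed part of the image of a square of R x R. *)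
Lemma compact_cdisc (r : R) : compact [set z : R[i] | nc z <= r].
Proof.
have cK : compact ((fun p : R * R => p.1%:C + 'i * p.2%:C : R[i]) @`
    (`[-r, r] `*` `[-r, r])).
  apply: continuous_compact; last by apply: compact_setX; exact: segment_compact.
  apply: continuous_subspaceT => p; apply: cvgD.
    by apply: (@cvg_comp _ _ _ _ (fun x : R => x%:C : R[i])); [exact: cvg_fst|exact: continuous_real_complex].
  apply: cvgM; first exact: cvg_cst.
  by apply: (@cvg_comp _ _ _ _ (fun x : R => x%:C : R[i])); [exact: cvg_snd|exact: continuous_real_complex].
apply: subclosed_compact cK _.
  rewrite (_ : mkset _ = (fun z : R[i] => nv z) @^-1` [set x | x <= r]) //.
  by apply: closed_comp => [z _|]; [exact: continuous_nv | exact: closed_le].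
move=> z /= hz; exists (Re z, Im z) => /=; last by rewrite -complexE.
split; rewrite /= in_itv /=; rewrite -ler_norml.
  exact: le_trans (nc_Re _) hz.
exact: le_trans (nc_Im _) hz.
Qed.

End ComplexTopology.

Section Continuity.
Variable R : realType.

(** A record, so that unification does not unfold the topology of R[i]. *)
Record cont (T U : topologicalType) (f : T -> U) (p : T) : Prop :=
  Cont { cont_for : {for p, continuous f} }.

Lemma cont_comp (T U W : topologicalType) (f : T -> U) (g : U -> W) p :
  cont f p -> cont g (f p) -> cont (fun x => g (f x)) p.
Proof. by case=> cf [cg]; split; exact: continuous_comp. Qed.

Lemma cont_cst (T U : topologicalType) (c : U) (p : T) : cont (fun=> c) p.
Proof. by split; exact: cvg_cst. Qed.

Lemma cont_id (T : topologicalType) (p : T) : cont id p.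
Proof. by split; exact: cvg_id. Qed.

Lemma cont_pair (T U W : topologicalType) (f : T -> U) (g : T -> W) p :
  cont f p -> cont g p -> cont (fun x => (f x, g x)) p.
Proof. by case=> cf [cg]; split; apply: cvg_pair. Qed.

Lemma cont_fst (T U : topologicalType) (p : T * U) : cont fst p.
Proof. by split; exact: cvg_fst. Qed.

Lemma cont_snd (T U : topologicalType) (p : T * U) : cont snd p.
Proof. by split; exact: cvg_snd. Qed.

(** Continuity at p only depends on the germ of the function at p. *)
Lemma near_cont (T U : topologicalType) (f g : T -> U) p :
  (\forall q \near p, f q = g q) -> cont f p -> cont g p.
Proof.
move=> fg [cf]; have fgp : f p = g p by exact: nbhs_singleton fg.
split; rewrite /prop_for /continuous_at -fgp.
by apply: cvg_trans cf; apply: near_eq_cvg; apply: filterS fg => x ->.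
Qed.

Variable T : topologicalType.
Implicit Types (f g : T -> R[i]) (p : T).

Lemma cont_nc f p : cont f p <->
  forall e : R, 0 < e -> \forall q \near p, nc (f q - f p) < e.
Proof.
split=> [[/(@cvg_nvP R T (nbhs p) _ R[i] f (f p))]//|h].
by split; apply/(@cvg_nvP R T (nbhs p) _ R[i] f (f p)).
Qed.

Lemma contVD (V : normedModType R[i]) (f g : T -> V) p :
  cont f p -> cont g p -> cont (fun x => f x + g x) p.
Proof. by case=> cf [cg]; split; exact: cvgD. Qed.

Lemma contVZ (V : normedModType R[i]) (k : T -> R[i]) (f : T -> V) p :
  cont k p -> cont f p -> cont (fun x => k x *: f x) p.
Proof. by case=> cf [cg]; split; exact: cvgZ. Qed.

Lemma contD f g p : cont f p -> cont g p -> cont (fun x => f x + g x) p.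
Proof. exact: (@contVD R[i]). Qed.

Lemma contM f g p : cont f p -> cont g p -> cont (fun x => f x * g x) p.
Proof. by case=> cf [cg]; split; exact: (cvgM cf cg). Qed.

Lemma contZ c f p : cont f p -> cont (fun x => c * f x) p.
Proof. exact: (contM (cont_cst c p)). Qed.

Lemma contN f p : cont f p -> cont (fun x => - f x) p.
Proof. by case=> cf; split; exact: (cvgN cf). Qed.

Lemma contB f g p : cont f p -> cont g p -> cont (fun x => f x - g x) p.
Proof. by move=> cf cg; exact: contD cf (contN cg). Qed.

Lemma contV f p : f p != 0 -> cont f p -> cont (fun x => (f x)^-1) p.
Proof. by move=> f0 [cf]; split; exact: (cvgV f0 cf). Qed.

Lemma cont_realC (f : T -> R) p : cont f p -> cont (fun x => (f x)%:C) p.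
Proof.
have cC : cont (fun x : R => x%:C : R[i]) (f p) by split; exact: continuous_real_complex.
by move=> cf; exact: (@cont_comp T R R[i] f (fun x => x%:C) p cf cC).
Qed.

End Continuity.

Lemma cont_eps (R : realType) (V : normedModType R[i]) (f : V -> R[i]) p :
  cont f p <-> forall e : R, 0 < e ->
    exists2 d : R, 0 < d & forall q, nv (q - p) < d -> nc (f q - f p) < e.
Proof.
rewrite cont_nc; split=> H e e0; first exact/nbhs_nvP/H.
by apply/nbhs_nvP/H.
Qed.

Lemma ccont_eps (R : realType) (f : R[i] -> R[i]) p :
  cont f p <-> forall e : R, 0 < e ->
    exists2 d : R, 0 < d & forall q, nc (q - p) < d -> nc (f q - f p) < e.
Proof. exact: (@cont_eps R R[i]). Qed.

(** * Curves in the complex plane and their integrals *)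

Section Curves.
Variable R : realType.
Implicit Types (g P : R -> R[i]) (a b t x : R) (l L : R[i]).

(** Differentiability of a curve in the plane, written with remainders because
R[i] is normed over itself and not over R. *)
Definition rder g t l := forall e : R, 0 < e -> exists2 d : R, 0 < d &
  forall h : R, `|h| < d -> nc (g (t + h) - g t - h%:C * l) <= e * `|h|.

Lemma is_derive_eps (f : R -> R) t (l : R) : is_derive t 1 f l <->
  forall e : R, 0 < e -> exists2 d : R, 0 < d &
  forall h : R, `|h| < d -> `|f (t + h) - f t - h * l| <= e * `|h|.
Proof.
have E h : h != 0 -> `|f (t + h) - f t - h * l| =
    `|l - h^-1 *: ((f \o shift t) (h *: 1) - f t)| * `|h|.
  move=> h0; rewrite -normrM distrC /=; congr (`| _ |).
  rewrite /= [h%:A]mulr1 [h + t]addrC /GRing.scale /=; set u := f _ - f _.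
by rewrite mulrBl mulrAC mulVf // mul1r [l * h]mulrC.
split=> [|H].
  move=> [cf dfE] e e0.
  have := cf; rewrite /derivable -/(derive _ _ _) => /cvg_ex[/= l' cl'].
  have El : l' = l by rewrite -dfE; apply/esym/cvg_lim.
  rewrite El in cl'.
  have /cvgrPdist_lt/(_ e e0) := cl'.
  rewrite near_withinE => /nbhs_normP[d /= d0 hd]; exists d => // h hh.
  have [->|h0] := eqVneq h 0; first by rewrite addr0 mul0r !subr0 subrr normr0 mulr0.
  rewrite E // ler_wpM2r //; apply/ltW; apply: (hd h) => //=.
  by rewrite sub0r normrN.
have cl : (fun h => h^-1 *: ((f \o shift t) (h *: 1) - f t)) @ 0^' --> l.
  apply/cvgrPdist_le => e e0.
  have [d d0 hd] := H e e0.
  rewrite near_withinE; apply/nbhs_normP; exists d => //= h.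
  rewrite /ball_ /= sub0r normrN => hh h0.
  have h0' : 0 < `|h| by rewrite normr_gt0.
  by have := hd h hh; rewrite E // ler_pM2r.
split; first by apply/cvg_ex; exists l.
exact/cvg_lim.
Qed.

Lemma rder_Re g t l : rder g t l -> is_derive t 1 (fun x => Re (g x)) (Re l).
Proof.
move=> H; apply/is_derive_eps => e /H[d d0 hd]; exists d => // h /hd.
apply: le_trans; apply: le_trans (nc_Re _).
by case: l {H hd} => l1 l2; case: (g (t+h)) => ??; case: (g t) => ?? /=; simpc.
Qed.

Lemma rder_Im g t l : rder g t l -> is_derive t 1 (fun x => Im (g x)) (Im l).
Proof.
move=> H; apply/is_derive_eps => e /H[d d0 hd]; exists d => // h /hd.
apply: le_trans; apply: le_trans (nc_Im _).
by case: l {H hd} => l1 l2; case: (g (t+h)) => ??; case: (g t) => ?? /=; simpc.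
Qed.

Lemma rder_ReIm g t l : is_derive t 1 (fun x => Re (g x)) (Re l) ->
  is_derive t 1 (fun x => Im (g x)) (Im l) -> rder g t l.
Proof.
move=> /is_derive_eps H1 /is_derive_eps H2 e e0.
have e2 : 0 < e / 2 by rewrite divr_gt0.
have [d1 d10 h1] := H1 _ e2; have [d2 d20 h2] := H2 _ e2.
exists (Num.min d1 d2) => [|h]; first by rewrite lt_min d10.
rewrite lt_min => /andP[/h1 k1 /h2 k2].
apply: le_trans (nc_ReIm _) _.
have -> : e * `|h| = e / 2 * `|h| + e / 2 * `|h| by field.
apply: lerD.
  apply: le_trans k1; rewrite le_eqVlt; apply/orP; left; apply/eqP; congr (`| _ |).
  by case: l {H1 H2 h1 h2 k2} => l1 l2; case: (g (t+h)) => ??; case: (g t) => ?? /=; simpc.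
apply: le_trans k2; rewrite le_eqVlt; apply/orP; left; apply/eqP; congr (`| _ |).
by case: l {H1 H2 h1 h2 k1} => l1 l2; case: (g (t+h)) => ??; case: (g t) => ?? /=; simpc.
Qed.

Lemma rder_continuous g t l : rder g t l -> cont g t.
Proof.
move=> H; apply/cont_nc => e e0.
have [d d0 hd] := H 1 ltr01.
have M0 : 0 < 1 + nc l by rewrite ltr_pwDl // nc_ge0.
apply/nbhs_normP; exists (Num.min d (e / (1 + nc l))) => /=.
  by rewrite lt_min d0 divr_gt0.
move=> x; rewrite /ball_ /= distrC lt_min => /andP[xd xe].
have := hd (x - t) xd; rewrite mul1r [t + _]addrC subrK => hx.
have -> : g x - g t = (g x - g t - (x - t)%:C * l) + (x - t)%:C * l by ring.
apply: le_lt_trans (ncD _ _) _; rewrite ncM ncR.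
have : `|x - t| * (1 + nc l) < e by rewrite -ltr_pdivlMr.
by apply: le_lt_trans; rewrite mulrDr mulr1 lerD2r.
Qed.

(** The mean value theorem fails for curves: it is applied to the real and the
imaginary parts separately, whence the factor 2. *)
Lemma mean_value_ineq g (dg : R -> R[i]) a b L (M : R) : a <= b ->
  (forall x, a <= x <= b -> rder g x (dg x)) ->
  (forall x, a <= x <= b -> nc (dg x - L) <= M) ->
  nc (g b - g a - (b - a)%:C * L) <= 2 * M * (b - a).
Proof.
move=> ab dgP dM.
have main (f df : R -> R) (l : R) :
    (forall x, a <= x <= b -> is_derive x 1 f (df x)) ->
    (forall x, a <= x <= b -> `|df x - l| <= M) ->
    `|f b - f a - (b - a) * l| <= M * (b - a).
  move=> fd fM.
  have [c cab ->] : exists2 c, c \in `[a, b]%R & f b - f a = df c * (b - a).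
    apply: MVT_segment => //.
      by move=> x; rewrite in_itv /= => /andP[ax xb]; apply: fd; rewrite !ltW.
    apply: derivable_within_continuous => x; rewrite in_itv /= => /fd d.
    exact: ex_derive.
  rewrite [_ * l]mulrC -mulrBl normrM [X in _ * X]ger0_norm ?subr_ge0 //.
  by apply: ler_wpM2r; [rewrite subr_ge0|by apply: fM; move: cab; rewrite in_itv].
apply: le_trans (nc_ReIm _) _.
have -> : 2 * M * (b - a) = M * (b - a) + M * (b - a) by ring.
apply: lerD.
  have -> : Re (g b - g a - (b - a)%:C * L) =
      Re (g b) - Re (g a) - (b - a) * Re L.
    by case: (g b) => ??; case: (g a) => ??; case: L {dM} => ?? /=; simpc.
  apply: (main (fun x => Re (g x)) (fun x => Re (dg x))) => x xab.
    exact/rder_Re/dgP.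
  by rewrite -(raddfB (@Re R)); apply: le_trans (nc_Re _) (dM _ xab).
have -> : Im (g b - g a - (b - a)%:C * L) =
    Im (g b) - Im (g a) - (b - a) * Im L.
  by case: (g b) => ??; case: (g a) => ??; case: L {dM} => ?? /=; simpc.
apply: (main (fun x => Im (g x)) (fun x => Im (dg x))) => x xab.
  exact/rder_Im/dgP.
by rewrite -(raddfB (@Im R)); apply: le_trans (nc_Im _) (dM _ xab).
Qed.

Lemma real_primitive_exists (f : R -> R) a b : continuous f ->
  exists F : R -> R, forall x, a <= x <= b -> is_derive x 1 F (f x).
Proof.
move=> cf.
have fi : (@lebesgue_measure R).-integrable `[a - 1, b + 1] (EFin \o f).
  apply: continuous_compact_integrable; first exact: segment_compact.
  exact: continuous_subspaceT.
(* starting the integral at a - 1 makes a and b interior points *)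
exists (fun x => \int[@lebesgue_measure R]_(t in [set` `[a - 1, x]]) (f t))%R.
move=> x /andP[ax xb].
have [] := @continuous_FTC1_closed R f (a - 1) x (b + 1) _ fi _ (cf x).
- by rewrite (le_lt_trans xb) // ltrDl.
- by rewrite (lt_le_trans _ ax) // ltrBlDr ltrDl.
by move=> d E; apply: DeriveDef; [exact: d | rewrite -derive1E; exact: E].
Qed.

Lemma primitive_exists g a b : (forall x, cont g x) ->
  exists P, forall x, a <= x <= b -> rder P x (g x).
Proof.
move=> cg.
have [F1 h1] : exists F, forall x, a <= x <= b -> is_derive x 1 F (Re (g x)).
  apply: real_primitive_exists => x.
  by have [cgx] := cg x; apply: continuous_comp; [exact: cgx | exact: continuous_Re].
have [F2 h2] : exists F, forall x, a <= x <= b -> is_derive x 1 F (Im (g x)).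
  apply: real_primitive_exists => x.
  by have [cgx] := cg x; apply: continuous_comp; [exact: cgx | exact: continuous_Im].
by exists (fun x => F1 x +i* F2 x) => x xab; apply: rder_ReIm; [exact: h1|exact: h2].
Qed.

Lemma rderD g P t l L : rder g t l -> rder P t L ->
  rder (fun x => g x + P x) t (l + L).
Proof.
move=> H1 H2 e e0; have e2 : 0 < e / 2 by rewrite divr_gt0.
have [d1 d10 h1] := H1 _ e2; have [d2 d20 h2] := H2 _ e2.
exists (Num.min d1 d2) => [|h]; first by rewrite lt_min d10.
rewrite lt_min => /andP[/h1 k1 /h2 k2].
have -> : g (t + h) + P (t + h) - (g t + P t) - h%:C * (l + L) =
  (g (t + h) - g t - h%:C * l) + (P (t + h) - P t - h%:C * L) by ring.
apply: le_trans (ncD _ _) _.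
have -> : e * `|h| = e / 2 * `|h| + e / 2 * `|h| by field.
exact: lerD.
Qed.

Lemma rderZ (c : R[i]) g t l : rder g t l -> rder (fun x => c * g x) t (c * l).
Proof.
move=> H e e0.
have c0 : 0 < 1 + nc c by rewrite ltr_pwDl // nc_ge0.
have [d d0 hd] := H _ (divr_gt0 e0 c0).
exists d => // h /hd k.
have -> : c * g (t + h) - c * g t - h%:C * (c * l) =
  c * (g (t + h) - g t - h%:C * l) by ring.
rewrite ncM; apply: (@le_trans _ _ (nc c * (e / (1 + nc c) * `|h|))).
  by rewrite ler_wpM2l // nc_ge0.
rewrite mulrA ler_wpM2r // mulrA ler_pdivrMr // mulrC ler_wpM2l ?ltW //.
by rewrite ltrDr.
Qed.

Lemma rderN g t l : rder g t l -> rder (fun x => - g x) t (- l).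
Proof.
move=> /(@rderZ (-1)); rewrite mulN1r.
by rewrite (_ : (fun x => -1 * g x) = fun x => - g x) //; apply/funext => x; rewrite mulN1r.
Qed.

Lemma rderB g P t l L : rder g t l -> rder P t L ->
  rder (fun x => g x - P x) t (l - L).
Proof. by move=> H1 H2; apply: rderD => //; exact: rderN. Qed.

Lemma rder_cst (c : R[i]) t : rder (fun=> c) t 0.
Proof.
move=> e e0; exists 1 => // h _.
by rewrite subrr mulr0 subrr nc0 mulr_ge0 // ltW.
Qed.

Lemma rder_id t : rder (fun x => x%:C) t 1.
Proof.
move=> e e0; exists 1 => // h _.
rewrite (_ : _ - _ - _ = 0); first by rewrite nc0 mulr_ge0 // ltW.
by rewrite rmorphD /=; ring.
Qed.

Lemma rder_ext g P t l : (forall x, g x = P x) -> rder g t l -> rder P t l.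
Proof. by move=> /funext ->. Qed.

(** The integral of a continuous function over [a, b], defined as the
increment of a primitive: linearity, additivity and the fundamental theorem
then follow from the mean value inequality alone. *)
Definition cint a b g : R[i] :=
  let P := xget (fun=> 0) [set P | forall x, a <= x <= b -> rder P x (g x)] in
  P b - P a.

Lemma primitive_unique a b P Q (g : R -> R[i]) : a <= b ->
  (forall x, a <= x <= b -> rder P x (g x)) ->
  (forall x, a <= x <= b -> rder Q x (g x)) -> P b - P a = Q b - Q a.
Proof.
move=> ab hP hQ; apply/eqP; rewrite -subr_eq0; apply/eqP/nc_eq0/eqP.
rewrite eq_le nc_ge0 andbT.
have := @mean_value_ineq (fun x => P x - Q x) (fun=> 0) a b 0 0 ab.
rewrite !mulr0 !mul0r !subr0.
rewrite (_ : P b - P a - (Q b - Q a) = P b - Q b - (P a - Q a)); last by ring.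
apply=> x xab; last by rewrite nc0.
by rewrite -(subrr (g x)); apply: rderB; [exact: hP|exact: hQ].
Qed.

Lemma cintE a b g P : a <= b ->
  (forall x, a <= x <= b -> rder P x (g x)) -> cint a b g = P b - P a.
Proof.
move=> ab hP; rewrite /cint; case: xgetP => [Q _ hQ|/(_ P)//].
exact: primitive_unique hQ hP.
Qed.

Lemma eq_cint a b g P : (forall x, a <= x <= b -> g x = P x) ->
  cint a b g = cint a b P.
Proof.
move=> gP; rewrite /cint; congr (_ - _); congr (xget _ _ _); apply/seteqP; split=> Q /= h x xab.
- by rewrite -gP //; exact: h.
- by rewrite gP //; exact: h.
- by rewrite -gP //; exact: h.
- by rewrite gP //; exact: h.
Qed.

Lemma cintD a b g P : a <= b -> (forall x, cont g x) -> (forall x, cont P x) ->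
  cint a b (fun x => g x + P x) = cint a b g + cint a b P.
Proof.
move=> ab /(@primitive_exists _ a b)[G hG] /(@primitive_exists _ a b)[Q hQ].
rewrite (cintE ab hG) (cintE ab hQ).
rewrite (@cintE a b _ (fun x => G x + Q x)) //; first by ring.
by move=> x xab; apply: rderD; [exact: hG|exact: hQ].
Qed.

Lemma cintZ a b (c : R[i]) g : a <= b -> (forall x, cont g x) ->
  cint a b (fun x => c * g x) = c * cint a b g.
Proof.
move=> ab /(@primitive_exists _ a b)[G hG].
rewrite (cintE ab hG) (@cintE a b _ (fun x => c * G x)) //; first by ring.
by move=> x xab; apply: rderZ; exact: hG.
Qed.

Lemma cintB a b g P : a <= b -> (forall x, cont g x) -> (forall x, cont P x) ->
  cint a b (fun x => g x - P x) = cint a b g - cint a b P.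
Proof.
move=> ab /(@primitive_exists _ a b)[G hG] /(@primitive_exists _ a b)[Q hQ].
rewrite (cintE ab hG) (cintE ab hQ).
rewrite (@cintE a b _ (fun x => G x - Q x)) //; first by ring.
by move=> x xab; apply: rderB; [exact: hG|exact: hQ].
Qed.

Lemma cint_cst a b (c : R[i]) : a <= b -> cint a b (fun=> c) = (b - a)%:C * c.
Proof.
move=> ab; rewrite (@cintE a b _ (fun x => c * x%:C)) //.
  by rewrite rmorphB /=; ring.
by move=> x _; rewrite -[X in rder _ _ X]mulr1; apply: rderZ; exact: rder_id.
Qed.

Lemma cint_split a c b g : a <= c -> c <= b -> (forall x, cont g x) ->
  cint a b g = cint a c g + cint c b g.
Proof.
move=> ac cb /(@primitive_exists _ a b)[G hG].
rewrite (cintE (le_trans ac cb) hG) (@cintE a c _ G) // ?(@cintE c b _ G) //.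
- by ring.
- by move=> x /andP[h1 h2]; apply: hG; rewrite h2 (le_trans ac h1).
- by move=> x /andP[h1 h2]; apply: hG; rewrite h1 (le_trans h2 cb).
Qed.

Lemma cint_bound a b g (M : R) : a <= b -> (forall x, cont g x) ->
  (forall x, a <= x <= b -> nc (g x) <= M) ->
  nc (cint a b g) <= 2 * M * (b - a).
Proof.
move=> ab /(@primitive_exists _ a b)[G hG] gM; rewrite (cintE ab hG).
have := mean_value_ineq (L := 0) ab hG (M := M); rewrite mulr0 subr0; apply.
by move=> x xab; rewrite subr0 gM.
Qed.

End Curves.

(** * Differentiation in the complex plane *)

Section PlaneDerivatives.
Variable R : realType.
Local Notation C := R[i].
Implicit Types (f g : C -> C) (t z w l m A B : C).

(** Real differentiability in the plane, the differential being written
h A + conj(h) B; A and B are the two Wirtinger derivatives. *)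
Definition rdiff f t A B := forall e : R, 0 < e -> exists2 d : R, 0 < d &
  forall h : C, nc h < d ->
    nc (f (t + h) - f t - (h * A + conjc h * B)) <= e * nc h.

Definition cder f t l := rdiff f t l 0.

Lemma cder_eps f t l : cder f t l <-> forall e : R, 0 < e ->
  exists2 d : R, 0 < d &
  forall h : C, nc h < d -> nc (f (t + h) - f t - h * l) <= e * nc h.
Proof.
by split=> H e /H[d d0 hd]; exists d => // h /hd; rewrite mulr0 addr0.
Qed.

(** Caratheodory's form of differentiability turns the rules of calculus into
statements about continuous functions. *)
Lemma cder_carath f t l : cder f t l <-> exists phi : C -> C,
  [/\ cont phi t, phi t = l &
      forall x, f x - f t = (x - t) * phi x].
Proof.
split=> [/cder_eps H|[phi [cphi phit fE]]].
  exists (fun x => if x == t then l else (f x - f t) / (x - t)); split.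
  - apply/ccont_eps => e e0; have [d d0 hd] := H _ (divr_gt0 e0 (ltr0n _ 2)).
    exists d => // x; rewrite eqxx => xd.
    case: ifPn => [_|xt]; first by rewrite subrr nc0.
    have xt0 : x - t != 0 by rewrite subr_eq0.
    have xt1 : 0 < nc (x - t) by rewrite nc_gt0.
    have := hd _ xd; rewrite [t + _]addrC subrK.
    have -> : f x - f t - (x - t) * l = (x - t) * ((f x - f t) / (x - t) - l).
      by rewrite mulrBr [_ / _]mulrC mulrA mulfV // mul1r.
    rewrite ncM [_ * nc (x - t)]mulrC ler_pM2l // => /le_lt_trans; apply.
    by rewrite ltr_pdivrMr // ltr_pMr // ltr1n.
  - by rewrite eqxx.
  - move=> x; case: ifPn => [/eqP ->|xt]; first by rewrite !subrr mul0r.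
    by rewrite mulrC divfK // subr_eq0.
apply/cder_eps => e e0.
have /ccont_eps/(_ e e0)[d d0 hd] := cphi; exists d => // h hh.
have := hd (t + h); rewrite [t + h]addrC addrK => /(_ hh); rewrite phit [h + t]addrC => k.
have := fE (t + h); rewrite (_ : t + h - t = h); last by rewrite [t + h]addrC addrK.
move=> ->.
by rewrite -mulrBr ncM mulrC ler_wpM2r ?nc_ge0 // ltW // addrC.
Qed.

Lemma cder_continuous f t l : cder f t l -> cont f t.
Proof.
move=> /cder_carath[phi [cphi phit fE]].
have -> : f = fun x => f t + (x - t) * phi x.
  by apply/funext => x; rewrite -fE addrC subrK.
apply: contD; first exact: cont_cst.
by apply: contM => //; apply: contB; [exact: cont_id | exact: cont_cst].
Qed.

Lemma cder_comp f g t l m : cder g t l -> cder f (g t) m ->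
  cder (fun x => f (g x)) t (m * l).
Proof.
move=> gl; have cg := cder_continuous gl; move: gl.
move=> /cder_carath[psi [cpsi psit gE]] /cder_carath[phi [cphi phit fE]].
apply/cder_carath; exists (fun x => phi (g x) * psi x); split.
- by apply: contM => //; exact: cont_comp cg cphi.
- by rewrite phit psit.
- by move=> x; rewrite fE gE; ring.
Qed.

Lemma cderM f g t l m : cder f t l -> cder g t m ->
  cder (fun x => f x * g x) t (l * g t + f t * m).
Proof.
move=> fl gm; have cg := cder_continuous gm; move: fl gm.
move=> /cder_carath[phi [cphi phit fE]] /cder_carath[psi [cpsi psit gE]].
apply/cder_carath; exists (fun x => phi x * g x + f t * psi x); split.
- by apply: contD; [exact: contM | exact: contZ].
- by rewrite phit psit.
- move=> x; rewrite (_ : _ - _ = (f x - f t) * g x + f t * (g x - g t)); last by ring.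
  by rewrite fE gE; ring.
Qed.

Lemma cderD f g t l m : cder f t l -> cder g t m ->
  cder (fun x => f x + g x) t (l + m).
Proof.
move=> /cder_carath[phi [cphi phit fE]] /cder_carath[psi [cpsi psit gE]].
apply/cder_carath; exists (fun x => phi x + psi x); split.
- exact: contD.
- by rewrite phit psit.
- move=> x; rewrite (_ : _ - _ = (f x - f t) + (g x - g t)); last by ring.
  by rewrite fE gE; ring.
Qed.

Lemma cder_cst c t : cder (fun=> c) t 0.
Proof.
apply/cder_carath; exists (fun=> 0); split; [exact: cont_cst | by [] |].
by move=> x; rewrite subrr mulr0.
Qed.

Lemma cder_id t : cder (fun x => x) t 1.
Proof.
apply/cder_carath; exists (fun=> 1); split; [exact: cont_cst | by [] |].
by move=> x; rewrite mulr1.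
Qed.

Lemma cderZ c f t l : cder f t l -> cder (fun x => c * f x) t (c * l).
Proof. by move=> /(cderM (cder_cst c t)); rewrite mul0r add0r. Qed.

Lemma cderBc c f t l : cder f t l -> cder (fun x => f x - c) t l.
Proof. by move=> /cderD/(_ (cder_cst (- c) t)); rewrite addr0. Qed.

Lemma cderMr c f t l : cder f t l -> cder (fun x => f x * c) t (l * c).
Proof.
move=> /(cderZ c); rewrite mulrC.
by rewrite (_ : (fun x => c * f x) = fun x => f x * c) //; apply/funext => x; rewrite mulrC.
Qed.

Lemma cderB f g t l m : cder f t l -> cder g t m ->
  cder (fun x => f x - g x) t (l - m).
Proof.
move=> fl /(cderZ (-1)) /(cderD fl); rewrite mulN1r.
by rewrite (_ : (fun x => f x + -1 * g x) = fun x => f x - g x) //; apply/funext => x; rewrite mulN1r.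
Qed.

Lemma cder_inv t : t != 0 -> cder (fun x => x^-1) t (- t ^- 2).
Proof.
move=> t0; apply/cder_eps => e e0.
(* the first bound keeps t + h away from 0, the second one controls the
   remainder h ^ 2 / (t ^ 2 (t + h)) *)
pose d := Num.min (nc t / 2) (e * (nc t ^+ 3) / 2).
have nt : 0 < nc t by rewrite nc_gt0.
have d0 : 0 < d by rewrite lt_min divr_gt0 //= divr_gt0 // mulr_gt0 // exprn_gt0.
exists d => // h; rewrite lt_min => /andP[h1 h2].
have th : nc t / 2 <= nc (t + h).
  have := ncB (t + h) h; rewrite addrK; lra.
have th0 : t + h != 0 by rewrite -nc_gt0; apply: lt_le_trans th; rewrite divr_gt0.
have -> : (t + h)^-1 - t^-1 - h * - t ^- 2 = h * (h / (t ^+ 2 * (t + h))).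
  by field; rewrite t0 th0.
rewrite ncM mulrC ler_wpM2r ?nc_ge0 // !ncM ncV !ncM.
have p0 : 0 < nc t * nc t * nc (t + h).
  by rewrite !mulr_gt0 // nc_gt0.
rewrite ler_pdivrMr //; apply: (le_trans (ltW h2)).
have -> : e * nc t ^+ 3 / 2 = e * (nc t * nc t * (nc t / 2)) by field.
by rewrite ler_pM2l // ler_pM2l // mulr_gt0.
Qed.

Lemma cderV f t l : f t != 0 -> cder f t l ->
  cder (fun x => (f x)^-1) t (- (f t) ^- 2 * l).
Proof. by move=> ft0 fl; apply: (cder_comp fl); exact: cder_inv. Qed.

Lemma cder_shift f t l : cder f t l <-> cder (fun s => f (t + s)) 0 l.
Proof.
by split=> H e /H[d d0 hd]; exists d => // h /hd; rewrite ?add0r addr0.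
Qed.

Lemma conjc_subZ (z w : C) (h : R) :
  conjc (z - h%:C * w) = conjc z - h%:C * conjc w.
Proof.
case: z => a b; case: w => c d; apply/eqP; rewrite eq_complex /=.
by apply/andP; split; apply/eqP; ring.
Qed.

(** For a function which is only real differentiable, both Wirtinger derivatives
enter the chain rule along a curve. *)
Lemma rder_comp f (g : R -> C) (t : R) l A B :
  rdiff f (g t) A B -> rder g t l ->
  rder (fun x => f (g x)) t (l * A + conjc l * B).
Proof.
move=> Hf Hg e e0.
set M := 1 + nc l; have M0 : 0 < M by rewrite ltr_pwDl // nc_ge0.
set N := 1 + (nc A + nc B).
have N0 : 0 < N by rewrite ltr_pwDl // addr_ge0 // nc_ge0.
have [d1 d10 h1] := Hf _ (divr_gt0 (divr_gt0 e0 (ltr0n _ 2)) M0).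
have [d2 d20 h2] := Hg _ (divr_gt0 (divr_gt0 e0 (ltr0n _ 2)) N0).
have [d3 d30 h3] := Hg _ ltr01.
exists (Num.min (Num.min d2 d3) (d1 / M)) => [|h].
  by rewrite !lt_min d20 d30 divr_gt0.
rewrite !lt_min -andbA => /and3P[/h2 k2 /h3 k3 hd1].
set k := g (t + h) - g t in k2 k3.
have kM : nc k <= M * `|h|.
  have -> : k = (k - h%:C * l) + h%:C * l by ring.
  apply: le_trans (ncD _ _) _; rewrite ncM ncR /M.
  by rewrite mulrDl mul1r [nc l * _]mulrC lerD2r -[`|h|]mul1r.
have kd : nc k < d1.
  by apply: le_lt_trans kM _; rewrite mulrC -ltr_pdivlMr.
have := h1 k kd; rewrite (_ : g t + k = g (t + h)) => [k1|]; last by rewrite /k addrC subrK.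
have -> : f (g (t + h)) - f (g t) - h%:C * (l * A + conjc l * B) =
  (f (g (t + h)) - f (g t) - (k * A + conjc k * B)) +
  ((k - h%:C * l) * A + conjc (k - h%:C * l) * B).
  have -> : conjc (k - h%:C * l) = conjc k - h%:C * conjc l.
    exact: conjc_subZ.
  by ring.
apply: le_trans (ncD _ _) _.
have -> : e * `|h| = e / 2 / M * (M * `|h|) + e / 2 / N * `|h| * N.
  by field; rewrite !gt_eqF.
apply: lerD.
  by apply: (le_trans k1); rewrite ler_pM2l // !divr_gt0.
apply: le_trans (ncD _ _) _; rewrite !ncM ncJ -mulrDr.
apply: ler_pM => //; rewrite ?addr_ge0 ?nc_ge0 //.
by rewrite /N lerDr.
Qed.

Lemma rder_comp_cder f (g : R -> C) (t : R) l m :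
  cder f (g t) m -> rder g t l -> rder (fun x => f (g x)) t (l * m).
Proof. by move=> hf /(rder_comp hf); rewrite mulr0 addr0. Qed.

Lemma rder_line z w (t : R) : rder (fun x => z + x%:C * w) t w.
Proof.
have := rderD (rder_cst z t) (rderZ w (rder_id t)).
rewrite add0r mulr1; apply: rder_ext => x; by rewrite [w * _]mulrC.
Qed.

Lemma cder_mean_value f (df : C -> C) z h L (M : R) :
  (forall x : R, 0 <= x <= 1 -> cder f (z + x%:C * h) (df (z + x%:C * h))) ->
  (forall x : R, 0 <= x <= 1 -> nc (df (z + x%:C * h) - L) <= M) ->
  nc (f (z + h) - f z - h * L) <= 2 * M * nc h.
Proof.
move=> fd dM.
have := @mean_value_ineq R (fun x => f (z + x%:C * h))
  (fun x => h * df (z + x%:C * h)) 0 1 (h * L) (nc h * M) ler01.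
rewrite mul1r mul0r addr0 subr0 mul1r [2 * _]mulrA mulr1 [2 * _ * M]mulrAC; apply => x xab.
  by apply: rder_comp_cder (fd x xab) _; exact: rder_line.
by rewrite -mulrBr ncM ler_wpM2l ?nc_ge0 // dM.
Qed.

End PlaneDerivatives.

(** * Integrals depending on a parameter *)

Section ParameterIntegrals.
Variable R : realType.
Local Notation C := R[i].

(** Joint continuity along the compact segment {t0} x [a, b] is uniform. *)
Lemma uniform_near (T : topologicalType) (K : T -> R -> C) t0 (a b e : R) :
  0 < e -> (forall x : R, a <= x <= b -> cont (fun p : T * R => K p.1 p.2) (t0, x)) ->
  \forall t \near t0, forall x : R, a <= x <= b -> nc (K t x - K t0 x) < e.
Proof.
move=> e0 cK.
have e2 : 0 < e / 2 by rewrite divr_gt0.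
have /compact_near_coveringP cov := @segment_compact R a b.
have := cov T (nbhs t0) (fun t x => nc (K t x - K t0 x) < e) _.
move=> H; have {}H : \forall t \near t0, `[a, b] `<=` (fun x : R => nc (K t x - K t0 x) < e).
  apply: H => x; rewrite /= in_itv /= => xab.
  have /cont_nc/(_ _ e2)[[A B] /= [At Bx] AB] := cK x xab.
  exists (B, A) => //= -[x' t] /= [Bx' At'].
  have h1 := AB (t, x') (conj At' Bx').
  have h2 := AB (t0, x') (conj (nbhs_singleton At) Bx').
  apply: le_lt_trans (nc_triangle _ _ (K t0 x)) _.
  by rewrite [nc (K t0 x - _)]ncBC [e]splitr ltrD.
by apply: filterS H => t ht x xab; apply: ht; rewrite /= in_itv.
Qed.

Lemma cont_cint (T : topologicalType) (K : T -> R -> C) t0 (a b : R) : a <= b ->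
  (\forall t \near t0, forall x, cont (K t) x) ->
  (forall x : R, a <= x <= b -> cont (fun p : T * R => K p.1 p.2) (t0, x)) ->
  cont (fun t => cint a b (K t)) t0.
Proof.
move=> ab cK jK; apply/cont_nc => e e0.
have c0 := nbhs_singleton cK.
pose e' := e / (2 * (b - a) + 1).
have M0 : 0 < 2 * (b - a) + 1 by rewrite ltr_wpDl // mulr_ge0 // subr_ge0.
have e'0 : 0 < e' by rewrite divr_gt0.
have h := uniform_near e'0 jK.
apply: filterS2 cK h => t ct ht.
rewrite -cintB //.
apply: (@le_lt_trans _ _ (2 * e' * (b - a))).
  by apply: cint_bound => // [x|x xab]; [exact: contB | rewrite ltW // ht].
rewrite /e' mulrAC mulrA -mulrA -[X in _ < X](mulfVK (lt0r_neq0 M0)).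
by rewrite [ltRHS]mulrC ltr_pM2r ?divr_gt0 // ltrDl.
Qed.

(** Differentiation under the integral sign: the mean value inequality bounds
the remainder of K by the oscillation of its derivative K1, which is uniformly
small on [a, b]. *)
Lemma cder_cint (K K1 : C -> R -> C) (a b d : R) : a <= b -> 0 < d ->
  (forall t x, nc t < d -> cont (K t) x) -> (forall x, cont (K1 0) x) ->
  (forall t x, nc t < d -> a <= x <= b -> cder (fun t => K t x) t (K1 t x)) ->
  (forall x : R, a <= x <= b -> cont (fun p : C * R => K1 p.1 p.2) (0, x)) ->
  cder (fun t => cint a b (K t)) 0 (cint a b (K1 0)).
Proof.
move=> ab d0 cK cK1 dK jK1; apply/cder_eps => e e0.
pose M := 4 * (b - a) + 1.
have M0 : 0 < M by rewrite ltr_wpDl // mulr_ge0 // subr_ge0.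
have e'0 : 0 < e / M by rewrite divr_gt0.
have /(@nbhs_nvP R C)[d1 d10 hd1] := uniform_near e'0 jK1.
exists (Num.min d d1) => [|h]; first by rewrite lt_min d0.
rewrite lt_min => /andP[hd hh1]; rewrite add0r.
have K00 x : cont (K 0) x by apply: cK; rewrite nc0.
have -> : cint a b (K h) - cint a b (K 0) - h * cint a b (K1 0) =
    cint a b (fun x => K h x - K 0 x - h * K1 0 x).
  have cKh x : cont (K h) x by exact: cK.
  have cKB x : cont (fun x => K h x - K 0 x) x by exact: contB (cKh x) (K00 x).
  have cKZ x : cont (fun x => h * K1 0 x) x by exact: contZ.
  by rewrite (cintB ab cKB cKZ) (cintB ab cKh K00) (cintZ h ab cK1).
apply: (@le_trans _ _ (2 * (2 * (e / M) * nc h) * (b - a))).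
  apply: cint_bound => // x; first by apply: contB; [apply: contB; [exact: cK | exact: K00] | exact: contZ].
  move=> xab.
  have := @cder_mean_value R (fun t => K t x) (fun t => K1 t x) 0 h (K1 0 x) (e / M).
  rewrite add0r; apply => y /andP[y0 y1]; rewrite add0r.
    apply: dK => //; rewrite ncM ncR ger0_norm //.
    by apply: le_lt_trans hd; rewrite ler_piMl // nc_ge0.
  apply/ltW/hd1 => //; rewrite nvE subr0 ncM ncR ger0_norm //.
  by apply: le_lt_trans hh1; rewrite ler_piMl // nc_ge0.
have -> : 2 * (2 * (e / M) * nc h) * (b - a) = (e * nc h) * (4 * (b - a) / M).
  by field; rewrite gt_eqF.
rewrite ler_piMr ?mulr_ge0 ?nc_ge0 // ?ltW //.
by rewrite ltr_pdivrMr // mul1r ltrDl.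
Qed.

(** The same argument for a real parameter. *)
Lemma rder_cint (K K1 : R -> R -> C) (s0 a b d : R) : a <= b -> 0 < d ->
  (forall t x, `|t - s0| < d -> cont (K t) x) -> (forall x, cont (K1 s0) x) ->
  (forall t x, `|t - s0| < d -> a <= x <= b -> rder (fun t => K t x) t (K1 t x)) ->
  (forall x : R, a <= x <= b -> cont (fun p : R * R => K1 p.1 p.2) (s0, x)) ->
  rder (fun t => cint a b (K t)) s0 (cint a b (K1 s0)).
Proof.
move=> ab d0 cK cK1 dK jK1 e e0.
pose M := 4 * (b - a) + 1.
have M0 : 0 < M by rewrite ltr_wpDl // mulr_ge0 // subr_ge0.
have e'0 : 0 < e / M by rewrite divr_gt0.
have /nbhs_normP[d1 /= d10 hd1] := uniform_near e'0 jK1.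
exists (Num.min d d1) => [|h]; first by rewrite lt_min d0.
rewrite lt_min => /andP[hd hh1].
have K00 x : cont (K s0) x by apply: cK; rewrite subrr normr0.
have Kh x : cont (K (s0 + h)) x by apply: cK; rewrite addrC addKr.
have -> : cint a b (K (s0 + h)) - cint a b (K s0) - h%:C * cint a b (K1 s0) =
    cint a b (fun x => K (s0 + h) x - K s0 x - h%:C * K1 s0 x).
  have cKB x : cont (fun x => K (s0 + h) x - K s0 x) x by exact: contB (Kh x) (K00 x).
  have cKZ x : cont (fun x => h%:C * K1 s0 x) x by exact: contZ.
  by rewrite (cintB ab cKB cKZ) (cintB ab Kh K00) (cintZ h%:C ab cK1).
apply: (@le_trans _ _ (2 * (2 * (e / M) * `|h|) * (b - a))).
  apply: cint_bound => // x; first by apply: contB; [apply: contB | exact: contZ].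
  move=> xab.
  have := @mean_value_ineq R (fun y => K (s0 + y * h) x) (fun y => h%:C * K1 (s0 + y * h) x) 0 1 (h%:C * K1 s0 x) (`|h| * (e / M)) ler01.
  rewrite mul1r mul0r addr0 subr0 mul1r mulr1 [X in _ <= X](_ : _ = 2 * (e / M) * `|h|); last by ring.
  apply => y /andP[y0 y1].
    have yh : `|s0 + y * h - s0| < d.
      rewrite addrC addKr normrM ger0_norm //.
      by apply: le_lt_trans hd; rewrite ler_piMl.
    have dy := dK _ x yh xab.
    move=> e1 e10.
    have [h0|h0] := eqVneq h 0.
      exists 1 => // k _; rewrite (_ : _ - _ - _ = 0); first by rewrite nc0 mulr_ge0 // ltW.
      by rewrite h0 !mulr0 mul0r mulr0 subrr subr0.
    have nh0 : 0 < `|h| by rewrite normr_gt0.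
    have [d2 d20 hd2] := dy _ (divr_gt0 e10 nh0).
    exists (d2 / `|h|); first by rewrite divr_gt0.
    move=> k; rewrite ltr_pdivlMr // -normrM => /hd2.
    rewrite (_ : s0 + y * h + k * h = s0 + (y + k) * h); last by ring.
    rewrite rmorphM mulrA => /le_trans; apply.
    rewrite normrM le_eqVlt; apply/orP; left; apply/eqP.
    by field; rewrite gt_eqF.
  rewrite -mulrBr ncM ncR ler_wpM2l //.
  apply/ltW/hd1 => //; rewrite /ball_ /= distrC addrC addKr normrM ger0_norm //.
  by apply: le_lt_trans hh1; rewrite ler_piMl.
have -> : 2 * (2 * (e / M) * `|h|) * (b - a) = (e * `|h|) * (4 * (b - a) / M).
  by field; rewrite gt_eqF.
rewrite ler_piMr ?mulr_ge0 // ?ltW //.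
by rewrite ltr_pdivrMr // mul1r ltrDl.
Qed.

End ParameterIntegrals.

(** * The unit circle and the exponential function *)

Section Circle.
Variable R : realType.
Local Notation C := R[i].

Definition cis (x : R) : C := cos x +i* sin x.

Lemma nc_cis x : nc (cis x) = 1.
Proof. by rewrite /= cos2Dsin2 sqrtr1. Qed.

Lemma cis_neq0 x : cis x != 0.
Proof. by rewrite -nc_gt0 nc_cis. Qed.

Lemma cis0 : cis 0 = 1.
Proof. by rewrite /cis cos0 sin0. Qed.

Lemma cisD x y : cis (x + y) = cis x * cis y.
Proof. by rewrite /cis cosD sinD; simpc; rewrite [cos x * sin y + _]addrC. Qed.

Lemma cis2pi : cis (pi *+ 2) = 1.
Proof. by rewrite /cis cos2pi sin2pi. Qed.

Lemma rder_cis x : rder cis x ('i * cis x).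
Proof.
apply: rder_ReIm => /=.
  rewrite mul0r mul1r sub0r; exact: is_derive_cos.
rewrite mul0r mul1r add0r; exact: is_derive_sin.
Qed.

Lemma cont_cis x : cont cis x.
Proof. exact: rder_continuous (rder_cis x). Qed.

Definition cexp (z : C) : C := (expR (Re z))%:C * cis (Im z).

Lemma nc_cexp z : nc (cexp z) = expR (Re z).
Proof. by rewrite /cexp ncM ncR nc_cis mulr1 ger0_norm // expR_ge0. Qed.

Lemma cexp_neq0 z : cexp z != 0.
Proof. by rewrite -nc_gt0 nc_cexp expR_gt0. Qed.

Lemma cexpD z w : cexp (z + w) = cexp z * cexp w.
Proof.
rewrite /cexp !raddfD /= expRD cisD rmorphM /=; ring.
Qed.

(** By the functional equation it is enough to treat the origin, where the
increment splits into those of expR and of cis and a product of both. *)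
Lemma cder_cexp z : cder cexp z (cexp z).
Proof.
have H0 : cder cexp 0 1.
  apply/cder_eps => e e0.
  have e4 : 0 < e / 4 by rewrite divr_gt0.
  have := is_derive_expR (0 : R) => /is_derive_eps/(_ _ e4)[d1 d10 h1].
  have [d2 d20 h2] := rder_cis 0 e4.
  exists (Num.min (Num.min d1 d2) (Num.min 1 (e / 4))).
    by rewrite !lt_min d10 d20 ltr01 e4.
  move=> h; rewrite !lt_min -!andbA => /and4P[k1 k2 k3 k4].
  rewrite add0r mulr1.
  case: h k1 k2 k3 k4 => s t; set h := s +i* t => k1 k2 k3 k4.
  have sh : `|s| <= nc h by exact: (nc_Re h).
  have th : `|t| <= nc h by exact: (nc_Im h).
  have := h1 s (le_lt_trans sh k1); rewrite add0r expR0 mulr1 => {}h1.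
  have := h2 t (le_lt_trans th k2); rewrite add0r cis0 mulr1 => {}h2.
  have -> : cexp h - cexp 0 - h = (expR s - 1 - s)%:C * cis t +
     (1 + s)%:C * (cis t - 1 - t%:C * 'i) + s%:C * (t%:C * 'i).
    rewrite /cexp /= expR0 cis0 (_ : h = s%:C + t%:C * 'i); last by rewrite /h; simpc.
    by rewrite !rmorphB !rmorphD /= rmorph1; ring.
  apply: le_trans (ncD _ _) _; rewrite (_ : e * nc h = e / 4 * nc h + 2 * (e / 4) * nc h + e / 4 * nc h); last by field.
  apply: lerD; last first.
    rewrite !ncM !ncR nci mulr1; apply: ler_pM => //.
    by apply: ltW; exact: le_lt_trans k4.
  apply: le_trans (ncD _ _) _; apply: lerD.
    rewrite ncM nc_cis mulr1 ncR; apply: le_trans h1 _.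
    by rewrite ler_wpM2l // ltW.
  rewrite ncM ncR -mulrA; apply: ler_pM => //; first exact: nc_ge0.
    apply: le_trans (ler_normD _ _) _; rewrite normr1 -[leRHS]/(1 + 1) lerD2l.
    by apply: ltW; exact: le_lt_trans k3.
  by apply: le_trans h2 _; rewrite ler_wpM2l // ltW.
apply/cder_shift.
have := cderZ (cexp z) H0; rewrite mulr1.
by rewrite (_ : (fun x => cexp z * cexp x) = fun s => cexp (z + s)) //; apply/funext => x; rewrite cexpD.
Qed.

End Circle.

(** * Goursat's theorem for rectangles *)

Section Goursat.
Variable R : realType.
Local Notation C := R[i].
Implicit Types (g : C -> C) (a b c d : R).

(** The integral of g dz along the boundary of [a, b] + i [c, d]. *)
Definition bdint g a b c d : C :=
  cint a b (fun x => g (x +i* c)) + 'i * cint c d (fun y => g (b +i* y))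
  - cint a b (fun x => g (x +i* d)) - 'i * cint c d (fun y => g (a +i* y)).

Lemma rder_horizontal c x : rder (fun t : R => t +i* c : C) x 1.
Proof.
apply: rder_ext (rder_line (c *i) 1 x) => t.
by rewrite mulr1; simpc.
Qed.

Lemma rder_vertical c x : rder (fun t : R => c +i* t : C) x 'i.
Proof.
apply: rder_ext (rder_line (c%:C) 'i x) => t.
by simpc.
Qed.

Lemma cont_horizontal g c : (forall z, cont g z) ->
  forall x, cont (fun x => g (x +i* c)) x.
Proof. by move=> cg x; exact: cont_comp (rder_continuous (rder_horizontal c x)) (cg _). Qed.

Lemma cont_vertical g c : (forall z, cont g z) ->
  forall x, cont (fun x => g (c +i* x)) x.
Proof. by move=> cg x; exact: cont_comp (rder_continuous (rder_vertical c x)) (cg _). Qed.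

Lemma bdint_splitx g a m b c d : (forall z, cont g z) ->
  a <= m -> m <= b -> bdint g a b c d = bdint g a m c d + bdint g m b c d.
Proof.
move=> cg am mb; rewrite /bdint.
rewrite (cint_split am mb (cont_horizontal c cg)).
rewrite (cint_split am mb (cont_horizontal d cg)); ring.
Qed.

Lemma bdint_splity g a b c m d : (forall z, cont g z) ->
  c <= m -> m <= d -> bdint g a b c d = bdint g a b c m + bdint g a b m d.
Proof.
move=> cg am mb; rewrite /bdint.
rewrite (cint_split am mb (cont_vertical a cg)).
rewrite (cint_split am mb (cont_vertical b cg)); ring.
Qed.

Lemma bdint_primitive g G a b c d : a <= b -> c <= d ->
  (forall z, cont g z) -> (forall z, cder G z (g z)) -> bdint g a b c d = 0.
Proof.
move=> ab cd cg Gg; rewrite /bdint.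
have H e : cint a b (fun x => g (x +i* e)) = G (b +i* e) - G (a +i* e).
  rewrite (cintE (P := fun x => G (x +i* e))) // => x _.
  by rewrite -[g _]mul1r; apply: rder_comp_cder (Gg _) _; exact: rder_horizontal.
have V e : 'i * cint c d (fun y => g (e +i* y)) = G (e +i* d) - G (e +i* c).
  rewrite -cintZ //; last exact: cont_vertical.
  rewrite (cintE (P := fun x => G (e +i* x))) // => x _.
  by apply: rder_comp_cder (Gg _) _; exact: rder_vertical.
by rewrite !H !V; ring.
Qed.

Lemma bdintB g h a b c d : a <= b -> c <= d ->
  (forall z, cont g z) -> (forall z, cont h z) ->
  bdint (fun z => g z - h z) a b c d = bdint g a b c d - bdint h a b c d.
Proof.
move=> ab cd cg ch; rewrite /bdint.
have H (u : C -> C) : (forall z, cont u z) -> forall e x, cont (fun x => u (x +i* e)) x.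
  by move=> cu e; exact: cont_horizontal e cu.
have V (u : C -> C) : (forall z, cont u z) -> forall e x, cont (fun y => u (e +i* y)) x.
  by move=> cu e; exact: cont_vertical e cu.
rewrite (cintB ab (H g cg c) (H h ch c)) (cintB ab (H g cg d) (H h ch d)).
rewrite (cintB cd (V g cg a) (V h ch a)) (cintB cd (V g cg b) (V h ch b)).
by ring.
Qed.

Lemma bdint_bound g a b c d (M : R) : a <= b -> c <= d ->
  (forall z, cont g z) ->
  (forall x y, a <= x <= b -> c <= y <= d -> nc (g (x +i* y)) <= M) ->
  nc (bdint g a b c d) <= 4 * M * ((b - a) + (d - c)).
Proof.
move=> ab cd cg gM; rewrite /bdint.
have H e : c <= e <= d -> nc (cint a b (fun x => g (x +i* e))) <= 2 * M * (b - a).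
  by move=> ce; apply: cint_bound => // [|x xab]; [exact: cont_horizontal | exact: gM].
have V e : a <= e <= b -> nc ('i * cint c d (fun y => g (e +i* y))) <= 2 * M * (d - c).
  by move=> ae; rewrite ncM nci mul1r; apply: cint_bound => // [|x xab]; [exact: cont_vertical | exact: gM].
have h1 := H c; have h2 := H d; have v1 := V a; have v2 := V b.
rewrite lexx cd in h1; rewrite lexx cd in h2; rewrite lexx ab in v1; rewrite lexx ab in v2.
have -> : 4 * M * (b - a + (d - c)) = 2 * M * (b - a) + 2 * M * (d - c) + 2 * M * (b - a) + 2 * M * (d - c) by ring.
apply: le_trans (ncB _ _) _; apply: lerD; last exact: v1.
apply: le_trans (ncB _ _) _; apply: lerD; last exact: h2.
by apply: le_trans (ncD _ _) _; apply: lerD; [exact: h1 | exact: v2].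
Qed.

Definition in_rect a b c d (z : C) := (a <= Re z <= b) && (c <= Im z <= d).

(** Differentiability relative to a closed rectangle, which makes sense at its
boundary points. *)
Definition cder_within a b c d g z (L : C) := forall e : R, 0 < e ->
  exists2 r : R, 0 < r & forall w, in_rect a b c d w -> nc (w - z) < r ->
    nc (g w - g z - (w - z) * L) <= e * nc (w - z).

(** The integrals over the four quarters add up to the integral over the
rectangle, so that one of them is at least a quarter of it. *)
Lemma bdint_quarter g (x y w h N : R) : (forall z, cont g z) -> 0 <= w -> 0 <= h ->
  N <= nc (bdint g x (x + w) y (y + h)) ->
  exists x' y', [/\ x <= x', x' + w / 2 <= x + w, y <= y', y' + h / 2 <= y + h &
    N / 4 <= nc (bdint g x' (x' + w / 2) y' (y' + h / 2))].
Proof.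
move=> cg w0 h0.
have w2 : 0 <= w / 2 by rewrite divr_ge0.
have h2 : 0 <= h / 2 by rewrite divr_ge0.
have ew : x + w = (x + w / 2) + w / 2 by field.
have eh : y + h = (y + h / 2) + h / 2 by field.
rewrite (@bdint_splitx _ x (x + w / 2)) ?lerDl ?ew ?lerDl //.
rewrite (@bdint_splity _ x _ y (y + h / 2)) ?lerDl ?eh ?lerDl //.
rewrite (@bdint_splity _ (x + w / 2) _ y (y + h / 2)) ?lerDl ?eh ?lerDl //.
move=> HN; apply: contrapT => HH.
have P x' y' : x <= x' -> x' + w / 2 <= x + w -> y <= y' -> y' + h / 2 <= y + h ->
    nc (bdint g x' (x' + w / 2) y' (y' + h / 2)) < N / 4.
  move=> e1 e2 e3 e4; rewrite ltNge; apply/negP => e5; apply: HH.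
  by exists x', y'; split => //; rewrite -?ew -?eh.
have xl : x <= x + w / 2 by rewrite lerDl.
have yl : y <= y + h / 2 by rewrite lerDl.
have xr : x + w / 2 <= x + w by rewrite ew lerDl.
have yr : y + h / 2 <= y + h by rewrite eh lerDl.
have xr' : x + w / 2 + w / 2 <= x + w by rewrite -ew.
have yr' : y + h / 2 + h / 2 <= y + h by rewrite -eh.
have p1 := P x y (lexx x) xr (lexx y) yr.
have p2 := P x (y + h / 2) (lexx x) xr yl yr'.
have p3 := P (x + w / 2) y xl xr' (lexx y) yr.
have p4 := P (x + w / 2) (y + h / 2) xl xr' yl yr'.
move: HN; rewrite leNgt => /negP; apply.
apply: le_lt_trans (ncD _ _) _.
rewrite (_ : N = (N / 4 + N / 4) + (N / 4 + N / 4)); last by field.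
by apply: ltrD; apply: le_lt_trans (ncD _ _) _; exact: ltrD.
Qed.

Lemma nested_intervals (f u : nat -> R) : (forall k, 0 <= u k) ->
  (forall j k, f j <= f (j + k)%N /\ f (j + k)%N + u (j + k)%N <= f j + u j) ->
  forall k, f k <= sup (range f) <= f k + u k.
Proof.
move=> u0 mf k.
have ub l : f l <= f k + u k.
  have [lk|/ltnW kl] := leqP l k.
    have := mf l (k - l)%N; rewrite subnKC; last exact: lk.
    move=> [+ _] => /le_trans; apply.
    by rewrite lerDl u0.
  have := mf k (l - k)%N; rewrite subnKC; last exact: kl.
  move=> [_]; apply: le_trans.
  by rewrite lerDl u0.
have hs : has_sup (range f).
  split; first by exists (f 0%N); exists 0%N.
  by exists (f k + u k) => _ [l _ <-]; exact: ub.
apply/andP; split; first by apply: ub_le_sup; [case: hs | exists k].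
by apply: ge_sup; [case: hs | move=> _ [l _ <-]; exact: ub].
Qed.

Lemma dist_in_interval a (u b c : R) : a <= b <= a + u -> a <= c <= a + u -> `|b - c| <= u.
Proof.
by move=> /andP[ab ba] /andP[ac ca]; rewrite ler_norml; apply/andP; split; lra.
Qed.

(** If the integral is not zero, repeated quartering gives nested rectangles
whose integrals decrease no faster than 4 ^ - k.  At their common point the
linear approximation of g integrates to zero, and the integral of what is left
is at most e times the square of the diameter, that is, less than 4 ^ - k. *)
Lemma goursat g (x0 y0 w h : R) : 0 <= w -> 0 <= h -> (forall z, cont g z) ->
  (forall z, in_rect x0 (x0 + w) y0 (y0 + h) z ->
    exists L, cder_within x0 (x0 + w) y0 (y0 + h) g z L) ->
  bdint g x0 (x0 + w) y0 (y0 + h) = 0.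
Proof.
move=> w0 h0 cg dg.
apply: contrapT => /eqP; rewrite -nc_gt0; set N := nc _ => N0.
have H k : 0 <= w / 2 ^+ k by rewrite divr_ge0 // exprn_ge0.
have H' k : 0 <= h / 2 ^+ k by rewrite divr_ge0 // exprn_ge0.
pose good k (p : R * R) := N / 4 ^+ k <=
  nc (bdint g p.1 (p.1 + w / 2 ^+ k) p.2 (p.2 + h / 2 ^+ k)).
pose nested k (p q : R * R) :=
  [/\ p.1 <= q.1, q.1 + w / 2 ^+ k.+1 <= p.1 + w / 2 ^+ k, p.2 <= q.2 &
      q.2 + h / 2 ^+ k.+1 <= p.2 + h / 2 ^+ k].
have e2 (u : R) k : u / 2 ^+ k.+1 = u / 2 ^+ k / 2.
  by rewrite exprSr invfM mulrA.
have e4 k : N / 4 ^+ k.+1 = N / 4 ^+ k / 4.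
  by rewrite exprSr invfM mulrA.
have step k p : good k p -> exists q, good k.+1 q /\ nested k p q.
  move=> /(bdint_quarter cg (H k) (H' k))[x' [y' [q1 q2 q3 q4 q5]]].
  by exists (x', y'); rewrite /good /nested /= e4 !e2.
pose nxt k p := xget p [set q | good k.+1 q /\ nested k p q].
pose s := fix s k := if k is k'.+1 then nxt k' (s k') else (x0, y0).
have sg k : good k (s k).
  elim: k => [|k IH]; first by rewrite /good /= !expr0 !divr1.
  rewrite /= /nxt; case: xgetP => [q _ []//|].
  by have [q hq] := step k _ IH; move/(_ q).
have sn k : nested k (s k) (s k.+1).
  rewrite /= /nxt; case: xgetP => [q _ []//|].
  by have [q hq] := step k _ (sg k); move/(_ q).
have mono1 j k : (s j).1 <= (s (j + k)%N).1 /\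
    (s (j + k)%N).1 + w / 2 ^+ (j + k) <= (s j).1 + w / 2 ^+ j.
  elim: k => [|k [IH1 IH2]]; first by rewrite addn0.
  rewrite addnS; have [q1 q2 _ _] := sn (j + k)%N.
  by split; [exact: le_trans IH1 q1 | exact: le_trans q2 IH2].
have mono2 j k : (s j).2 <= (s (j + k)%N).2 /\
    (s (j + k)%N).2 + h / 2 ^+ (j + k) <= (s j).2 + h / 2 ^+ j.
  elim: k => [|k [IH1 IH2]]; first by rewrite addn0.
  rewrite addnS; have [_ _ q1 q2] := sn (j + k)%N.
  by split; [exact: le_trans IH1 q1 | exact: le_trans q2 IH2].
have B1 := nested_intervals H mono1.
have B2 := nested_intervals H' mono2.
set x := sup _ in B1; set y := sup _ in B2.
have inr k X Y : (s k).1 <= X <= (s k).1 + w / 2 ^+ k ->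
    (s k).2 <= Y <= (s k).2 + h / 2 ^+ k -> in_rect x0 (x0 + w) y0 (y0 + h) (X +i* Y).
  have := mono1 0%N k; have := mono2 0%N k; rewrite /= !expr0 !divr1 !add0n.
  move=> [y1 y2] [x1 x2] /andP[X1 X2] /andP[Y1 Y2]; rewrite /in_rect /=.
  rewrite (le_trans x1 X1) (le_trans X2 x2).
  by rewrite (le_trans y1 Y1) (le_trans Y2 y2).
have [|L dL] := dg (x +i* y); first exact: (inr 0%N _ _ (B1 0%N) (B2 0%N)).
(* twice the factor 4 (w + h) ^ 2 of the final estimate, plus 1 to make it
   positive *)
have K0 : 0 < 8 * (w + h) ^+ 2 + 1.
  by rewrite ltr_wpDl // mulr_ge0 // exprn_ge0 // addr_ge0.
pose e := N / (8 * (w + h) ^+ 2 + 1).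
have e0 : 0 < e by rewrite divr_gt0.
have [r r0 hr] := dL _ e0.
have [k hk] : exists k, (w + h) / 2 ^+ k < r.
  exists (Num.bound ((w + h) / r)).
  have := archi_boundP (divr_ge0 (addr_ge0 w0 h0) (ltW r0)).
  rewrite ltr_pdivrMr // => hb.
  rewrite ltr_pdivrMr ?exprn_gt0 //; apply: (lt_le_trans hb).
  rewrite mulrC ler_pM2l // -natrX ler_nat; apply/ltnW/ltn_expl => //.
have := sg k; rewrite /good leNgt => /negP; apply.
(* the linear approximation of g at the limit point has a primitive *)
pose q z : C := g (x +i* y) + (z - x +i* y) * L.
have cq z : cont q z.
  apply: contD; first exact: cont_cst.
  by apply: contM; [apply: contB; [exact: cont_id|exact: cont_cst] | exact: cont_cst].
have a1 : (s k).1 <= (s k).1 + w / 2 ^+ k by rewrite lerDl.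
have a2 : (s k).2 <= (s k).2 + h / 2 ^+ k by rewrite lerDl.
have q0 : bdint q (s k).1 ((s k).1 + w / 2 ^+ k) (s k).2 ((s k).2 + h / 2 ^+ k) = 0.
  apply: (@bdint_primitive q (fun z => g (x +i* y) * z + (L / 2) * ((z - x +i* y) * (z - x +i* y)))) => // z.
  have -> : q z = g (x +i* y) * 1 + (L / 2) * (1 * (z - x +i* y) + (z - x +i* y) * 1).
    by rewrite /q; field.
  apply: cderD; first by apply: cderZ; exact: cder_id.
  by apply: cderZ; apply: cderM; apply: cderBc; exact: cder_id.
rewrite -[bdint g _ _ _ _]subr0 -q0 -bdintB //.
pose D := (w + h) / 2 ^+ k.
have D0 : 0 <= D by rewrite divr_ge0 ?addr_ge0 // exprn_ge0.
apply: (@le_lt_trans _ _ (4 * (e * D) * D)).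
  have -> : D = ((s k).1 + w / 2 ^+ k - (s k).1) + ((s k).2 + h / 2 ^+ k - (s k).2).
    by rewrite /D; ring.
  apply: bdint_bound => //; first by move=> z; exact: contB.
  move=> X Y hX hY; rewrite /q opprD addrA.
  have nX : nc (X +i* Y - x +i* y) <= D.
    apply: le_trans (nc_ReIm _) _; rewrite /= /D mulrDl.
    by apply: lerD; [exact: dist_in_interval hX (B1 k) | exact: dist_in_interval hY (B2 k)].
  have -> : (s k).1 + w / 2 ^+ k - (s k).1 + ((s k).2 + h / 2 ^+ k - (s k).2) = D.
    by rewrite /D; ring.
  apply: le_trans (hr _ (inr _ _ _ hX hY) (le_lt_trans nX hk)) _.
  by rewrite ler_pM2l.
have -> : 4 ^+ k = 2 ^+ k * 2 ^+ k :> R by rewrite -exprMn -natrM.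
rewrite /D.
have p0 : 0 < 2 ^+ k :> R by rewrite exprn_gt0.
rewrite ltr_pdivlMr ?mulr_gt0 //.
have -> : 4 * (e * ((w + h) / 2 ^+ k)) * ((w + h) / 2 ^+ k) * (2 ^+ k * 2 ^+ k) = e * (4 * (w + h) ^+ 2).
  by field; rewrite gt_eqF.
rewrite /e mulrAC ltr_pdivrMr // ltr_pM2l //.
have := sqr_ge0 (w + h); lra.
Qed.

End Goursat.

(** * Cauchy's formula for the derivative *)

Section CauchyDerivative.
Variable R : realType.
Local Notation C := R[i].
Local Notation tau := (pi *+ 2 : R).

Lemma tau_gt0 : 0 < tau.
Proof. by rewrite pmulrn_lgt0 // pi_gt0. Qed.

(** Clamping both coordinates extends a function given on a rectangle to a
continuous function on the plane. *)
Lemma cont_clamp (T : topologicalType) (f : T -> R) (a b : R) p :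
  cont f p -> cont (fun x => Num.max a (Num.min b (f x))) p.
Proof.
case=> cf; split; apply: (@continuous_max _ _ (fun=> a) (fun x => Num.min b (f x))).
  exact: cvg_cst.
by apply: (@continuous_min _ _ (fun=> b) f) => //; exact: cvg_cst.
Qed.

Lemma clamp_id (a b x : R) : a <= x <= b -> Num.max a (Num.min b x) = x.
Proof. by move=> /andP[ax xb]; rewrite min_r // max_r. Qed.

Lemma clamp_in (a b x : R) : a <= b -> a <= Num.max a (Num.min b x) <= b.
Proof. by move=> ab; rewrite le_max lexx /= ge_max ab /= ge_min lexx. Qed.

(** In the logarithmic coordinate w = e^z, the difference quotient of f at 0
is 2 i pi - periodic and holomorphic on a half-plane, so that its means over
vertical segments do not depend on the abscissa; they tend to f'(0) when the
abscissa tends to - oo. *)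
Lemma cauchy_derivative (f df : C -> C) (r : R) : 0 < r ->
  (forall t, nc t <= r -> cder f t (df t)) ->
  cint 0 tau (fun x => (f (r%:C * cis x) - f 0) / (r%:C * cis x)) =
  tau%:C * df 0.
Proof.
move=> r0 fd.
have t0 := tau_gt0.
pose g (z : C) := (f (cexp z) - f 0) / cexp z.
have gd z : Re z <= ln r -> exists l, cder g z l.
  move=> zr; have nr : nc (cexp z) <= r.
    by rewrite nc_cexp -[leRHS]lnK ?posrE // ler_expR.
  exists (df (cexp z) * cexp z / cexp z + (f (cexp z) - f 0) * (- (cexp z) ^- 2 * cexp z)).
  apply: (@cderM _ (fun z => f (cexp z) - f 0) (fun z => (cexp z)^-1)).
    by apply: cderBc; apply: (cder_comp (cder_cexp z)); exact: fd.
  by apply: cderV; [exact: cexp_neq0 | exact: cder_cexp].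
have cg z : Re z <= ln r -> cont g z.
  by move=> /gd[l]; exact: cder_continuous.
pose m s := cint 0 tau (fun y => g (s +i* y)).
have mE s0 : s0 <= ln r -> m (ln r) = m s0.
  move=> s0r.
  pose cl (z : C) := Num.max s0 (Num.min (ln r) (Re z)) +i* Num.max 0 (Num.min tau (Im z)).
  have ccl z : cont cl z.
    have -> : cl = fun z => (Num.max s0 (Num.min (ln r) (Re z)))%:C + 'i * (Num.max 0 (Num.min tau (Im z)))%:C.
      by apply/funext => u; rewrite /cl; simpc.
    apply: contD; first by apply: cont_realC; apply: cont_clamp; split; exact: continuous_Re.
    by apply: contZ; apply: cont_realC; apply: cont_clamp; split; exact: continuous_Im.
  pose G z := g (cl z).
  have cG z : cont G z.
    apply: cont_comp (ccl z) _; apply: cg => /=.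
    by have /andP[] := clamp_in (Re z) s0r.
  have := @goursat R G s0 0 (ln r - s0) tau _ (ltW t0) cG.
  have e1 : s0 + (ln r - s0) = ln r by rewrite addrC subrK.
  rewrite add0r e1 subr_ge0 => /(_ s0r).
  have clE z : in_rect s0 (ln r) 0 tau z -> cl z = z.
    by case: z => x y /andP[hx hy]; rewrite /cl /= !clamp_id.
  move=> H; have {H} : bdint G s0 (ln r) 0 tau = 0.
    apply: H => z hz.
    have /gd[l] : Re z <= ln r by move: hz => /andP[/andP[]].
    move=> /cder_eps dl; exists l => e /dl[d d0 hd]; exists d => // w hw wz.
    by rewrite /G !clE //; have := hd (w - z) wz; rewrite [z + _]addrC subrK.
  rewrite /bdint.
  have -> : cint s0 (ln r) (fun x => G (x +i* tau)) = cint s0 (ln r) (fun x => G (x +i* 0)).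
    apply: eq_cint => x hx; rewrite /G !clE; try by rewrite /in_rect /= hx lexx ltW.
    by rewrite /g /cexp /= cis2pi cis0.
  have alg (A B E : C) : A + 'i * B - A - 'i * E = 'i * (B - E) by ring.
  rewrite alg => /eqP.
  have i0 : ('i : C) != 0 by rewrite -nc_gt0 nci.
  rewrite mulf_eq0 (negbTE i0) /= subr_eq0 => /eqP.
  rewrite (_ : cint 0 tau (fun y => G (ln r +i* y)) = m (ln r)); last first.
    by apply: eq_cint => y hy; rewrite /G clE // /in_rect /= hy lexx s0r.
  rewrite (_ : cint 0 tau (fun y => G (s0 +i* y)) = m s0) //.
  by apply: eq_cint => y hy; rewrite /G clE // /in_rect /= hy lexx s0r.
have cv s y : s <= ln r -> cont (fun y => g (s +i* y)) y.
  move=> sr; apply: (@cont_comp _ _ _ (fun y : R => s +i* y : C) g).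
    exact: rder_continuous (rder_vertical _ _).
  exact: cg.
have -> : cint 0 tau (fun x => (f (r%:C * cis x) - f 0) / (r%:C * cis x)) = m (ln r).
  by apply: eq_cint => y _; rewrite /g /cexp /= lnK ?posrE.
apply/eqP; rewrite -subr_eq0; apply/eqP; apply: nc_small => e e0.
have e'0 : 0 < e / (2 * tau) by rewrite divr_gt0 // mulr_gt0.
have /cder_eps/(_ _ e'0)[d d0 hd] := fd 0 (eq_ind_r (fun x => x <= r) (ltW r0) (nc0 R)).
pose s0 := Num.min (ln r) (ln (d / 2)).
have s0r : s0 <= ln r by rewrite ge_min lexx.
rewrite (mE _ s0r).
have -> : m s0 - tau%:C * df 0 = cint 0 tau (fun y => g (s0 +i* y) - df 0).
  rewrite (cintB (ltW t0) (fun x => cv s0 x s0r) (fun x => cont_cst (df 0) x)).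
  by rewrite cint_cst ?subr0 // ltW.
have alg (u : R) : u != 0 -> e = 2 * (e / (2 * u)) * (u - 0).
  by move=> u0; field.
rewrite [leRHS](alg tau); last exact: lt0r_neq0.
apply: cint_bound; first exact: ltW.
  by move=> x; apply: contB; [exact: cv | exact: cont_cst].
move=> y _; rewrite /g; set w := cexp _.
have w0 : w != 0 by exact: cexp_neq0.
have nw : nc w < d.
  rewrite nc_cexp /=; apply: (@le_lt_trans _ _ (d / 2)).
    have d2 : 0 < d / 2 by rewrite divr_gt0.
    by rewrite -[leRHS]lnK ?posrE // ler_expR ge_min lexx orbT.
  by rewrite ltr_pdivrMr // ltr_pMr // ltr1n.
have := hd w nw; rewrite add0r => hw.
have -> : (f w - f 0) / w - df 0 = (f w - f 0 - w * df 0) / w by field.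
by rewrite ncM ncV ler_pdivrMr // nc_gt0.
Qed.

End CauchyDerivative.

Section Holomorphic.
Variables (R : realType) (V : normedModType R[i]).
Local Notation C := R[i].
Local Notation tau := (pi *+ 2 : R).
Implicit Types (D : set V) (F : V -> C) (p q u v : V) (t l : C).

Lemma is_derive_cder F p v l :
  is_derive p v F l <-> cder (fun t => F (p + t *: v)) 0 l.
Proof.
have E (h : C) : h != 0 -> nc (F (p + (0 + h) *: v) - F (p + 0 *: v) - h * l) =
    nv (h^-1 *: ((F \o shift p) (h *: v) - F p) - l : C) * nc h.
  move=> h0; rewrite nvE -ncM /= add0r scale0r addr0 [h *: v + p]addrC.
  congr nc; rewrite mulrBl [l * h]mulrC; congr (_ - _).
  by rewrite /GRing.scale /= mulrAC mulVf // mul1r.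
have key : cder (fun t => F (p + t *: v)) 0 l <->
    (fun h : C => h^-1 *: ((F \o shift p) (h *: v) - F p)) @ (0 : C)^' --> l.
  split=> [/cder_eps H|/(@cvg_nvP R _ _ _ C) H].
    apply/(@cvg_nvP R _ _ _ C) => e e0.
    have [d d0 hd] := H _ (divr_gt0 e0 (ltr0n _ 2)).
    rewrite near_withinE; apply: filterS (near_nv (0 : C) d0) => h /=.
    rewrite nvE subr0 => /hd k h0; have hp : 0 < nc h by rewrite nc_gt0.
    apply: (@le_lt_trans _ _ (e / 2)); first by rewrite -(ler_pM2r hp) -E.
    by rewrite ltr_pdivrMr // ltr_pMr // ltr1n.
  apply/cder_eps => e e0; have := H e e0; rewrite near_withinE.
  move=> /(@nbhs_nvP R C)[d d0 hd]; exists d => // h hh.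
  have [->|h0] := eqVneq h 0; first by rewrite addr0 mul0r subr0 subrr nc0 mulr0.
  rewrite E // ler_wpM2r ?nc_ge0 // ltW //; apply: hd => //.
  by rewrite nvE subr0.
rewrite key; split=> [[cf dfE]|cl].
  by have := cf; rewrite /derivable => /cvg_ex[/= l' cl']; rewrite -dfE /derive (cvg_lim _ cl').
by split; [apply/cvg_ex; exists l | exact/cvg_lim].
Qed.

Lemma derivable_cder F p v : derivable F p v ->
  cder (fun t => F (p + t *: v)) 0 ('D_v F p).
Proof. by move=> d; apply/is_derive_cder; split. Qed.

Lemma cder_line F p v t : derivable F (p + t *: v) v ->
  cder (fun t => F (p + t *: v)) t ('D_v F (p + t *: v)).
Proof.
move=> /derivable_cder H; apply/cder_shift.
rewrite (_ : (fun s => _) = fun s => F (p + t *: v + s *: v)) //.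
by apply/funext => s; rewrite scalerDl addrA.
Qed.

Lemma near_cder (f g : C -> C) t l (d : R) : 0 < d ->
  (forall s, nc (s - t) < d -> f s = g s) -> cder f t l -> cder g t l.
Proof.
move=> d0 fg /cder_eps H; apply/cder_eps => e /H[d1 d10 h1].
exists (Num.min d d1) => [|h]; first by rewrite lt_min d0.
rewrite lt_min => /andP[hd hd1]; rewrite -!fg ?subrr ?nc0 //; first exact: h1.
by rewrite [t + h]addrC addrK.
Qed.

(** Holomorphy in the sense of Gateaux.  It implies Frechet differentiability,
but it is the form in which holomorphy passes to integrals depending on a
parameter. *)
Definition ghol D F := forall p, D p -> cont F p /\ forall v, derivable F p v.

Lemma cauchy_formula D F p v (r : R) : ghol D F -> 0 < r ->
  (forall t, nc t <= r -> D (p + t *: v)) ->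
  'D_v F p = tau%:C^-1 *
    cint 0 tau (fun x => (F (p + (r%:C * cis x) *: v) - F p) / (r%:C * cis x)).
Proof.
move=> hF r0 Dt.
have := @cauchy_derivative R (fun t => F (p + t *: v)) (fun t => 'D_v F (p + t *: v)) r r0.
rewrite scale0r addr0 => ->; last by move=> t /Dt/hF[_ /(_ v)]; exact: cder_line.
by rewrite mulKf // fmorph_eq0 gt_eqF // tau_gt0.
Qed.

Lemma cont_affine p v (x : R) (r : C) : cont (fun x => p + (r * cis x) *: v) x.
Proof.
apply: contVD; first exact: cont_cst.
by apply: contVZ; [apply: contZ; exact: cont_cis | exact: cont_cst].
Qed.

Lemma cont_cauchy_kernel F p v (r : R) : 0 < r ->
  (forall x, cont F (p + (r%:C * cis x) *: v)) -> forall x,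
  cont (fun x => (F (p + (r%:C * cis x) *: v) - F p) / (r%:C * cis x)) x.
Proof.
move=> r0 cF x; apply: contM.
  by apply: contB; [exact: cont_comp (cont_affine p v x _) (cF x) | exact: cont_cst].
apply: contV; last by apply: contZ; exact: cont_cis.
by rewrite mulf_neq0 // ?cis_neq0 // fmorph_eq0 gt_eqF.
Qed.

Lemma nc_rcis (r x : R) : 0 < r -> nc (r%:C * cis x) = r.
Proof. by move=> r0; rewrite ncM ncR nc_cis mulr1 gtr0_norm. Qed.

(** The factor 4 combines the factor 2 of the bound on integrals with the two
terms of F - F p. *)
Lemma cauchy_estimate D F p v (r M : R) : ghol D F -> 0 < r ->
  (forall t, nc t <= r -> D (p + t *: v)) ->
  (forall t, nc t <= r -> nc (F (p + t *: v)) <= M) ->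
  nc ('D_v F p) <= 4 * M / r.
Proof.
move=> hF r0 Dt FM; rewrite (cauchy_formula hF r0 Dt) ncM ncV ncR.
have t0 := tau_gt0 R.
rewrite gtr0_norm // mulrC ler_pdivrMr //.
have -> : 4 * M / r * tau = 2 * (2 * M / r) * (tau - 0).
  by rewrite subr0; field; rewrite gt_eqF.
apply: cint_bound; first exact: ltW.
  by apply: cont_cauchy_kernel => // x; apply: (hF _ _).1; apply: Dt; rewrite nc_rcis.
move=> x _; rewrite ncM ncV nc_rcis // ler_pM2r ?invr_gt0 //.
apply: le_trans (ncB _ _) _; rewrite mulrDl mul1r; apply: lerD.
  by apply: FM; rewrite nc_rcis.
by have := FM 0; rewrite scale0r addr0 nc0; apply; exact: ltW.
Qed.

Lemma near_disc D p v (r : R) : open D ->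
  (forall t, nc t <= r -> D (p + t *: v)) ->
  \forall q \near p, forall t, nc t <= r -> D (q + t *: v).
Proof.
move=> oD Dt.
have /compact_near_coveringP cov := @compact_cdisc R r.
have := cov V (nbhs p) (fun q t => D (q + t *: v)) _.
move=> H; have {}H : \forall q \near p, [set t : C | nc t <= r] `<=` (fun t => D (q + t *: v)).
  apply: H => t /= /Dt Dpt.
  have [c] : cont (fun a : C * V => a.2 + a.1 *: v) (t, p).
    by apply: contVD; [exact: cont_snd|apply: contVZ; [exact: cont_fst|exact: cont_cst]].
  exact: (c D (open_nbhs_nbhs (conj oD Dpt))).
by apply: filterS H => q hq t; exact: hq.
Qed.

Lemma disc_in D p v : open D -> D p ->
  exists2 r : R, 0 < r & forall t, nc t <= r -> D (p + t *: v).
Proof.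
move=> oD Dp; have /nbhs_nvP[e e0 he] := open_nbhs_nbhs (conj oD Dp).
exists (e / (1 + nv v) / 2).
  by rewrite !divr_gt0 // ltr_pwDl // nv_ge0.
move=> t ht; apply: he; rewrite addrC addKr nvZ.
have M0 : 0 < 1 + nv v by rewrite ltr_pwDl // nv_ge0.
apply: (@le_lt_trans _ _ (e / (1 + nv v) / 2 * (1 + nv v))).
  by apply: ler_pM => //; [exact: nc_ge0|exact: nv_ge0|rewrite lerDr].
by rewrite mulrAC divfK ?gt_eqF // ltr_pdivrMr // ltr_pMr // ltr1n.
Qed.

Lemma ghol_cont_derive D F v p : open D -> ghol D F -> D p -> cont ('D_v F) p.
Proof.
move=> oD hF Dp; have [r r0 Dr] := disc_in v oD Dp.
have nD := near_disc oD Dr.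
apply: (@near_cont _ _ (fun q => tau%:C^-1 * cint 0 tau (fun x => (F (q + (r%:C * cis x) *: v) - F q) / (r%:C * cis x)))).
  by apply: filterS nD => q Dq; rewrite (cauchy_formula hF r0 Dq).
apply: contZ; apply: cont_cint; first exact/ltW/tau_gt0.
  apply: filterS nD => q Dq; apply: cont_cauchy_kernel => // x.
  by apply: (hF _ _).1; apply: Dq; rewrite nc_rcis.
move=> x _; apply: contM.
  apply: contB.
    apply: (@cont_comp _ _ _ (fun a : V * R => a.1 + (r%:C * cis a.2) *: v) F).
      apply: contVD; first exact: cont_fst.
      apply: contVZ; last exact: cont_cst.
      by apply: contZ; apply: (cont_comp (cont_snd _)); exact: cont_cis.
    by apply: (hF _ _).1; apply: Dr; rewrite nc_rcis.
  apply: (cont_comp (cont_fst _)).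
  exact: (hF _ Dp).1.
apply: contV; first by rewrite /= mulf_neq0 // ?cis_neq0 // fmorph_eq0 gt_eqF.
by apply: contZ; apply: (cont_comp (cont_snd _)); exact: cont_cis.
Qed.

(** Cauchy's formula writes 'D_v F as an integral over a circle of values of F,
which can be differentiated under the integral sign. *)
Lemma ghol_derive D F v : open D -> ghol D F -> ghol D ('D_v F).
Proof.
move=> oD hF p Dp; split; first exact: ghol_cont_derive hF Dp.
move=> u; have [r r0 Dr] := disc_in v oD Dp.
have /nbhs_nvP[e e0 he] := near_disc oD Dr.
pose d := e / (1 + nv u).
have M0 : 0 < 1 + nv u by rewrite ltr_pwDl // nv_ge0.
have d0 : 0 < d by rewrite divr_gt0.
have Dd t s : nc t < d -> nc s <= r -> D (p + t *: u + s *: v).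
  move=> td; apply: he; rewrite addrC addKr nvZ.
  apply: (@le_lt_trans _ _ (nc t * (1 + nv u))).
    by rewrite ler_wpM2l ?nc_ge0 // lerDr.
  by rewrite -ltr_pdivlMr.
have Dd0 t : nc t < d -> D (p + t *: u).
  by move=> td; have := Dd t 0 td; rewrite scale0r addr0 nc0; apply; exact: ltW.
pose K (t : C) (x : R) := (F (p + t *: u + (r%:C * cis x) *: v) - F (p + t *: u)) / (r%:C * cis x).
pose K1 (t : C) (x : R) := ('D_u F (p + t *: u + (r%:C * cis x) *: v) - 'D_u F (p + t *: u)) / (r%:C * cis x).
suff H : cder (fun t => cint 0 tau (K t)) 0 (cint 0 tau (K1 0)).
  suff [] : is_derive p u ('D_v F) (tau%:C^-1 * cint 0 tau (K1 0)) by [].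
  apply/is_derive_cder; apply: (near_cder d0 _ (cderZ _ H)) => s; rewrite subr0 => sd.
  by rewrite (cauchy_formula hF r0 (fun t => Dd s t sd)).
have cu q : D q -> cont ('D_u F) q by exact: ghol_cont_derive.
have d00 : nc (0 : C) < d by rewrite nc0.
apply: (cder_cint (d := d) (ltW (tau_gt0 R)) d0).
- move=> t x td; apply: cont_cauchy_kernel => // y.
  by apply: (hF _ _).1; apply: Dd; rewrite // nc_rcis.
- move=> x; apply: (@cont_cauchy_kernel ('D_u F) (p + 0 *: u) v r r0) => y.
  by apply: cu; apply: Dd; rewrite // nc_rcis.
- move=> t x td _; rewrite /K /K1.
  apply: cderMr; apply: cderB; last first.
    by apply: cder_line; apply: (hF _ _).2; exact: Dd0.
  rewrite (_ : (fun t => F _) = fun t => F (p + (r%:C * cis x) *: v + t *: u)).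
    rewrite addrAC; apply: cder_line; apply: (hF _ _).2; rewrite addrAC.
    by apply: Dd; rewrite // nc_rcis.
  by apply/funext => s; rewrite addrAC.
- move=> x _; apply: contM; last first.
    apply: contV; first by rewrite /= mulf_neq0 // ?cis_neq0 // fmorph_eq0 gt_eqF.
    by apply: contZ; apply: (cont_comp (cont_snd _)); exact: cont_cis.
  have c1 : cont (fun a : C * R => p + a.1 *: u) (0, x).
    apply: contVD; first exact: cont_cst.
    by apply: contVZ; [exact: cont_fst | exact: cont_cst].
  apply: contB; last by apply: (@cont_comp _ _ _ _ ('D_u F) _ c1); apply: cu; exact: Dd0.
  apply: (@cont_comp _ _ _ (fun a : C * R => p + a.1 *: u + (r%:C * cis a.2) *: v) ('D_u F)).
    apply: contVD => //; apply: contVZ; last exact: cont_cst.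
    by apply: contZ; apply: (cont_comp (cont_snd _)); exact: cont_cis.
  by apply: cu; apply: Dd; rewrite // nc_rcis.
Qed.

End Holomorphic.

Lemma addrKK (Z : zmodType) (a b c : Z) : a + b + c - a = b + c.
Proof. by rewrite -[a + b + c]addrA [LHS]addrC addKr. Qed.

(** * From Gateaux to Frechet differentiability *)

Section Frechet.
Variables (R : realType) (V : normedModType R[i]).
Local Notation C := R[i].
Implicit Types (D : set V) (F : V -> C) (p q u v h : V).

Lemma cont_continuous (T U : topologicalType) (f : T -> U) :
  (forall x, cont f x) -> continuous f.
Proof. by move=> cf p; have [] := cf p. Qed.

Lemma differentiable_cont (W : normedModType R[i]) (f : V -> W) p :
  differentiable f p -> cont f p.
Proof. by move=> df; split; exact: differentiable_continuous. Qed.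

Lemma differentiable_eps F (df : {linear V -> C}) p (M : R) :
  (forall h, nc (df h) <= M * nv h) ->
  (forall e : R, 0 < e -> exists2 d : R, 0 < d & forall h, nv h < d ->
     nc (F (p + h) - F p - df h) <= e * nv h) -> differentiable F p.
Proof.
move=> dfM H.
have cdf : continuous df.
  apply: cont_continuous => q; apply/cont_eps => e e0.
  have M0 : 0 < 1 + `|M| by rewrite ltr_pwDl.
  exists (e / (1 + `|M|)) => [|w hw]; first by rewrite divr_gt0.
  rewrite -(linearB df); apply: le_lt_trans (dfM _) _.
  apply: (@le_lt_trans _ _ (nv (w - q) * (1 + `|M|))); last by rewrite -ltr_pdivlMr.
  rewrite mulrC ler_wpM2l ?nv_ge0 //; apply: (le_trans (ler_norm _)).
  by rewrite lerDr.
have Ho : F \o shift p = cst (F p) + df +o_ 0 id.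
  apply/eqaddoP => _/posnumP[eps].
  have /posC_real[e e0 ->] : 0 < eps%:num by [].
  have [d d0 hd] := H e e0.
  apply/nbhs_nvP; exists d => // h; rewrite subr0 => /hd.
  move=> hle; rewrite [`|h|]normr_nv -rmorphM normr_nc lecR; apply: le_trans hle.
  rewrite le_eqVlt; apply/orP; left; apply/eqP; congr nc.
  by rewrite !fctE /cst /= [h + p]addrC; ring.
apply/diff_locallyP; have -> := diff_unique cdf Ho.
by split.
Qed.

Lemma derive_scalev F p v (a : C) : derivable F p v ->
  is_derive p (a *: v) F (a * 'D_v F p).
Proof.
move=> /derivable_cder H; apply/is_derive_cder.
have := @cder_comp R (fun t => F (p + t *: v)) (fun t => a * t) 0 a ('D_v F p).
rewrite mulr0 [a * 'D_v F p]mulrC.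
rewrite (_ : (fun t => F (p + t *: (a *: v))) = fun t => F (p + (a * t) *: v)); last first.
  by apply/funext => t; rewrite scalerA mulrC.
apply => //; rewrite -[X in cder _ _ X]mulr1; apply: cderZ; exact: cder_id.
Qed.

Lemma ghol_mean_value D F p h L (M : R) : ghol D F ->
  (forall t : R, 0 <= t <= 1 -> D (p + t%:C *: h)) ->
  (forall t : R, 0 <= t <= 1 -> nc ('D_h F (p + t%:C *: h) - L) <= M) ->
  nc (F (p + h) - F p - L) <= 2 * M.
Proof.
move=> hF Dh hM.
have := @cder_mean_value R (fun t => F (p + t *: h)) (fun t => 'D_h F (p + t *: h)) 0 1 L M.
rewrite add0r scale0r addr0 scale1r mul1r nc1 mulr1; apply => t t01.
  rewrite add0r mulr1; apply: cder_line; apply: (hF _ _).2; exact: Dh.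
by rewrite add0r mulr1 hM.
Qed.

(** The increment along t (u + v) is split at p + t u: from there the increment
along t v is governed by 'D_v F near p, which is continuous. *)
Lemma derive_addv D F p u v : open D -> ghol D F -> D p ->
  'D_(u + v) F p = 'D_u F p + 'D_v F p.
Proof.
move=> oD hF Dp.
suff /is_derive_cder[] : cder (fun t => F (p + t *: (u + v))) 0 ('D_u F p + 'D_v F p) by [].
have Hu := derivable_cder ((hF _ Dp).2 u).
apply/cder_eps => e e0.
have e2 : 0 < e / 2 by rewrite divr_gt0.
have e4 : 0 < e / 4 by rewrite divr_gt0.
move: Hu => /cder_eps/(_ _ e2)[d1 d10 h1].
have /cont_eps/(_ _ e4)[d2 d20 h2] := ghol_cont_derive v oD hF Dp.
have /nbhs_nvP[d3 d30 h3] := open_nbhs_nbhs (conj oD Dp).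
have M0 : 0 < 1 + (nv u + nv v) by rewrite ltr_pwDl // addr_ge0 // nv_ge0.
exists (Num.min d1 (Num.min d2 d3 / (1 + (nv u + nv v)))).
  by rewrite !lt_min d10 divr_gt0 // lt_min d20.
move=> t; rewrite lt_min => /andP[td1].
rewrite ltr_pdivlMr // lt_min => /andP[td2 td3].
have near_p x : 0 <= x <= 1 -> nv (t *: u + x%:C *: (t *: v)) <= nc t * (1 + (nv u + nv v)).
  move=> /andP[x0 x1]; apply: le_trans (nvD _ _) _; rewrite !nvZ ncR ger0_norm //.
  rewrite !mulrDr mulr1; apply: (@le_trans _ _ (nc t * nv u + nc t * nv v)).
    by rewrite lerD2l ler_piMl // mulr_ge0 ?nc_ge0 ?nv_ge0.
  by rewrite lerDr nc_ge0.
rewrite !add0r scale0r addr0.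
have -> : F (p + t *: (u + v)) - F p - t * ('D_u F p + 'D_v F p) =
  (F (p + t *: u + t *: v) - F (p + t *: u) - t * 'D_v F p) +
  (F (p + t *: u) - F p - t * 'D_u F p).
  rewrite scalerDr addrA.
  by move: (F (p + t *: u + t *: v)) (F (p + t *: u)) (F p) ('D_u F p) ('D_v F p) => ? ? ? ? ?; ring.
apply: le_trans (ncD _ _) _.
have -> : e * nc t = 2 * (e / 4 * nc t) + e / 2 * nc t by field.
apply: lerD; last by have := h1 t td1; rewrite add0r scale0r addr0.
have Dx x : 0 <= x <= 1 -> D (p + t *: u + x%:C *: (t *: v)).
  move=> x01; apply: h3; rewrite addrKK.
  exact: le_lt_trans (near_p x x01) td3.
apply: (ghol_mean_value hF) => // x x01.
have [_ ->] := derive_scalev t ((hF _ (Dx x x01)).2 v).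
rewrite -mulrBr ncM mulrC ler_wpM2r ?nc_ge0 // ltW //.
apply: h2; rewrite addrKK.
exact: le_lt_trans (near_p x x01) td2.
Qed.

(** The differential is linear because directional derivatives are
continuous, and the remainder is quadratic by the Cauchy estimates applied
twice along the increment. *)
Lemma ghol_differentiable D F p : open D -> ghol D F -> D p -> differentiable F p.
Proof.
move=> oD hF Dp.
have lin : linear (fun h => 'D_h F p).
  move=> a u v; rewrite (derive_addv _ _ oD hF Dp).
  by have [_ ->] := derive_scalev a ((hF _ Dp).2 u).
pose df : {linear V -> C} := HB.pack (fun h => 'D_h F p)
  (GRing.isLinear.Build C V C *:%R (fun h => 'D_h F p) lin).
have /cont_eps/(_ _ ltr01)[d1 d10 h1] := (hF _ Dp).1.
have /nbhs_nvP[d2 d20 h2] := open_nbhs_nbhs (conj oD Dp).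
pose r := Num.min d1 d2 / 2; have r0 : 0 < r by rewrite divr_gt0 // lt_min d10.
pose M := 1 + nc (F p); have M0 : 0 < M by rewrite ltr_pwDl // nc_ge0.
have rin q : nv (q - p) <= r -> D q /\ nc (F q) <= M.
  move=> qr; have qlt : nv (q - p) < Num.min d1 d2.
    by apply: (le_lt_trans qr); rewrite ltr_pdivrMr // ltr_pMr ?ltr1n // lt_min d10.
  move: qlt; rewrite lt_min => /andP[q1 q2]; split; first exact: h2.
  have -> : F q = (F q - F p) + F p by rewrite subrK.
  by apply: le_trans (ncD _ _) _; rewrite lerD2r ltW // h1.
(* Cauchy estimate for a derivative at q, the function being bounded by B on
   the ball of radius s + s' and q at distance at most s' of p *)
have est (G : V -> C) q h (s s' B : R) : ghol D G -> 0 < s ->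
    (forall x, nv (x - p) <= s + s' -> D x /\ nc (G x) <= B) -> 0 <= B ->
    nv (q - p) <= s' -> nc ('D_h G q) <= 4 * B / s * nv h.
  move=> hG s0 hB B0 qs.
  have [h0|h0] := eqVneq (nv h) 0.
    by rewrite (nv_eq0 h0) derive0 nc0 nv0 mulr0.
  have hp : 0 < nv h by rewrite lt_neqAle eq_sym h0 nv_ge0.
  have bnd t : nc t <= s / nv h -> nv (q + t *: h - p) <= s + s'.
    move=> ts; rewrite addrAC [X in nv X]addrC; apply: le_trans (nvD _ _) _; apply: lerD => //.
    by rewrite nvZ -ler_pdivlMr.
  have -> : 4 * B / s * nv h = 4 * B / (s / nv h) by field; rewrite !gt_eqF.
  apply: (cauchy_estimate hG) => [|t /bnd/hB[]//|t /bnd/hB[]//].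
  by rewrite divr_gt0.
have r4 : 0 < r / 4 by rewrite divr_gt0.
have E1 q h : nv (q - p) <= r / 2 -> nc ('D_h F q) <= 4 * M / (r / 2) * nv h.
  move=> hq; apply: (est F q h (r / 2) (r / 2) M hF _ _ (ltW M0) hq); first by rewrite divr_gt0.
  by move=> x; rewrite -splitr; exact: rin.
have E2 q h : nv (q - p) <= r / 4 ->
    nc ('D_h ('D_h F) q) <= 4 * (4 * M / (r / 2) * nv h) / (r / 4) * nv h.
  move=> hq; apply: (est ('D_h F) q h (r / 4) (r / 4) _ (ghol_derive h oD hF) r4 _ _ hq).
    move=> x hx; have hx2 : nv (x - p) <= r / 2.
      by apply: (le_trans hx); move: (r) r0 => r' ?; lra.
    by split; [apply: (rin _ _).1; apply: (le_trans hx2); lra | exact: E1].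
  apply: mulr_ge0; last exact: nv_ge0.
  by apply: divr_ge0; [apply: mulr_ge0 => //|apply: divr_ge0 => //]; exact: ltW.
apply: (@differentiable_eps F df p (4 * M / (r / 2))).
  by move=> h; apply: E1; rewrite subrr nv0 ltW // divr_gt0.
move=> e e0.
have [K K0 KE] : exists2 K : R, 0 < K & K = 4 * (4 * M / (r / 2)) / (r / 4).
  eexists; last by [].
  apply: divr_gt0 => //; apply: mulr_gt0 => //.
  by apply: divr_gt0; [exact: mulr_gt0 | exact: divr_gt0].
exists (Num.min (r / 4) (e / (4 * K))) => [|h].
  by rewrite lt_min r4 divr_gt0 // mulr_gt0.
rewrite lt_min => /andP[hr]; rewrite ltr_pdivlMr ?mulr_gt0 // => hK.
have seg t : 0 <= t <= 1 -> nv (p + t%:C *: h - p) <= r / 4.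
  move=> /andP[t0 t1]; rewrite addrC addKr nvZ ncR ger0_norm //.
  by apply: le_trans (ltW hr); rewrite ler_piMl // nv_ge0.
have segD t : 0 <= t <= 1 -> D (p + t%:C *: h).
  by move=> /seg ht; apply: (rin _ _).1; apply: (le_trans ht); lra.
have : nc (F (p + h) - F p - df h) <= 2 * (2 * (K * nv h * nv h)).
  apply: (ghol_mean_value hF) => // t t01 /=.
  have -> : 'D_h F (p + t%:C *: h) - 'D_h F p = 'D_h F (p + t%:C *: h) - 'D_h F p - 0 by rewrite subr0.
  have hDF := ghol_derive h oD hF.
  have sub x : 0 <= x <= 1 -> 0 <= x * t <= 1.
    by case/andP: t01 => t0 t1 /andP[x0 x1]; rewrite mulr_ge0 // mulr_ile1.
  apply: (ghol_mean_value hDF) => x x01; rewrite scalerA -rmorphM.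
    exact/segD/sub.
  rewrite subr0.
  have DxD := segD _ (sub x x01).
  have [_ ->] := derive_scalev t%:C ((hDF _ DxD).2 h).
  rewrite ncM ncR; case/andP: (t01) => t0 t1; rewrite ger0_norm //.
  apply: (@le_trans _ _ (nc ('D_h ('D_h F) (p + (x * t)%:C *: h)))).
    by rewrite ler_piMl // nc_ge0.
  apply: le_trans (E2 _ _ (seg _ (sub x x01))) _.
  by rewrite KE le_eqVlt; apply/orP; left; apply/eqP; ring.
move=> /le_trans; apply.
rewrite [leLHS](_ : _ = (nv h * (4 * K)) * nv h); last by ring.
by rewrite ler_wpM2r ?nv_ge0 // ltW.
Qed.

Lemma holomorphic_ghol D F : holomorphic D F -> ghol D F.
Proof.
move=> hF p /hF dF; split; first exact: differentiable_cont.
by move=> v; exact: diff_derivable.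
Qed.

End Frechet.

(** * Real derivatives of smooth functions *)

Section RealDerivatives.
Variables (R : realType) (n : nat).
Local Notation C := R[i].
Local Notation E := (coords R n).
Implicit Types (F G : E -> C) (D : set E) (p q u v w : E) (l : C) (j : 'I_n).

Lemma rquot_rder F v p l :
  rquot F v p @ (0 : R)^' --> l <-> rder (fun t : R => F (p + t%:C *: v)) 0 l.
Proof.
have Eq (h : R) : h != 0 -> nc (F (p + (0 + h)%:C *: v) - F (p + 0%:C *: v) - h%:C * l) =
    nv (rquot F v p h - l : C) * `|h|.
  move=> h0; rewrite nvE -ncR -ncM add0r scale0r addr0 /rquot.
  congr nc; rewrite mulrBl [l * _]mulrC; congr (_ - _).
  by rewrite /GRing.scale /= mulrAC -rmorphM mulVf // mul1r.
split=> [/(@cvg_nvP R _ _ _ C) H|H].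
  move=> e e0; have := H e e0; rewrite near_withinE.
  move=> /nbhs_normP[d /= d0 hd]; exists d => // h hh.
  have [->|h0] := eqVneq h 0.
    by rewrite addr0 mul0r subr0 subrr nc0 normr0 mulr0.
  rewrite Eq // ler_wpM2r // ltW //; apply: hd => //=.
  by rewrite sub0r normrN.
apply/(@cvg_nvP R _ _ _ C) => e e0.
have [d d0 hd] := H _ (divr_gt0 e0 (ltr0n _ 2)).
rewrite near_withinE; apply/nbhs_normP; exists d => //= h.
rewrite /ball_ /= sub0r normrN => /hd k h0; have hp : 0 < `|h| by rewrite normr_gt0.
apply: (@le_lt_trans _ _ (e / 2)); first by rewrite -(ler_pM2r hp) -Eq.
by rewrite ltr_pdivrMr // ltr_pMr // ltr1n.
Qed.

Lemma rderivable_rder F v p : rderivable F v p ->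
  rder (fun t : R => F (p + t%:C *: v)) 0 (rderive v F p).
Proof.
move=> cf; apply/rquot_rder; have := cf; rewrite /rderivable => /cvg_ex[/= l cl].
by rewrite /rderive (cvg_lim _ cl).
Qed.

Lemma rder_rderive F v p l : rder (fun t : R => F (p + t%:C *: v)) 0 l ->
  rderivable F v p /\ rderive v F p = l.
Proof.
move=> /rquot_rder cl; split; first by apply/cvg_ex; exists l.
exact/cvg_lim.
Qed.

Lemma rder_shift (g : R -> C) t l : rder (fun s => g (t + s)) 0 l <-> rder g t l.
Proof.
by split=> H e /H[d d0 hd]; exists d => // h /hd; rewrite add0r addr0.
Qed.

Lemma rder_rline F v p t : rderivable F v (p + t%:C *: v) ->
  rder (fun t : R => F (p + t%:C *: v)) t (rderive v F (p + t%:C *: v)).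
Proof.
move=> /rderivable_rder H; apply/rder_shift.
have Eq : (fun s : R => F (p + (t + s)%:C *: v)) =
    fun s : R => F (p + t%:C *: v + s%:C *: v).
  by apply/funext => s; rewrite rmorphD scalerDl addrA.
rewrite Eq; exact: H.
Qed.

Lemma near_rder (f g : R -> C) (t : R) l (d : R) : 0 < d ->
  (forall s, `|s - t| < d -> f s = g s) -> rder f t l -> rder g t l.
Proof.
move=> d0 fg H e /H[d1 d10 h1].
exists (Num.min d d1) => [|h]; first by rewrite lt_min d0.
rewrite lt_min => /andP[hd hd1]; rewrite -!fg ?subrr ?normr0 //; first exact: h1.
by rewrite [t + h]addrC addrK.
Qed.

Lemma rline_in D p v : open D -> D p ->
  exists2 d : R, 0 < d & forall t : R, `|t| < d -> D (p + t%:C *: v).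
Proof.
move=> oD Dp; have [r r0 hr] := disc_in v oD Dp.
by exists r => // t tr; apply: hr; rewrite ncR ltW.
Qed.

Lemma rderive_local D F G v p : open D -> D p -> (forall q, D q -> F q = G q) ->
  rderivable F v p -> rderivable G v p /\ rderive v F p = rderive v G p.
Proof.
move=> oD Dp FG /rderivable_rder H.
have [d d0 hd] := rline_in v oD Dp.
have /rder_rderive[h1 h2] : rder (fun t : R => G (p + t%:C *: v)) 0 (rderive v F p).
  by apply: near_rder d0 _ H => s; rewrite subr0 => /hd; exact: FG.
by split.
Qed.

Lemma smooth_cont D F p : smooth D F -> D p -> cont F p.
Proof. by move=> sF Dp; split; case: (sF [::] p Dp). Qed.

Lemma smooth_rderivable D F v p : smooth D F -> D p -> rderivable F v p.
Proof. by move=> sF Dp; case: (sF [::] p Dp) => _; exact. Qed.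

Lemma smooth_rderive D F v : smooth D F -> smooth D (rderive v F).
Proof. by move=> sF vs p Dp; have := sF (rcons vs v) p Dp; rewrite foldr_rcons. Qed.

Lemma smooth_sub D D' F : D' `<=` D -> smooth D F -> smooth D' F.
Proof. by move=> sD sF vs p /sD; exact: sF. Qed.

Lemma foldr_rderive_eq D F G vs : open D -> smooth D F ->
  (forall q, D q -> F q = G q) ->
  forall p, D p -> foldr (@rderive R n) F vs p = foldr (@rderive R n) G vs p.
Proof.
move=> oD sF FG; elim: vs => [|v vs IH] p Dp /=; first exact: FG.
exact: (rderive_local oD Dp IH ((sF vs p Dp).2 v)).2.
Qed.

Lemma smooth_eq D F G : open D -> (forall q, D q -> F q = G q) ->
  smooth D F -> smooth D G.
Proof.
move=> oD FG sF vs p Dp; have H := foldr_rderive_eq vs oD sF FG.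
have [cF dF] := sF vs p Dp; split.
  have [//] : cont (foldr (@rderive R n) G vs) p.
  apply: near_cont (Cont cF).
  by apply: filterS (open_nbhs_nbhs (conj oD Dp)) => q; exact: H.
by move=> v; exact: (rderive_local oD Dp H (dF v)).1.
Qed.

Lemma rder_lincomb F G v p (a b : C) : rderivable F v p -> rderivable G v p ->
  rderivable (fun q => a * F q + b * G q) v p /\
  rderive v (fun q => a * F q + b * G q) p = a * rderive v F p + b * rderive v G p.
Proof.
move=> /rderivable_rder hF /rderivable_rder hG; apply: rder_rderive.
exact: rderD (rderZ a hF) (rderZ b hG).
Qed.

Lemma foldr_rderive_lincomb D F G vs (a b : C) : open D -> smooth D F -> smooth D G ->
  forall p, D p -> foldr (@rderive R n) (fun q => a * F q + b * G q) vs p =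
    a * foldr (@rderive R n) F vs p + b * foldr (@rderive R n) G vs p.
Proof.
move=> oD sF sG; elim: vs => [//|v vs IH] p Dp /=.
have [dL EL] := rder_lincomb a b ((sF vs p Dp).2 v) ((sG vs p Dp).2 v).
have IH' q : D q -> a * foldr (@rderive R n) F vs q + b * foldr (@rderive R n) G vs q =
  foldr (@rderive R n) (fun q => a * F q + b * G q) vs q by move=> Dq; rewrite IH.
by have [_ <-] := rderive_local oD Dp IH' dL.
Qed.

Lemma smooth_lincomb D F G (a b : C) : open D -> smooth D F -> smooth D G ->
  smooth D (fun q => a * F q + b * G q).
Proof.
move=> oD sF sG vs p Dp.
have H := foldr_rderive_lincomb vs a b oD sF sG.
have H' q : D q -> a * foldr (@rderive R n) F vs q + b * foldr (@rderive R n) G vs q =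
  foldr (@rderive R n) (fun q => a * F q + b * G q) vs q by move=> Dq; rewrite H.
split.
  have [//] : cont (foldr (@rderive R n) (fun q => a * F q + b * G q) vs) p.
  apply: (@near_cont _ _ (fun q => a * foldr (@rderive R n) F vs q + b * foldr (@rderive R n) G vs q)).
    by apply: filterS (open_nbhs_nbhs (conj oD Dp)) => q; exact: H'.
  by apply: contD; apply: contZ; split; [case: (sF vs p Dp)|case: (sG vs p Dp)].
move=> v; have [dL EL] := rder_lincomb a b ((sF vs p Dp).2 v) ((sG vs p Dp).2 v).
exact: (rderive_local oD Dp H' dL).1.
Qed.

Lemma ghol_rderive D F v p : open D -> ghol D F -> D p ->
  rderivable F v p /\ rderive v F p = 'D_v F p.
Proof.
move=> oD hF Dp; apply: rder_rderive.
have := derivable_cder ((hF p Dp).2 v) => H.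
have := @rder_comp_cder R (fun t => F (p + t *: v)) (fun x : R => x%:C) 0 1 _ H (rder_id 0).
by rewrite mul1r.
Qed.

(** The real derivative of a holomorphic function along v is its complex
derivative, which is again holomorphic. *)
Lemma ghol_foldr D F vs : open D -> ghol D F -> exists2 G, ghol D G &
  forall p, D p -> foldr (@rderive R n) F vs p = G p.
Proof.
move=> oD hF; elim: vs => [|v vs [G hG FG]]; first by exists F.
exists ('D_v G); first exact: ghol_derive.
move=> p Dp /=; have [d1 <-] := ghol_rderive v oD hG Dp.
have GF q : D q -> G q = foldr (@rderive R n) F vs q by move=> Dq; rewrite FG.
by have [_ ->] := rderive_local oD Dp GF d1.
Qed.

Lemma ghol_smooth D F : open D -> ghol D F -> smooth D F.
Proof.
move=> oD hF vs p Dp; have [G hG FG] := ghol_foldr vs oD hF.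
have GF q : D q -> G q = foldr (@rderive R n) F vs q by move=> Dq; rewrite FG.
split.
  have [//] : cont (foldr (@rderive R n) F vs) p.
  apply: near_cont (hG p Dp).1.
  by apply: filterS (open_nbhs_nbhs (conj oD Dp)) => q; exact: GF.
move=> v; exact: (rderive_local oD Dp GF (ghol_rderive v oD hG Dp).1).1.
Qed.

Lemma rmean_value D F p v L (t M : R) : 0 <= t ->
  (forall x : R, 0 <= x <= t -> D (p + x%:C *: v)) -> smooth D F ->
  (forall x : R, 0 <= x <= t -> nc (rderive v F (p + x%:C *: v) - L) <= M) ->
  nc (F (p + t%:C *: v) - F p - t%:C * L) <= 2 * M * t.
Proof.
move=> t0 Dp sF hM.
have := @mean_value_ineq R (fun x : R => F (p + x%:C *: v))
  (fun x : R => rderive v F (p + x%:C *: v)) 0 t L M t0.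
rewrite subr0 scale0r addr0; apply => // x xt.
by apply: rder_rline; apply: smooth_rderivable sF _; exact: Dp.
Qed.

(** Divided by t ^ 2, the second difference of F along u and v tends to the
mixed derivative; as it is symmetric in u and v, the order of the derivatives
does not matter. *)
Lemma second_difference D F p u v (e : R) : open D -> smooth D F -> D p -> 0 < e ->
  exists2 d : R, 0 < d & forall t : R, 0 <= t < d ->
    nc (F (p + t%:C *: u + t%:C *: v) - F (p + t%:C *: u) - F (p + t%:C *: v) + F p
        - t%:C * (t%:C * rderive u (rderive v F) p)) <= e * t * t.
Proof.
move=> oD sF Dp e0.
have sG := smooth_rderive u (smooth_rderive v sF).
have e4 : 0 < e / 4 by rewrite divr_gt0.
have /cont_eps/(_ _ e4)[d2 d20 h2] := smooth_cont sG Dp.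
have /nbhs_nvP[d3 d30 h3] := open_nbhs_nbhs (conj oD Dp).
have M0 : 0 < 1 + (nv u + nv v) by rewrite ltr_pwDl // addr_ge0 // nv_ge0.
exists (Num.min d2 d3 / (1 + (nv u + nv v))).
  by rewrite divr_gt0 // lt_min d20.
move=> t /andP[t0]; rewrite ltr_pdivlMr // lt_min => /andP[td2 td3].
have near_p x y : 0 <= x <= t -> 0 <= y <= t ->
    nv (p + x%:C *: v + y%:C *: u - p) <= t * (1 + (nv u + nv v)).
  move=> /andP[x0 x1] /andP[y0 y1]; rewrite addrKK.
  apply: le_trans (nvD _ _) _; rewrite !nvZ !ncR !ger0_norm //.
  rewrite !mulrDr mulr1 addrC [t * nv u + _]addrC addrA.
  rewrite [X in _ <= X]addrC addrA.
  apply: (@le_trans _ _ (t * nv u + t * nv v)).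
    by apply: lerD; rewrite ler_wpM2r ?nv_ge0.
  by rewrite lerD2r lerDl.
have Dxy x y : 0 <= x <= t -> 0 <= y <= t -> D (p + x%:C *: v + y%:C *: u).
  by move=> hx hy; apply: h3; exact: le_lt_trans (near_p _ _ hx hy) td3.
have tt : 0 <= t <= t by rewrite t0 lexx.
have t00 : (0 : R) <= 0 <= t by rewrite lexx t0.
set G := rderive u (rderive v F) p.
have step x : 0 <= x <= t -> nc (rderive v F (p + x%:C *: v + t%:C *: u) -
    rderive v F (p + x%:C *: v) - t%:C * G) <= 2 * (e / 4) * t.
  move=> xt.
  apply: (@rmean_value D (rderive v F) (p + x%:C *: v) u G t (e / 4) t0
            (fun y => Dxy x y xt) (smooth_rderive v sF)) => y yt.
  rewrite ltW //; apply: h2.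
  exact: le_lt_trans (near_p _ _ xt yt) td2.
have := @mean_value_ineq R
  (fun x : R => F (p + t%:C *: u + x%:C *: v) - F (p + x%:C *: v))
  (fun x : R => rderive v F (p + t%:C *: u + x%:C *: v) - rderive v F (p + x%:C *: v))
  0 t (t%:C * G) (2 * (e / 4) * t) t0.
rewrite subr0 scale0r !addr0.
have -> : 2 * (2 * (e / 4) * t) * t = e * t * t by field.
have alg (a b c d k : C) : a - b - c + d - k = a - c - (b - d) - k by ring.
rewrite alg => H; apply: H => x xt.
  apply: rderB.
    apply: rder_rline; apply: smooth_rderivable sF _.
    by rewrite addrAC; exact: Dxy.
  apply: rder_rline; apply: smooth_rderivable sF _.
  by have := Dxy x 0 xt t00; rewrite scale0r addr0.
by rewrite [p + _ *: u + _]addrAC; exact: step.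
Qed.

Lemma schwarz D F p u v : open D -> smooth D F -> D p ->
  rderive u (rderive v F) p = rderive v (rderive u F) p.
Proof.
move=> oD sF Dp; apply/eqP; rewrite -subr_eq0; apply/eqP; apply: nc_small => e e0.
have e2 : 0 < e / 2 by rewrite divr_gt0.
have [d1 d10 h1] := second_difference u v oD sF Dp e2.
have [d2 d20 h2] := second_difference v u oD sF Dp e2.
pose t := Num.min d1 d2 / 2.
have m0 : 0 < Num.min d1 d2 by rewrite lt_min d10.
have t0 : 0 < t by rewrite divr_gt0.
have : t < Num.min d1 d2 by rewrite /t ltr_pdivrMr // ltr_pMr // ltr1n.
rewrite lt_min => /andP[t1 t2].
have k1 := h1 t; rewrite (ltW t0) t1 in k1; have {}k1 := k1 isT.
have k2 := h2 t; rewrite (ltW t0) t2 in k2; have {}k2 := k2 isT.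
rewrite [p + _ *: v + _ *: u]addrAC in k2.
rewrite -(ler_pM2l (mulr_gt0 t0 t0)).
have alg (a b c d x y s : C) : s * s * (x - y) =
    (a - c - b + d - s * (s * y)) - (a - b - c + d - s * (s * x)) by ring.
have -> (z : C) : t * t * nc z = nc (t%:C * t%:C * z).
  by rewrite !ncM !ncR gtr0_norm.
rewrite (alg (F (p + t%:C *: u + t%:C *: v)) (F (p + t%:C *: u)) (F (p + t%:C *: v)) (F p)).
apply: le_trans (ncB _ _) _.
have -> : t * t * e = e / 2 * t * t + e / 2 * t * t by field.
exact: (lerD k2 k1).
Qed.

End RealDerivatives.

(** * Words in the Wirtinger derivatives *)

Section CoordinateNorms.
Variable R : realType.
Local Notation C := R[i].

Lemma nv_coord m (v : 'rV[C]_m) j : nc (v 0 j) <= nv v.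
Proof.
apply/ler_addgt0Pl => e e0; rewrite addrC ltW //.
have : ball (0 : 'rV[C]_m) (nv v + e)%:C v.
  by rewrite -ball_normE /ball_ /= sub0r normrN normr_nv ltcR ltrDl.
move=> [_ /(_ 0 j)]; rewrite -ball_normE /ball_ /= mxE sub0r normrN.
by rewrite normr_nc ltcR.
Qed.

Lemma nv_le_coord m (v : 'rV[C]_m) (r : R) : 0 <= r ->
  (forall j, nc (v 0 j) <= r) -> nv v <= r.
Proof.
move=> r0 vr; apply/ler_addgt0Pl => e e0; rewrite addrC.
have re : 0 < r + e by rewrite ltr_wpDl.
have : ball (0 : 'rV[C]_m) (r + e)%:C v.
  split; first by rewrite ltcR.
  move=> i j; rewrite -ball_normE /ball_ /= mxE sub0r normrN normr_nc ltcR.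
  by rewrite (ord1 i); apply: le_lt_trans (vr j) _; rewrite ltrDl.
by rewrite -ball_normE /ball_ /= sub0r normrN normr_nv ltcR => /ltW.
Qed.

Lemma nv_delta m (j : 'I_m) (t : C) : nv (t *: delta_mx 0 j : 'rV[C]_m) <= nc t.
Proof.
apply: nv_le_coord; first exact: nc_ge0.
move=> k; rewrite !mxE eqxx /=; case: (k == j); rewrite ?mulr1 // mulr0 nc0.
exact: nc_ge0.
Qed.

Lemma nv_pair (V W : normedModType C) (v : V) (w : W) (r : R) :
  (nv ((v, w) : (V * W)%type) < r) = (nv v < r) && (nv w < r).
Proof.
have [r0|r0] := ltP 0 r; last first.
  rewrite !ltNge !(le_trans r0) ?nv_ge0 //.
have : ball ((0, 0) : (V * W)%type) r%:C (v, w) <-> (nv ((v, w) : (V * W)%type) < r).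
  by rewrite -ball_normE /ball_ /= -[X in X - _]/(0 : (V * W)%type) sub0r normrN normr_nv ltcR.
rewrite /ball /= /prod_ball /= -!ball_normE /ball_ /= !sub0r !normrN !normr_nv !ltcR.
by move=> H; apply/idP/idP => [/H[-> ->]//|/andP[? ?]]; apply/H.
Qed.

End CoordinateNorms.

Section Words.
Variables (R : realType) (n : nat).
Local Notation C := R[i].
Local Notation E := (coords R n).
Implicit Types (F G : E -> C) (D : set E) (p q u v w : E) (j : 'I_n).
Implicit Types (x y : bool * 'I_n) (l : seq (bool * 'I_n)).

(** The Wirtinger derivatives are such combinations of two real derivatives, and
it is in this form that they commute. *)
Definition real_op (a : C) u (b : C) v F : E -> C :=
  fun p => a * rderive u F p + b * rderive v F p.

Lemma real_op_smooth a u b v D F : open D -> smooth D F ->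
  smooth D (real_op a u b v F).
Proof. by move=> oD sF; apply: smooth_lincomb oD _ _; exact: smooth_rderive. Qed.

Lemma real_op_local a u b v D F G p : open D -> smooth D F ->
  (forall q, D q -> F q = G q) -> D p -> real_op a u b v F p = real_op a u b v G p.
Proof.
move=> oD sF FG Dp; rewrite /real_op.
rewrite (rderive_local oD Dp FG (smooth_rderivable (v := u) sF Dp)).2.
by rewrite (rderive_local oD Dp FG (smooth_rderivable (v := v) sF Dp)).2.
Qed.

Lemma real_opC a u b v a' u' b' v' D F p : open D -> smooth D F -> D p ->
  real_op a u b v (real_op a' u' b' v' F) p =
  real_op a' u' b' v' (real_op a u b v F) p.
Proof.
move=> oD sF Dp.
have L w (c d : C) w1 w2 : rderive w (real_op c w1 d w2 F) p =
    c * rderive w (rderive w1 F) p + d * rderive w (rderive w2 F) p.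
  have s1 := smooth_rderive w1 sF; have s2 := smooth_rderive w2 sF.
  exact: (rder_lincomb (v := w) c d (smooth_rderivable s1 Dp) (smooth_rderivable s2 Dp)).2.
rewrite [in LHS]/real_op (L u) (L v) [in RHS]/real_op (L u') (L v').
rewrite (schwarz u' u oD sF Dp) (schwarz u' v oD sF Dp).
rewrite (schwarz v' u oD sF Dp) (schwarz v' v oD sF Dp).
move: (rderive _ _ _) (rderive _ _ _) (rderive _ _ _) (rderive _ _ _) => A B A' B'.
ring.
Qed.

(** A letter (true, j) stands for d/dz_j and (false, j) for d/dzbar_j. *)
Definition wirtinger x : (E -> C) -> E -> C :=
  if x.1 then dz x.2 else dzbar x.2.

Lemma wirtingerE x F : wirtinger x F =
  real_op 2^-1 (re_dir R x.2) ((if x.1 then -1 else 1) * (2^-1 * 'i)) (im_dir R x.2) F.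
Proof.
case: x => [[] j]; apply/funext => p; rewrite /wirtinger /= /dz /dzbar /real_op /GRing.scale /=.
  by rewrite mulN1r mulNr mulrBr mulrA.
by rewrite mul1r mulrDr mulrA.
Qed.

(** Words, contrary to multi-indices, are extended by one derivative at a time,
which suits proofs by induction. *)
Definition wordD l F : E -> C := foldr wirtinger F l.

Lemma smooth_wirtinger x D F : open D -> smooth D F -> smooth D (wirtinger x F).
Proof. by move=> oD sF; rewrite wirtingerE; exact: real_op_smooth. Qed.

Lemma wirtinger_local x D F G p : open D -> smooth D F ->
  (forall q, D q -> F q = G q) -> D p -> wirtinger x F p = wirtinger x G p.
Proof. by move=> oD sF FG Dp; rewrite !wirtingerE; exact: real_op_local FG Dp. Qed.

Lemma smooth_word l D F : open D -> smooth D F -> smooth D (wordD l F).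
Proof.
by move=> oD sF; elim: l => [//|x l IH]; exact: (smooth_wirtinger x oD IH).
Qed.

Lemma word_local l D F G : open D -> smooth D F ->
  (forall q, D q -> F q = G q) -> forall p, D p -> wordD l F p = wordD l G p.
Proof.
move=> oD sF FG; elim: l => [|x l IH] p Dp /=; first exact: FG.
exact: (wirtinger_local x oD (smooth_word l oD sF) IH Dp).
Qed.

Lemma wirtinger_word x l D F p : open D -> smooth D F -> D p ->
  wordD (rcons l x) F p = wordD (x :: l) F p.
Proof.
move=> oD sF; elim: l p => [//|y l IH] p Dp /=.
rewrite (wirtinger_local _ oD _ IH Dp); last exact: smooth_word.
by rewrite /= !wirtingerE; apply: (real_opC _ _ _ _ _ _ _ _ oD _ Dp); exact: smooth_word.
Qed.

Lemma word_perm l l' D F p : open D -> smooth D F -> D p -> perm_eq l l' ->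
  wordD l F p = wordD l' F p.
Proof.
move=> oD sF; elim: l l' p => [|x l IH] l' p Dp pl.
  by move: pl => /perm_size/esym/size0nil ->.
have /path.splitPr xl : x \in l' by rewrite -(perm_mem pl) mem_head.
move: pl; case: xl => l1 l2 pl.
have pl' : perm_eq l (l1 ++ l2).
  by rewrite -(perm_cons x); apply: (perm_trans pl); rewrite -[x :: l2]/([:: x] ++ l2) perm_catCA perm_refl.
have -> : wordD (l1 ++ x :: l2) F p = wordD (rcons l1 x) (wordD l2 F) p.
  by rewrite /wordD -foldr_cat cat_rcons.
rewrite (wirtinger_word x l1 oD _ Dp); last exact: smooth_word.
rewrite /=; apply: (wirtinger_local x oD (smooth_word l oD sF) _ Dp) => q Dq.
by rewrite (IH (l1 ++ l2)) // /wordD foldr_cat.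
Qed.

Definition canonical_word (a b : 'I_n -> nat) : seq (bool * 'I_n) :=
  flatten [seq nseq (a j) (true, j) | j <- enum 'I_n] ++
  flatten [seq nseq (b j) (false, j) | j <- enum 'I_n].

Lemma multi_foldr (c : bool) (a : 'I_n -> nat) F :
  multi (fun j => wirtinger (c, j)) a F =
  wordD (flatten [seq nseq (a j) (c, j) | j <- enum 'I_n]) F.
Proof.
rewrite /multi /wordD; elim: (enum 'I_n) => //= j s IH.
rewrite foldr_cat -IH; elim: (a j) => //= k ->.
by [].
Qed.

Lemma multi_word (a b : 'I_n -> nat) F :
  multi (@dz R n) a (multi (@dzbar R n) b F) = wordD (canonical_word a b) F.
Proof.
rewrite -[multi _ b F]/(multi (fun j => wirtinger (false, j)) b F).
rewrite -[multi _ a _]/(multi (fun j => wirtinger (true, j)) a _).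
by rewrite !multi_foldr /wordD /canonical_word foldr_cat.
Qed.

(** Since the derivatives commute, only the numbers of occurrences of the
letters matter. *)
Lemma word_multi l : exists a b : 'I_n -> nat, forall D F p, open D -> smooth D F -> D p ->
  wordD l F p = multi (@dz R n) a (multi (@dzbar R n) b F) p.
Proof.
pose cnt (c : bool) (j : 'I_n) := count_mem (c, j) l.
exists (cnt true), (cnt false) => D F p oD sF Dp; rewrite multi_word.
apply: (word_perm oD sF Dp); apply/allP => -[c j] _; apply/eqP.
have cf (c' : bool) (a : 'I_n -> nat) : count_mem (c, j) (flatten [seq nseq (a i) (c', i) | i <- enum 'I_n]) = ((c' == c) * a j)%N.
  rewrite count_flatten -map_comp sumnE big_map big_enum /= (bigD1 j) //= big1.
    by rewrite count_nseq /= xpair_eqE eqxx andbT addn0.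
  by move=> i ij; rewrite count_nseq /= xpair_eqE (negbTE ij) andbF.
rewrite /= count_cat !cf /cnt.
by case: (c); rewrite ?mul1n ?mul0n ?addn0 ?add0n.
Qed.

Lemma im_dirE j : im_dir R j = 'i *: re_dir R j :> E.
Proof. by rewrite /im_dir /re_dir /GRing.scale /=; congr pair; rewrite scaler0. Qed.

(** The alternative about G gives one bound for both kinds of letters. *)
Lemma ghol_wirtinger x D F : open D -> ghol D F ->
  exists2 G, ghol D G & forall p, D p -> wirtinger x F p = G p /\
    (G p = 0 \/ G p = 'D_(re_dir R x.2) F p).
Proof.
move=> oD hF; set e := re_dir R x.2.
exists (if x.1 then 'D_e F else fun=> 0).
  case: (x.1); first exact: ghol_derive.
  by move=> p _; split=> [|v]; [exact: cont_cst | exact: derivable_cst].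
move=> p Dp; split; last by case: (x.1); [right|left].
rewrite wirtingerE /real_op im_dirE -/e.
rewrite (ghol_rderive e oD hF Dp).2 (ghol_rderive ('i *: e) oD hF Dp).2.
have [_ ->] := derive_scalev 'i ((hF p Dp).2 e).
have i2 : 'i * 'i = -1 :> C by rewrite -expr2 sqr_i.
case: (x.1).
  rewrite mulN1r mulNr mulrA -[2^-1 * 'i * 'i]mulrA i2.
  by move: ('D_e F p) => A; field.
rewrite mul1r mulrA -[2^-1 * 'i * 'i]mulrA i2.
by move: ('D_e F p) => A; field.
Qed.

Lemma ghol_word l D F : open D -> ghol D F ->
  exists2 G, ghol D G & forall p, D p -> wordD l F p = G p.
Proof.
move=> oD hF; elim: l => [|x l [G hG FG]]; first by exists F.
have [H hH HG] := ghol_wirtinger x oD hG; exists H => // p Dp.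
rewrite -(HG p Dp).1 /=; apply: (wirtinger_local x oD _ FG Dp).
by apply: smooth_word => //; exact: ghol_smooth.
Qed.

Lemma word_dzbar_ghol D F j : open D -> ghol D F -> forall p, D p -> dzbar j F p = 0.
Proof.
move=> oD hF p Dp; rewrite -[dzbar j F]/(wirtinger (false, j) F) wirtingerE /real_op im_dirE.
rewrite (ghol_rderive _ oD hF Dp).2 (ghol_rderive ('i *: _) oD hF Dp).2.
have [_ ->] := derive_scalev 'i ((hF p Dp).2 (re_dir R j)).
have i2 : 'i * 'i = -1 :> C by rewrite -expr2 sqr_i.
rewrite /= mul1r mulrA -[2^-1 * 'i * 'i]mulrA i2.
by move: ('D_(re_dir R j) F p) => A; field.
Qed.

(** Cauchy's estimate in one coordinate direction for each letter, at the cost of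
half of the radius rho. *)
Lemma word_cauchy l (rho : R) : 0 < rho -> exists2 K : R, 0 < K &
  forall D F q (M : R), open D -> ghol D F ->
  (forall v : 'rV[C]_n, nv v <= rho -> D (q + (v, 0)) /\ nc (F (q + (v, 0))) <= M) ->
  nc (wordD l F q) <= K * M.
Proof.
elim: l rho => [|x l IH] rho rho0.
  exists 1 => // D F q M oD hF /(_ 0); rewrite nv0 => /(_ (ltW rho0))[_].
  by rewrite -[(0, 0)]/(0 : E) addr0 mul1r.
have rho2 : 0 < rho / 2 by rewrite divr_gt0.
have [K K0 HK] := IH _ rho2.
exists (4 * K / (rho / 2)) => [|D F q M oD hF HM].
  by rewrite divr_gt0 // mulr_gt0.
have Dq : D q.
  by have [+ _] := HM 0 (eq_ind_r (fun a => a <= rho) (ltW rho0) (nv0 _)); rewrite -[(0, 0)]/(0 : E) addr0.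
have M0 : 0 <= M.
  have [_] := HM 0 (eq_ind_r (fun a => a <= rho) (ltW rho0) (nv0 _)).
  by apply: le_trans; exact: nc_ge0.
have [G hG FG] := ghol_word l oD hF.
have [H hH GH] := ghol_wirtinger x oD hG.
have -> : wordD (x :: l) F q = H q.
  rewrite -(GH q Dq).1 /=; apply: (wirtinger_local x oD _ FG Dq).
  by apply: smooth_word => //; exact: ghol_smooth.
(* the first letter gives zero or a complex derivative *)
have [_ [->|->]] := GH q Dq.
  rewrite nc0 mulr_ge0 // divr_ge0 ?mulr_ge0 // ltW //.
have -> : 4 * K / (rho / 2) * M = 4 * (K * M) / (rho / 2) by ring.
have inD t (v : 'rV[C]_n) : nc t <= rho / 2 -> nv v <= rho / 2 ->
    D (q + t *: re_dir R x.2 + (v, 0)) /\ nc (F (q + t *: re_dir R x.2 + (v, 0))) <= M.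
  move=> ht hv; have := HM (t *: delta_mx 0 x.2 + v).
  have -> : q + (t *: delta_mx 0 x.2 + v, 0) = q + t *: re_dir R x.2 + (v, 0).
    by rewrite -addrA; congr (_ + _); rewrite /re_dir; apply/eqP; rewrite xpair_eqE /= eqxx /= scaler0 addr0.
  apply; rewrite [rho]splitr; apply: le_trans (nvD _ _) _; apply: lerD => //.
  by apply: le_trans (nv_delta _ _) ht.
apply: (cauchy_estimate hG rho2) => t ht.
  have [+ _] := inD t 0 ht (eq_ind_r (fun a => a <= rho / 2) (ltW rho2) (nv0 _)).
  by rewrite -[(0, 0)]/(0 : E) addr0.
rewrite -FG; first by apply: (HK D) => // v hv; exact: inD.
have [+ _] := inD t 0 ht (eq_ind_r (fun a => a <= rho / 2) (ltW rho2) (nv0 _)).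
by rewrite -[(0, 0)]/(0 : E) addr0.
Qed.

End Words.

(** * Landau's inequality and exponential decay *)

Section Landau.
Variables (R : realType) (n : nat).
Local Notation C := R[i].
Local Notation E := (coords R n).
Implicit Types (F G : E -> C) (D : set E) (p q u v w : E) (j : 'I_n).
Implicit Types (x y : bool * 'I_n) (l : seq (bool * 'I_n)).

(** By Taylor's formula d * g1 0 differs from g d - g 0 by a multiple of
B d ^ 2. *)
Lemma landau (g g1 g2 : R -> C) (d A B : R) : 0 < d ->
  (forall t : R, 0 <= t <= d -> rder g t (g1 t)) ->
  (forall t : R, 0 <= t <= d -> rder g1 t (g2 t)) ->
  nc (g 0) <= A -> nc (g d) <= A ->
  (forall t : R, 0 <= t <= d -> nc (g2 t) <= B) ->
  nc (g1 0) <= 2 * A / d + 4 * B * d.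
Proof.
move=> d0 hg hg1 g0 gd hB.
have g10 (x : R) : 0 <= x <= d -> nc (g1 x - g1 0) <= 2 * B * d.
  move=> /andP[x0 xd].
  have B0 : 0 <= B by apply: le_trans (hB 0 _); rewrite ?nc_ge0 // lexx ltW.
  have := @mean_value_ineq R g1 g2 0 x 0 B x0.
  rewrite mulr0 !subr0 => H; apply: (@le_trans _ _ (2 * B * x)).
    apply: H => y /andP[y0 yx].
      by apply: hg1; rewrite y0 (le_trans yx).
    by rewrite subr0; apply: hB; rewrite y0 (le_trans yx).
  by rewrite ler_wpM2l // mulr_ge0.
have := @mean_value_ineq R g g1 0 d (g1 0) (2 * B * d) (ltW d0) hg g10.
rewrite subr0 => H.
rewrite -(ler_pM2l d0).
have -> : d * nc (g1 0) = nc ((g d - g 0) - (g d - g 0 - d%:C * g1 0)).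
  by rewrite -[in LHS](gtr0_norm d0) -ncR -ncM; congr nc; ring.
apply: le_trans (ncB _ _) _.
have -> : d * (2 * A / d + 4 * B * d) = (A + A) + 2 * (2 * B * d) * d.
  by field; rewrite gt_eqF.
apply: lerD => //; apply: le_trans (ncB _ _) _; exact: lerD.
Qed.

Lemma smooth_landau D F p v (d A B : R) : 0 < d -> smooth D F ->
  (forall t : R, 0 <= t <= d -> D (p + t%:C *: v)) ->
  nc (F p) <= A -> nc (F (p + d%:C *: v)) <= A ->
  (forall t : R, 0 <= t <= d -> nc (rderive v (rderive v F) (p + t%:C *: v)) <= B) ->
  nc (rderive v F p) <= 2 * A / d + 4 * B * d.
Proof.
move=> d0 sF Dp F0 Fd HB.
have := @landau (fun t => F (p + t%:C *: v)) (fun t => rderive v F (p + t%:C *: v))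
  (fun t => rderive v (rderive v F) (p + t%:C *: v)) d A B d0.
rewrite scale0r addr0; apply => //.
- move=> t td; exact: (rder_rline (smooth_rderivable sF (Dp t td))).
- move=> t td; exact: (rder_rline (smooth_rderivable (smooth_rderive v sF) (Dp t td))).
Qed.

Lemma rderive_dir (c : bool) j F p :
  rderive (if c then re_dir R j else im_dir R j) F p =
  (if c then 1 else 'i) * dz j F p + (if c then 1 else - 'i) * dzbar j F p.
Proof.
have i2 : 'i * 'i = -1 :> C by rewrite -expr2 sqr_i.
have i0 : ('i : C) != 0 by rewrite -nc_gt0 nci.
rewrite /dz /dzbar /GRing.scale /=.
case: c; first by move: (rderive _ _ _) (rderive _ _ _) => a b; field.
move: (rderive _ _ _) (rderive _ _ _) i2 i0 => a b; rewrite ?complexiE => i2 i0.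
rewrite (_ : _ + _ = - ('i * 'i) * b); last by field.
by rewrite i2 opprK mul1r.
Qed.

Lemma rderive2_words (c : bool) j l F D p : open D -> smooth D F -> D p ->
  forall e, e = (if c then re_dir R j else im_dir R j) ->
  nc (rderive e (rderive e (wordD l F)) p) <=
  nc (wordD [:: (true, j), (true, j) & l] F p) +
  nc (wordD [:: (true, j), (false, j) & l] F p) +
  nc (wordD [:: (false, j), (true, j) & l] F p) +
  nc (wordD [:: (false, j), (false, j) & l] F p).
Proof.
move=> oD sF Dp e ->; set e' := (if c then _ else _).
pose a : C := if c then 1 else 'i; pose b : C := if c then 1 else - 'i.
have na : nc a = 1 by rewrite /a; case: (c); rewrite ?nc1 ?nci.
have nb : nc b = 1 by rewrite /b; case: (c); rewrite ?nc1 ?ncN ?nci.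
have sG := smooth_word l oD sF; set G := wordD l F in sG *.
have Eq q : rderive e' G q = a * wirtinger (true, j) G q + b * wirtinger (false, j) G q.
  exact: rderive_dir.
have -> : rderive e' G = fun q => a * wirtinger (true, j) G q + b * wirtinger (false, j) G q.
  by apply/funext => q; exact: Eq.
have sT := smooth_wirtinger (true, j) oD sG.
have sN := smooth_wirtinger (false, j) oD sG.
rewrite (rder_lincomb a b (smooth_rderivable (v := e') sT Dp) (smooth_rderivable (v := e') sN Dp)).2.
have E2 H : rderive e' H p = a * wirtinger (true, j) H p + b * wirtinger (false, j) H p.
  exact: rderive_dir.
rewrite !E2 /wordD [foldr _ F _]/= -[foldr _ F l]/G.
rewrite [foldr _ F _]/= -[foldr _ F l]/G [foldr _ F _]/= -[foldr _ F l]/G [foldr _ F _]/= -[foldr _ F l]/G.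
move: (wirtinger _ _ p) (wirtinger _ _ p) (wirtinger _ _ p) (wirtinger _ _ p) => A1 A2 A3 A4.
have -> : nc A4 + nc A2 + nc A3 + nc A1 = (nc A4 + nc A3) + (nc A2 + nc A1) by ring.
apply: le_trans (ncD _ _) _; rewrite !ncM na nb !mul1r.
by apply: lerD; apply: le_trans (ncD _ _) _; rewrite !ncM na nb !mul1r.
Qed.

(** If all derivatives grow subexponentially and the function itself decays
exponentially, then its derivatives decay exponentially: Landau's inequality
bounds a first derivative by the geometric mean of the function and of its
second derivatives.  By induction on the word, half of the room rho around Q
being used for each letter. *)
Lemma words_decay D F (N : E -> R) (Q : set E) (rho : R) l :
  open D -> smooth D F -> 0 < rho ->
  (forall q, 0 <= N q) -> (forall q (v : 'rV[C]_n), N (q + (v, 0)) = N q) ->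
  (forall q (v : 'rV[C]_n), Q q -> nv v <= rho -> D (q + (v, 0))) ->
  (exists h A : R, [/\ 0 < h, 0 < A & forall q (v : 'rV[C]_n), Q q -> nv v <= rho ->
     nc (F (q + (v, 0))) <= A * expR (- h * N q)]) ->
  (forall l h, 0 < h -> exists A : R, forall q (v : 'rV[C]_n), Q q -> nv v <= rho ->
     nc (wordD l F (q + (v, 0))) <= A * expR (h * N q)) ->
  exists h A : R, [/\ 0 < h, 0 < A & forall q, Q q ->
     nc (wordD l F q) <= A * expR (- h * N q)].
Proof.
move=> oD sF rho0 N0 Nv QD HF Hl.
elim: l Q rho rho0 QD HF Hl => [|[c j] l IH] Q rho rho0 QD HF Hl.
  have [h [A [h0 A0 HA]]] := HF; exists h, A; split=> // q Qq.
  by have := HA q 0 Qq; rewrite nv0 -[(0, 0)]/(0 : E) addr0; apply; exact: ltW.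
have rho2 : 0 < rho / 2 by rewrite divr_gt0.
pose Q' := [set q | exists q0 (v : 'rV[C]_n), [/\ Q q0, nv v <= rho / 2 & q = q0 + (v, 0)]].
have Q'E q (w : 'rV[C]_n) : Q' q -> nv w <= rho / 2 ->
    exists q0 (v : 'rV[C]_n), [/\ Q q0, nv v <= rho, q + (w, 0) = q0 + (v, 0) & N q = N q0].
  move=> [q0 [v [Qq0 hv ->]]] hw; exists q0, (v + w); split => //.
    by rewrite [rho]splitr; apply: le_trans (nvD _ _) _; exact: lerD.
  by rewrite -addrA; congr (_ + _); apply/eqP; rewrite xpair_eqE /= addr0 !eqxx.
have [] := IH Q' (rho / 2) rho2.
- by move=> q w Q'q hw; have [q0 [v [Qq0 hv -> _]]] := Q'E q w Q'q hw; exact: QD.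
- have [h [A [h0 A0 HA]]] := HF; exists h, A; split=> // q w Q'q hw.
  by have [q0 [v [Qq0 hv -> ->]]] := Q'E q w Q'q hw; exact: HA.
- move=> l' h h0; have [A HA] := Hl l' h h0; exists A => q w Q'q hw.
  by have [q0 [v [Qq0 hv -> ->]]] := Q'E q w Q'q hw; exact: HA.
move=> h1 [A1 [h10 A10 H1]].
have h4 : 0 < h1 / 4 by rewrite divr_gt0.
have [B1 HB1] := Hl [:: (true, j), (true, j) & l] _ h4.
have [B2 HB2] := Hl [:: (true, j), (false, j) & l] _ h4.
have [B3 HB3] := Hl [:: (false, j), (true, j) & l] _ h4.
have [B4 HB4] := Hl [:: (false, j), (false, j) & l] _ h4.
pose B := `|B1| + `|B2| + `|B3| + `|B4|.
have B0 : 0 <= B by rewrite !addr_ge0.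
pose K := 4 * A1 / rho + 2 * B * rho.
have K0 : 0 < K by rewrite ltr_pwDl ?divr_gt0 ?mulr_gt0 // !mulr_ge0 // ltW.
have sG := smooth_word l oD sF.
have key (b : bool) q : Q q ->
    nc (rderive (if b then re_dir R j else im_dir R j) (wordD l F) q) <= K * expR (- (h1 / 4) * N q).
  move=> Qq; set e := if b then _ else _.
  (* Landau's inequality bounds the derivative by exp (- h1 N) / d plus
     exp (h1 N / 4) d, up to constants; this step d makes both terms decay *)
  pose d := rho / 2 * expR (- (h1 / 2) * N q).
  have d0 : 0 < d by rewrite mulr_gt0 // expR_gt0.
  have dr : d <= rho / 2.
    rewrite /d ler_piMr //; first exact: ltW.
    rewrite -[leRHS]expR0 ler_expR mulNr oppr_le0 mulr_ge0 //.
    by rewrite divr_ge0 // ltW.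
  have seg (t : R) : 0 <= t <= d -> exists2 v : 'rV[C]_n, nv v <= rho / 2 & t%:C *: e = (v, 0).
    move=> /andP[t0 td]; exists ((t%:C * (if b then 1 else 'i)) *: delta_mx 0 j).
      apply: le_trans (nv_delta _ _) _; rewrite ncM ncR ger0_norm //.
      by rewrite (_ : nc _ = 1) ?mulr1 ?(le_trans td) //; case: (b); rewrite ?nc1 ?nci.
    rewrite /e; case: (b); rewrite ?mulr1 /re_dir /im_dir /GRing.scale /=; congr pair; rewrite ?scaler0 //.
    by rewrite scalerA.
  have rho_rho2 (v : 'rV[C]_n) : nv v <= rho / 2 -> nv v <= rho.
    by move=> /le_trans; apply; rewrite ler_pdivrMr // ler_pMr // ler1n.
  have Nq (v : 'rV[C]_n) : N (q + (v, 0)) = N q by exact: Nv.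
  have HQ' (v : 'rV[C]_n) : nv v <= rho / 2 -> Q' (q + (v, 0)) by move=> hv; exists q, v.
  have HA (v : 'rV[C]_n) : nv v <= rho / 2 ->
      nc (wordD l F (q + (v, 0))) <= A1 * expR (- h1 * N q).
    by move=> hv; have := H1 _ (HQ' v hv); rewrite Nq.
  have HD (t : R) : 0 <= t <= d -> D (q + t%:C *: e).
    by move=> /seg[v hv ->]; apply: QD => //; exact: rho_rho2.
  have L := @smooth_landau D (wordD l F) q e d (A1 * expR (- h1 * N q)) (B * expR (h1 / 4 * N q)) d0 sG HD.
  apply: le_trans (L _ _ _) _.
  - by have := HA 0; rewrite nv0 -[(0, 0)]/(0 : E) addr0; apply; exact: ltW.
  - by have [|v hv ->] := seg d; [rewrite lexx ltW | exact: HA].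
  - move=> t td; have W2 := @rderive2_words b j l F D _ oD sF (HD t td) e (erefl _); apply: (le_trans W2).
    have [v /rho_rho2 hv ->] := seg t td.
    have M (a : R) : a * expR (h1 / 4 * N q) <= `|a| * expR (h1 / 4 * N q).
      by rewrite ler_wpM2r ?expR_ge0 // ler_norm.
    rewrite /B !mulrDl.
    apply: lerD; last by apply: le_trans (HB4 q v Qq hv) _; exact: M.
    apply: lerD; last by apply: le_trans (HB3 q v Qq hv) _; exact: M.
    apply: lerD; last by apply: le_trans (HB2 q v Qq hv) _; exact: M.
    by apply: le_trans (HB1 q v Qq hv) _; exact: M.
  rewrite /K [leRHS]mulrDl; apply: lerD.
    have -> : 2 * (A1 * expR (- h1 * N q)) / d =
        4 * A1 / rho * (expR (- h1 * N q) * expR (h1 / 2 * N q)).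
      have -> : d = rho / 2 * (expR (h1 / 2 * N q))^-1 by rewrite /d mulNr expRN.
      have : expR (h1 / 2 * N q) != 0 by rewrite gt_eqF // expR_gt0.
      move: (expR _) (expR _) => y y' y0.
      by field; rewrite y0 gt_eqF.
    rewrite ler_pM2l ?divr_gt0 ?mulr_gt0 // -expRD ler_expR -mulrDl.
    by rewrite ler_wpM2r //; move: (h1) h10 => h ?; lra.
  have -> : 4 * (B * expR (h1 / 4 * N q)) * d =
      2 * B * rho * (expR (h1 / 4 * N q) * expR (- (h1 / 2) * N q)).
    by rewrite /d; field.
  apply: ler_wpM2l; first by rewrite !mulr_ge0 // ltW.
  rewrite -expRD ler_expR -mulrDl ler_wpM2r //.
  by move: (h1) h10 => h ?; lra.
exists (h1 / 4), K; split => // q Qq.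
have k1 := key true q Qq; have k2 := key false q Qq.
have -> : wordD ((c, j) :: l) F q = wirtinger (c, j) (wordD l F) q by [].
rewrite wirtingerE /real_op -[(c, j).2]/j -[(c, j).1]/c.
move: (rderive (re_dir R j) _ q) (rderive (im_dir R j) _ q) (K * _) k1 k2 => a a' M k1 k2.
have n2 : nc (2^-1 : C) = 2^-1.
  by rewrite ncV -[2 in LHS](rmorph_nat (real_complex R) 2) ncR ger0_norm.
have nsg : nc (if c then -1 else 1 : C) = 1 by case: (c); rewrite ?ncN nc1.
apply: le_trans (ncD _ _) _; rewrite !ncM nci mulr1 nsg mul1r n2 -mulrDr.
rewrite -ler_pdivlMl ?invr_gt0 // invrK (_ : 2 * M = M + M); last by ring.
exact: lerD.
Qed.

End Landau.

(** * The Cauchy-Pompeiu estimate *)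

Section WirtingerDifferential.
Variables (R : realType) (n : nat).
Local Notation C := R[i].
Local Notation E := (coords R n).
Implicit Types (F : E -> C) (D : set E) (p q u v w : E) (j : 'I_n).

Lemma rder_scale (g : R -> C) (c x t : R) (l : C) : rder g (c + t * x) l ->
  rder (fun s => g (c + s * x)) t (x%:C * l).
Proof.
move=> H e e0.
have [x0|x0] := eqVneq x 0.
  exists 1 => // k _; rewrite (_ : _ - _ - _ = 0); first by rewrite nc0 mulr_ge0 // ltW.
  by rewrite x0 !mulr0 mul0r mulr0 subrr subr0.
have nx : 0 < `|x| by rewrite normr_gt0.
have [d d0 hd] := H _ (divr_gt0 e0 nx).
exists (d / `|x|); first by rewrite divr_gt0.
move=> k; rewrite ltr_pdivlMr // -normrM => /hd.
rewrite (_ : c + t * x + k * x = c + (t + k) * x); last by ring.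
rewrite rmorphM mulrA => /le_trans; apply.
rewrite normrM le_eqVlt; apply/orP; left; apply/eqP.
by field; rewrite gt_eqF.
Qed.

Lemma smooth_increment D F p v (x : R) L (M : R) : smooth D F ->
  (forall t : R, `|t| <= `|x| -> D (p + t%:C *: v)) ->
  (forall t : R, `|t| <= `|x| -> nc (rderive v F (p + t%:C *: v) - L) <= M) ->
  nc (F (p + x%:C *: v) - F p - x%:C * L) <= 2 * M * `|x|.
Proof.
move=> sF Dp HM.
have tx (t : R) : 0 <= t <= 1 -> `|0 + t * x| <= `|x|.
  by move=> /andP[t0 t1]; rewrite add0r normrM ger0_norm // ler_piMl.
have := @mean_value_ineq R (fun t => F (p + (0 + t * x)%:C *: v))
  (fun t => x%:C * rderive v F (p + (0 + t * x)%:C *: v)) 0 1 (x%:C * L) (`|x| * M) ler01.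
rewrite mul1r add0r mul0r addr0 scale0r addr0 subr0 mul1r mulr1.
rewrite (_ : 2 * (`|x| * M) = 2 * M * `|x|); last by ring.
apply => t t01.
  apply: (@rder_scale (fun s : R => F (p + s%:C *: v))).
  exact: (rder_rline (smooth_rderivable sF (Dp _ (tx t t01)))).
by rewrite -mulrBr ncM ncR ler_wpM2l // HM // tx.
Qed.

(** The increment along h is the sum of a horizontal and of a vertical one, and
partial derivatives are continuous. *)
Lemma smooth_rdiff0 D F p j : open D -> smooth D F -> D p ->
  rdiff (fun t : C => F (p + t *: re_dir R j)) 0 (dz j F p) (dzbar j F p).
Proof.
move=> oD sF Dp e e0.
pose X := re_dir R j; pose Y := im_dir R j.
have e4 : 0 < e / 4 by rewrite divr_gt0.
have /cont_eps/(_ _ e4)[d1 d10 h1] := smooth_cont (smooth_rderive X sF) Dp.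
have /cont_eps/(_ _ e4)[d2 d20 h2] := smooth_cont (smooth_rderive Y sF) Dp.
have /nbhs_nvP[d3 d30 h3] := open_nbhs_nbhs (conj oD Dp).
have M0 : 0 < 1 + (nv X + nv Y) by rewrite ltr_pwDl // addr_ge0 // nv_ge0.
have m0 : 0 < Num.min d1 (Num.min d2 d3) by rewrite !lt_min d10 d20.
exists (Num.min d1 (Num.min d2 d3) / (1 + (nv X + nv Y))).
  by rewrite divr_gt0.
move=> h; rewrite ltr_pdivlMr // => hd.
rewrite !add0r scale0r addr0.
have nx := nc_Re h; have ny := nc_Im h.
have near_p (s t : R) : `|s| <= nc h -> `|t| <= nc h ->
    nv (p + s%:C *: X + t%:C *: Y - p) < Num.min d1 (Num.min d2 d3).
  move=> hs ht; apply: le_lt_trans hd; rewrite addrKK.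
  apply: le_trans (nvD _ _) _; rewrite !nvZ !ncR !mulrDr mulr1.
  apply: (@le_trans _ _ (nc h * nv X + nc h * nv Y)).
    by apply: lerD; rewrite ler_wpM2r ?nv_ge0.
  by rewrite lerDr nc_ge0.
have Dst (s t : R) : `|s| <= nc h -> `|t| <= nc h -> D (p + s%:C *: X + t%:C *: Y).
  move=> hs ht; apply: h3; have := near_p s t hs ht.
  by rewrite !lt_min => /andP[_ /andP[]].
have n0 : `|0 : R| <= nc h by rewrite normr0 nc_ge0.
have I1 : nc (F (p + (Re h)%:C *: X) - F p - (Re h)%:C * rderive X F p) <= 2 * (e / 4) * `|Re h|.
  apply: (smooth_increment sF) => t ht.
    by have := Dst t 0 (le_trans ht nx) n0; rewrite scale0r addr0.
  rewrite ltW //; apply: h1; have := near_p t 0 (le_trans ht nx) n0.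
  by rewrite scale0r addr0 !lt_min => /andP[].
have I2 : nc (F (p + (Re h)%:C *: X + (Im h)%:C *: Y) - F (p + (Re h)%:C *: X) - (Im h)%:C * rderive Y F p) <= 2 * (e / 4) * `|Im h|.
  apply: (smooth_increment sF) => t ht.
    exact: (Dst (Re h) t nx (le_trans ht ny)).
  rewrite ltW //; apply: h2; have := near_p (Re h) t nx (le_trans ht ny).
  by rewrite !lt_min => /andP[_ /andP[]].
have -> : p + h *: re_dir R j = p + (Re h)%:C *: X + (Im h)%:C *: Y.
  by rewrite -addrA /Y im_dirE scalerA -scalerDl [_ * 'i]mulrC -complexE.
have -> : h * dz j F p + conjc h * dzbar j F p = (Re h)%:C * rderive X F p + (Im h)%:C * rderive Y F p.
  have ch : conjc h = (Re h)%:C - 'i * (Im h)%:C by case: (h) => a b; simpc.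
  have alg (x y a b : C) : (x + 'i * y) * (2^-1 * (a - 'i * b)) +
      (x - 'i * y) * (2^-1 * (a + 'i * b)) = x * a + y * b.
    have i2 : 'i * 'i = -1 :> C by rewrite -expr2 sqr_i.
    rewrite [LHS](_ : _ = x * a - ('i * 'i) * (y * b)); last by field.
    by rewrite i2; ring.
  rewrite ch [X in X * dz _ _ _](complexE h); exact: alg.
have alg (a b c a' b' u v : C) : a - c - (u * a' + v * b') =
   (a - b - v * b') + (b - c - u * a') by ring.
rewrite (alg _ (F (p + (Re h)%:C *: X))).
apply: le_trans (ncD _ _) _.
have -> : e * nc h = 2 * (e / 4) * nc h + 2 * (e / 4) * nc h by field.
apply: lerD.
  by apply: (le_trans I2); rewrite ler_wpM2l // mulr_ge0 // ltW.
by apply: (le_trans I1); rewrite ler_wpM2l // mulr_ge0 // ltW.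
Qed.

Lemma smooth_rdiff D F p (a w : C) j : open D -> smooth D F ->
  D (p + (w - a) *: re_dir R j) ->
  rdiff (fun t : C => F (p + (t - a) *: re_dir R j)) w
    (dz j F (p + (w - a) *: re_dir R j)) (dzbar j F (p + (w - a) *: re_dir R j)).
Proof.
move=> oD sF Dp e /(smooth_rdiff0 j oD sF Dp)[d d0 hd]; exists d; [exact: d0 | move=> h /hd].
have -> : p + (w + h - a) *: re_dir R j = p + (w - a) *: re_dir R j + (0 + h) *: re_dir R j.
  by rewrite add0r -[RHS]addrA -scalerDl; congr (_ + _ *: _); ring.
have -> : p + (w - a) *: re_dir R j + (0 : C) *: re_dir R j = p + (w - a) *: re_dir R j.
  by rewrite scale0r addr0.
exact.
Qed.

End WirtingerDifferential.

Section CauchyKernel.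
Variable R : realType.
Local Notation C := R[i].
Local Notation tau := (pi *+ 2 : R).

Lemma rder_rcis (r : R) x : rder (fun x => r%:C * cis x) x ('i * (r%:C * cis x)).
Proof.
have := rderZ r%:C (rder_cis x).
by rewrite (_ : r%:C * ('i * cis x) = 'i * (r%:C * cis x)) //; ring.
Qed.

Lemma kernel_neq0 (r : R) (z : C) x : nc z < r -> r%:C * cis x - z != 0.
Proof.
move=> zr; have r0 : 0 < r := le_lt_trans (nc_ge0 z) zr.
by rewrite subr_eq0; apply: contraTN zr => /eqP <-; rewrite nc_rcis // ltxx.
Qed.

(** As a function of t in [0, 1], the mean of w / (w - t z) over the circle has
derivative zero, since w z / (w - t z) ^ 2 is a derivative in the angle. *)
Lemma kernel_mean (r : R) (z : C) : nc z < r ->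
  cint 0 tau (fun x => r%:C * cis x / (r%:C * cis x - z)) = tau%:C.
Proof.
move=> zr; have r0 : 0 < r := le_lt_trans (nc_ge0 z) zr.
have t0 := tau_gt0 R.
pose w x : C := r%:C * cis x.
have cw x : cont w x by apply: contZ; exact: cont_cis.
(* room around [0, 1] in which t z stays in the disc *)
pose d := (r - nc z) / (1 + nc z).
have z1 : 0 < 1 + nc z by rewrite ltr_pwDl // nc_ge0.
have d0 : 0 < d by rewrite divr_gt0 ?subr_gt0.
have tz (t : R) : 0 <= t <= 1 -> forall s : R, `|s - t| < d -> nc (s%:C * z) < r.
  move=> /andP[tge tle] s; rewrite ltr_pdivlMr // => sd.
  rewrite ncM ncR; have : `|s| <= `|s - t| + 1.
    have {1}-> : s = (s - t) + t by rewrite subrK.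
    by apply: le_trans (ler_normD _ _) _; rewrite lerD2l ger0_norm.
  move=> hs; apply: (@le_lt_trans _ _ ((`|s - t| + 1) * nc z)).
    by rewrite ler_wpM2r // nc_ge0.
  have : `|s - t| * nc z <= `|s - t| * (1 + nc z) by rewrite ler_wpM2l // lerDr.
  rewrite mulrDl mul1r; lra.
pose K (t : R) x := w x / (w x - t%:C * z).
pose K1 (t : R) x := w x * (- (w x - t%:C * z) ^- 2 * - z).
have cK t x : nc (t%:C * z) < r -> cont (K t) x.
  move=> h; apply: (contM (cw x)); apply: contV; first exact: kernel_neq0.
  exact: contB (cw x) (cont_cst _ x).
have cden (T : topologicalType) (a : T) (f : T -> C) (g : T -> R) :
    cont f a -> cont g a -> f a - (g a)%:C * z != 0 -> cont (fun x => - (f x - (g x)%:C * z) ^- 2) a.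
  move=> cf cg h; apply: contN; apply: contV; first by rewrite expf_eq0 /=.
  have cden1 : cont (fun x => f x - (g x)%:C * z) a.
    exact: contB cf (contM (cont_realC cg) (cont_cst z a)).
  exact: (contM cden1 cden1).
have dJ (t : R) : 0 <= t <= 1 -> rder (fun t => cint 0 tau (K t)) t 0.
  move=> t01; have tzt := tz t t01.
  have tzt0 : nc (t%:C * z) < r by apply: tzt; rewrite subrr normr0.
  have <- : cint 0 tau (K1 t) = 0.
    rewrite (@cintE _ _ _ _ (fun x => 'i * z * (w x - t%:C * z)^-1) (ltW t0)).
      by rewrite /w cis2pi cis0 subrr.
    move=> x _.
    have := @rder_comp_cder R (fun u => 'i * z * u^-1) (fun x => w x - t%:C * z) x ('i * w x) _ (cderZ ('i * z) (cder_inv (kernel_neq0 x tzt0))).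
    have i2 : 'i * 'i = -1 :> C by rewrite -expr2 sqr_i.
    rewrite (_ : 'i * w x * _ = K1 t x); last first.
      have alg (a b : C) : 'i * b * ('i * z * - a) = b * (- a * - z).
        rewrite (_ : 'i * b * _ = - ('i * 'i) * z * a * b); last by ring.
        by rewrite i2; ring.
      exact: alg.
    apply; rewrite -[X in rder _ _ X]subr0; apply: rderB (rder_cst _ _).
    exact: rder_rcis.
  apply: (rder_cint (d := d) (ltW t0) d0).
  - by move=> s x hs; apply: cK; exact: tzt.
  - move=> x; apply: contM; first exact: cw.
    apply: contM; last exact: cont_cst.
    by apply: (cden _ _ w (fun=> t)) => //; [exact: cont_cst | exact: kernel_neq0].
  - move=> s x hs _; rewrite /K /K1.
    apply: rderZ.
    have k0 := kernel_neq0 x (tzt s hs).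
    have := @rder_comp_cder R (fun u => u^-1) (fun s : R => w x - s%:C * z) s (- z) _ (cder_inv k0).
    rewrite mulrC; apply.
    have := rderB (rder_cst (w x) s) (rderZ z (rder_id s)).
    by rewrite mulr1 sub0r; apply: rder_ext => y; rewrite [z * _]mulrC.
  - move=> x _; apply: contM; first by apply: (cont_comp (cont_snd _)); exact: cw.
    apply: contM; last exact: cont_cst.
    apply: (cden _ (t, x) (fun a => w a.2) fst); last exact: kernel_neq0.
      by apply: (cont_comp (cont_snd _)); exact: cw.
    exact: cont_fst.
have := @mean_value_ineq R (fun t => cint 0 tau (K t)) (fun=> 0) 0 1 0 0 ler01 dJ.
rewrite !mulr0 !mul0r !subr0 => H.
have {H} : nc (cint 0 tau (K 1) - cint 0 tau (K 0)) <= 0 by apply: H => x _; rewrite nc0.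
move=> H; have : nc (cint 0 tau (K 1) - cint 0 tau (K 0)) = 0.
  by apply/eqP; rewrite eq_le H nc_ge0.
move=> /nc_eq0/eqP; rewrite subr_eq0 => /eqP E.
rewrite (_ : (fun x => _) = K 1); last by apply/funext => x; rewrite /K mul1r.
rewrite E (_ : K 0 = fun=> 1); first by rewrite cint_cst ?subr0 ?mulr1 // ltW.
apply/funext => x; rewrite /K mul0r subr0 divff //.
by rewrite -nc_gt0 nc_rcis.
Qed.

(** Cauchy-Pompeiu estimate.  Deforming the circle of radius r to the point z
along segments changes the Cauchy integral only through the derivative of phi
with respect to the conjugate variable: the other terms form an exact
differential in the angle. *)
Lemma cauchy_pompeiu (phi A B : C -> C) (r r1 M : R) (z : C) :
  r < r1 -> nc z < r ->
  (forall w, nc w < r1 -> rdiff phi w (A w) (B w)) ->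
  (forall w, nc w < r1 -> [/\ cont phi w, cont A w & cont B w]) ->
  (forall w, nc w <= r -> nc (B w) <= M) ->
  nc (phi z - tau%:C^-1 * cint 0 tau (fun x =>
    phi (r%:C * cis x) * (r%:C * cis x / (r%:C * cis x - z)))) <= 8 * M * r.
Proof.
move=> rr1 zr dphi cphi BM.
have r0 : 0 < r := le_lt_trans (nc_ge0 z) zr.
have t0 := tau_gt0 R.
have tC0 : tau%:C != 0 :> C by rewrite fmorph_eq0 gt_eqF.
pose w x : C := r%:C * cis x.
have nw x : nc (w x) = r by rewrite /w nc_rcis.
have cw x : cont w x by apply: contZ; exact: cont_cis.
have k0 x : w x - z != 0 by exact: kernel_neq0.
have dw x : rder w x ('i * w x) by exact: rder_rcis.
have wper : w tau = w 0 by rewrite /w cis2pi cis0.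
have wmean : cint 0 tau (fun x => w x / (w x - z)) = tau%:C by exact: kernel_mean.
rewrite -[fun x : R => _]/(fun x => phi (w x) * (w x / (w x - z))).
clearbody w.
pose k x := w x / (w x - z).
have ck x : cont k x.
  by apply: contM; [exact: cw | apply: contV; [exact: k0 | apply: contB; [exact: cw | exact: cont_cst]]].
(* the curves g s, for s from 0 to 1, deform the point z into the circle *)
pose g (s : R) x := z + s%:C * (w x - z).
have gle (s : R) x : 0 <= s <= 1 -> nc (g s x) <= r.
  move=> /andP[s0 s1]; rewrite /g (_ : _ + _ = (1 - s)%:C * z + s%:C * w x); last first.
    by rewrite rmorphB /= rmorph1; ring.
  apply: le_trans (ncD _ _) _; rewrite !ncM !ncR nw !ger0_norm ?subr_ge0 //.
  rewrite [leRHS](_ : r = (1 - s) * r + s * r); last by ring.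
  by rewrite lerD2r ler_wpM2l ?subr_ge0 // ltW.
(* s may leave [0, 1] by d1 while g s stays in the disc of radius r1 *)
pose d1 := (r1 - r) / (2 * r).
have d10 : 0 < d1 by rewrite divr_gt0 ?subr_gt0 // mulr_gt0.
have wz2 x : nc (w x - z) <= 2 * r.
  by apply: le_trans (ncB _ _) _; rewrite nw; move: zr => /ltW; lra.
have glt (s : R) x : - d1 < s < 1 + d1 -> nc (g s x) < r1.
  move=> /andP[s0 s1].
  have far (u : R) (y : C) : 0 <= u < d1 -> nc y <= r -> nc y + u * nc (w x - z) < r1.
    move=> /andP[u0 ud] yr.
    have h1 : u * nc (w x - z) <= u * (2 * r) by rewrite ler_wpM2l.
    have h2 : u * (2 * r) < r1 - r by rewrite -ltr_pdivlMr ?mulr_gt0.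
    lra.
  have [sle|sgt] := leP s 1; last first.
    have -> : g s x = w x + (s - 1)%:C * (w x - z).
      by rewrite /g rmorphB /= rmorph1; ring.
    apply: le_lt_trans (ncD _ _) _; rewrite ncM ncR ger0_norm ?subr_ge0 ?(ltW sgt) //.
    by apply: far; rewrite ?nw // subr_ge0 (ltW sgt) ltrBlDl.
  have [sge|slt] := leP 0 s; first by apply: le_lt_trans rr1; apply: gle; rewrite sge.
  apply: le_lt_trans (ncD _ _) _; rewrite ncM ncR; apply: far; last exact: ltW.
  by rewrite normr_ge0 ltr0_norm // ltrNl.
have cg (T : topologicalType) (a : T) (f : T -> R) (h : T -> R) :
    cont f a -> cont h a -> cont (fun b => g (f b) (h b)) a.
  move=> cf ch; apply: contD; first exact: cont_cst.
  apply: contM; first exact: cont_realC.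
  by apply: contB; [apply: (@cont_comp _ _ _ h w) => // | exact: cont_cst].
pose K s x := phi (g s x) * k x.
pose K1 s x := ((w x - z) * A (g s x) + conjc (w x - z) * B (g s x)) * k x.
have cconj (T : topologicalType) (f : T -> C) a : cont f a -> cont (fun x => conjc (f x)) a.
  move=> /cont_nc cf; apply/cont_nc => e /cf; apply: filterS => q.
  by rewrite -rmorphB ncJ.
have cK s x : - d1 < s < 1 + d1 -> cont (K s) x.
  move=> hs; apply: contM => //.
  apply: (@cont_comp _ _ _ (g s) phi); first by apply: (cg _ _ (fun=> s) id); [exact: cont_cst|exact: cont_id].
  by have [] := cphi _ (glt s x hs).
have cwz (T : topologicalType) (h : T -> R) a : cont h a -> cont (fun b => w (h b) - z) a.
  by move=> ch; apply: contB; [apply: (@cont_comp _ _ _ h w) | exact: cont_cst].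
have cK1 (T : topologicalType) (f h : T -> R) a : - d1 < f a < 1 + d1 -> cont f a -> cont h a ->
    cont (fun b => K1 (f b) (h b)) a.
  move=> hs cf ch; have [_ cA cB] := cphi _ (glt (f a) (h a) hs).
  apply: contM; last by apply: (@cont_comp _ _ _ h k).
  apply: contD; apply: contM.
  - exact: cwz.
  - exact: (@cont_comp _ _ _ (fun b => g (f b) (h b)) A _ (cg _ _ _ _ cf ch)).
  - by apply: cconj; exact: cwz.
  - exact: (@cont_comp _ _ _ (fun b => g (f b) (h b)) B _ (cg _ _ _ _ cf ch)).
pose H s := cint 0 tau (K s).
have s_in (s : R) : 0 <= s <= 1 -> - d1 < s < 1 + d1.
  by move=> /andP[s0 s1]; apply/andP; split; lra.
have dH (s : R) : 0 <= s <= 1 -> rder H s (cint 0 tau (K1 s)).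
  move=> s01; have nears (t : R) : `|t - s| < d1 -> - d1 < t < 1 + d1.
    case/andP: s01 => s0 s1; rewrite ltr_norml => /andP[h1 h2].
    by apply/andP; split; lra.
  have sin := s_in s s01.
  apply: (rder_cint (d := d1) (ltW t0) d10).
  - by move=> t x ht; apply: cK; exact: nears.
  - move=> x; exact: (cK1 _ (fun=> s) id x sin (cont_cst _ _) (cont_id _)).
  - move=> t x /nears ht _; rewrite /K /K1.
    have H1 := @rder_comp R phi (fun t => g t x) t (w x - z) _ _ (dphi _ (glt t x ht)) (rder_line z (w x - z) t).
    have := rderZ (k x) H1; rewrite [k x * _]mulrC.
    by apply: rder_ext => u; rewrite mulrC.
  - move=> x _; exact: (cK1 _ fst snd (s, x) sin (cont_fst _) (cont_snd _)).
have H'M (s : R) : 0 < s <= 1 -> nc (cint 0 tau (K1 s)) <= 2 * (2 * M * r) * tau.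
  move=> /andP[s0 s1]; have sle : 0 <= s <= 1 by rewrite (ltW s0) s1.
  have s01 := s_in s sle.
  have sC : s%:C != 0 :> C by rewrite fmorph_eq0 gt_eqF.
  (* T1 is the derivative of phi (g s x) in the angle x: it integrates to zero
     over the circle, and only T2, which involves B alone, is left *)
  pose T1 x := (s%:C * ('i * w x)) * A (g s x) + conjc (s%:C * ('i * w x)) * B (g s x).
  pose T2 x := B (g s x) * (conjc (w x) + conjc (w x - z) * k x).
  have i2 : 'i * 'i = -1 :> C by rewrite -expr2 sqr_i.
  have E x : K1 s x = (- 'i / s%:C) * T1 x + T2 x.
    rewrite /K1 /T1 /T2.
    have -> : conjc (s%:C * ('i * w x)) = - s%:C * 'i * conjc (w x).
      case: (w x) => a b; apply/eqP; rewrite eq_complex /=.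
      by apply/andP; split; apply/eqP; ring.
    have wk : (w x - z) * k x = w x by rewrite /k mulrCA mulfV // mulr1.
    have alg (a b c y u u' v : C) : c * y = u ->
        (c * a + v * b) * y = (- 'i / s%:C) * (s%:C * ('i * u) * a + - s%:C * 'i * u' * b) + b * (u' + v * y).
      move=> <-; rewrite [RHS](_ : _ = - ('i * 'i) * (c * y * a) + ('i * 'i) * u' * b + b * (u' + v * y)); last by field.
      by rewrite i2; ring.
    exact: alg.
  have cT x : cont T1 x.
    have [_ cA cB] := cphi _ (glt s x s01).
    have cgx : cont (g s) x by apply: (cg _ _ (fun=> s) id); [exact: cont_cst|exact: cont_id].
    apply: contD; apply: contM.
    - by apply: contZ; apply: contZ.
    - exact: cont_comp cgx cA.
    - by apply: cconj; apply: contZ; apply: contZ.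
    - exact: cont_comp cgx cB.
  have cT2 x : cont T2 x.
    have [_ cA cB] := cphi _ (glt s x s01).
    have cgx : cont (g s) x by apply: (cg _ _ (fun=> s) id); [exact: cont_cst|exact: cont_id].
    apply: contM; first exact: cont_comp cgx cB.
    apply: contD; first exact: cconj.
    by apply: contM; [apply: cconj; apply: (cwz _ id); exact: cont_id | exact: ck].
  have iT1 : cint 0 tau T1 = 0.
    rewrite (@cintE _ _ _ _ (fun x => phi (g s x)) (ltW t0)).
      by rewrite /g wper subrr.
    move=> x _; apply: (rder_comp (dphi _ (glt s x s01))).
    rewrite -[X in rder _ _ X]add0r; apply: rderD; first exact: rder_cst.
    apply: rderZ; rewrite -[X in rder _ _ X]subr0; by apply: rderB (rder_cst _ _).
  rewrite (_ : K1 s = fun x => (- 'i / s%:C) * T1 x + T2 x); last by apply/funext.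
  rewrite cintD; [|exact: ltW|by move=> x; exact: contZ|exact: cT2].
  rewrite cintZ //; last exact: ltW.
  rewrite iT1 mulr0 add0r -[X in _ * X](subr0 tau).
  apply: cint_bound => //; first exact: ltW.
  move=> x _; rewrite /T2 ncM.
  have -> : 2 * M * r = M * (r + r) by ring.
  apply: ler_pM; [exact: nc_ge0|exact: nc_ge0|by apply: BM; exact: gle|].
  apply: le_trans (ncD _ _) _; rewrite ncJ nw lerD2l ncM ncJ /k ncM ncV nw.
  by rewrite mulrCA divff ?mulr1 // gt_eqF // nc_gt0.
have M0 : 0 <= M by apply: le_trans (BM z (ltW zr)); exact: nc_ge0.
have Hs (s : R) : 0 < s <= 1 -> nc (H 1 - H s) <= 8 * M * r * tau.
  move=> /andP[s0 s1].
  have := @mean_value_ineq R H (fun s => cint 0 tau (K1 s)) s 1 0 (2 * (2 * M * r) * tau) s1.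
  rewrite mulr0 subr0 => HH; apply: (@le_trans _ _ (2 * (2 * (2 * M * r) * tau) * (1 - s))).
    apply: HH => u /andP[su u1]; first by apply: dH; rewrite (le_trans (ltW s0) su).
    by rewrite subr0; apply: H'M; rewrite (lt_le_trans s0).
  rewrite [leRHS](_ : _ = 2 * (2 * (2 * M * r) * tau) * 1); last by ring.
  rewrite ler_wpM2l ?mulr_ge0 ?(ltW r0) ?(ltW t0) //.
  by rewrite lerBlDr lerDl ltW.
have cH0 : cont H 0.
  by apply: rder_continuous (dH 0 _); rewrite lexx ler01.
have H10 : nc (H 1 - H 0) <= 8 * M * r * tau.
  apply/ler_addgt0Pr => e e0.
  have /cont_nc/(_ e e0)/nbhs_normP[d /= d0 hd] := cH0.
  pose s := Num.min 1 (d / 2).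
  have s0 : 0 < s by rewrite lt_min ltr01 divr_gt0.
  have s1 : s <= 1 by rewrite ge_min lexx.
  have sd : s < d.
    by apply: (@le_lt_trans _ _ (d / 2)); [rewrite ge_min lexx orbT | rewrite ltr_pdivrMr // ltr_pMr // ltr1n].
  apply: le_trans (nc_triangle _ _ (H s)) _; apply: lerD; first by apply: Hs; rewrite s0.
  by rewrite ltW //; apply: hd; rewrite /ball_ /= sub0r normrN gtr0_norm.
have -> : cint 0 tau (fun x => phi (w x) * (w x / (w x - z))) = H 1.
  by apply: eq_cint => x _; rewrite /K /g rmorph1 mul1r [z + _]addrC subrK.
have H0 : H 0 = phi z * tau%:C.
  rewrite -wmean -cintZ; [|exact: ltW|exact: ck].
  by apply: eq_cint => x _; rewrite /K /g mul0r addr0.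
have -> : phi z - tau%:C^-1 * H 1 = - (tau%:C^-1 * (H 1 - H 0)).
  have alg (a b c : C) : c != 0 -> a - c^-1 * b = - (c^-1 * (b - a * c)).
    by move=> c0; field.
  by rewrite H0; exact: alg.
by rewrite ncN ncM ncV ncR gtr0_norm // mulrC ler_pdivrMr.
Qed.

End CauchyKernel.

(** * Holomorphic approximation in a polydisc *)

Section CauchyOperator.
Variables (R : realType) (V : normedModType R[i]).
Local Notation C := R[i].
Local Notation tau := (pi *+ 2 : R).
Variables (e : V) (lam dlam : V -> C) (rho : R).
Hypothesis lamD : forall p v t, lam (p + t *: v) = lam p + t * dlam v.
Hypothesis clam : forall p, cont lam p.
Implicit Types (D : set V) (F G : V -> C) (p q u v : V) (t : C) (x : R).

(** lam is the coordinate along e, so that this point of the line p + C e has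
coordinate rho * cis x. *)
Definition circle_pt p x : V := p + (rho%:C * cis x - lam p) *: e.

Definition circle_kernel p x : C := rho%:C * cis x / (rho%:C * cis x - lam p).

(** The Cauchy integral of F over a circle in the direction e. *)
Definition cauchy_op F p : C :=
  tau%:C^-1 * cint 0 tau (fun x => F (circle_pt p x) * circle_kernel p x).

(** Holomorphy in the directions of U only. *)
Definition dhol D (U : set V) F := forall p, D p -> cont F p /\
  forall v, U v -> derivable F p v /\ cont ('D_v F) p.

Lemma cont_rcis x : cont (fun x => rho%:C * cis x) x.
Proof. by apply: contZ; exact: cont_cis. Qed.

Lemma cont_circle_pt p x : cont (fun a : V * R => circle_pt a.1 a.2) (p, x).
Proof.
apply: contVD; first exact: cont_fst.
apply: contVZ; last exact: cont_cst.
apply: contB; first exact: (@cont_comp _ _ _ snd (fun x => rho%:C * cis x) _ (cont_snd _) (cont_rcis _)).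
exact: (@cont_comp _ _ _ fst lam _ (cont_fst _) (clam _)).
Qed.

Lemma cont_circle_den p x :
  cont (fun a : V * R => rho%:C * cis a.2 - lam a.1) (p, x).
Proof.
apply: contB; first exact: (@cont_comp _ _ _ snd (fun x => rho%:C * cis x) _ (cont_snd _) (cont_rcis _)).
exact: (@cont_comp _ _ _ fst lam _ (cont_fst _) (clam _)).
Qed.

Lemma cont_circle_kernel p x : nc (lam p) < rho ->
  cont (fun a : V * R => circle_kernel a.1 a.2) (p, x).
Proof.
move=> hp; apply: contM.
  exact: (@cont_comp _ _ _ snd (fun x => rho%:C * cis x) _ (cont_snd _) (cont_rcis _)).
by apply: contV; [exact: kernel_neq0 | exact: cont_circle_den].
Qed.

Lemma cont_slice (T S : topologicalType) (K : T -> S -> C) (a : T) (y : S) :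
  cont (fun b : T * S => K b.1 b.2) (a, y) -> cont (K a) y.
Proof.
move=> cK; exact: (@cont_comp _ _ _ (fun z => (a, z)) (fun b => K b.1 b.2) _
  (cont_pair (cont_cst a y) (cont_id y)) cK).
Qed.

Lemma cont_circle_fun (G : V -> C) p x : cont G (circle_pt p x) ->
  cont (fun a : V * R => G (circle_pt a.1 a.2)) (p, x).
Proof. by move=> cG; exact: (@cont_comp _ _ _ _ G _ (cont_circle_pt p x) cG). Qed.

(** The Cauchy integral at p depends on the line p + C e and, through the kernel,
on lam p.  Moving p by v moves the points of the circle by v - dlam v *: e: when
dlam e = 1 this vanishes for v = e, so that the integral is holomorphic along e
without any assumption on F, and it is holomorphic wherever F was. *)
Lemma cauchy_op_dhol D D' (U : set V) F : open D' ->
  (forall p, D' p -> nc (lam p) < rho) ->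
  (forall p x, D' p -> D (circle_pt p x)) ->
  dhol D U F -> dhol D' [set v | U (v - dlam v *: e)] (cauchy_op F).
Proof.
move=> oD' lD' DD' hF.
have t0 := tau_gt0 R.
pose K p x := F (circle_pt p x) * circle_kernel p x.
pose K1 v p x := 'D_(v - dlam v *: e) F (circle_pt p x) * circle_kernel p x +
  F (circle_pt p x) * (rho%:C * cis x * (- (rho%:C * cis x - lam p) ^- 2 * - dlam v)).
have cK p x : D' p -> cont (fun a : V * R => K a.1 a.2) (p, x).
  move=> Dp; apply: contM; last exact: cont_circle_kernel (lD' p Dp).
  exact: cont_circle_fun (hF _ (DD' p x Dp)).1.
have cK1 v p x : U (v - dlam v *: e) -> D' p -> cont (fun a : V * R => K1 v a.1 a.2) (p, x).
  move=> Uv Dp; have [cF /(_ _ Uv)[_ cdF]] := hF _ (DD' p x Dp).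
  apply: contD; apply: contM.
  - exact: cont_circle_fun cdF.
  - exact: cont_circle_kernel (lD' p Dp).
  - exact: cont_circle_fun cF.
  - apply: contM.
      exact: (@cont_comp _ _ _ snd (fun x => rho%:C * cis x) _ (cont_snd _) (cont_rcis _)).
    apply: contM; last exact: cont_cst.
    have k0 := kernel_neq0 x (lD' p Dp).
    apply: contN; apply: contV; first by rewrite expf_eq0.
    by apply: contM; exact: cont_circle_den.
have nD p : D' p -> \forall q \near p, D' q by move=> Dp; exact: open_nbhs_nbhs.
have der p v : D' p -> U (v - dlam v *: e) ->
    is_derive p v (cauchy_op F) (tau%:C^-1 * cint 0 tau (K1 v p)).
  move=> Dp Uv; apply/is_derive_cder; apply: cderZ.
  have [d d0 hd] := disc_in v oD' Dp.
  have p0 : p + (0 : C) *: v = p by rewrite scale0r addr0.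
  have := @cder_cint R (fun t => K (p + t *: v)) (fun t => K1 v (p + t *: v)) 0 tau d (ltW t0) d0.
  rewrite p0; apply.
  - move=> t x td; apply: (cont_slice (K := K)); apply: cK; apply: hd; exact: ltW.
  - by move=> x; apply: (cont_slice (K := K1 v)); exact: cK1.
  - move=> t x td _; rewrite /K /K1.
    have Dt := hd t (ltW td).
    have Ept s : circle_pt (p + s *: v) x = circle_pt p x + s *: (v - dlam v *: e).
      rewrite /circle_pt lamD scalerBr scalerA -!addrA; congr (_ + _).
      rewrite [RHS]addrCA; congr (_ + _); rewrite -scalerBl; congr (_ *: _); ring.
    apply: cderM.
      have := @cder_line R V F (circle_pt p x) (v - dlam v *: e) t.
      rewrite -Ept => H.
      rewrite (_ : (fun s => F _) = fun s => F (circle_pt p x + s *: (v - dlam v *: e))).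
        by apply: H; have [_ /(_ _ Uv)[]] := hF _ (DD' _ x Dt).
      by apply/funext => s; rewrite Ept.
    rewrite /circle_kernel; apply: cderZ.
    apply: (@cder_comp R (fun z : C => z^-1) (fun s => rho%:C * cis x - lam (p + s *: v)) t (- dlam v) _ _ (cder_inv (kernel_neq0 x (lD' _ Dt)))).
    rewrite (_ : (fun s => _ - _) = fun s => rho%:C * cis x - lam p - s * dlam v).
      have := cderB (cder_cst (rho%:C * cis x - lam p) t) (cderMr (dlam v) (cder_id t)).
      by rewrite mul1r sub0r.
    by apply/funext => s; rewrite lamD opprD addrA.
  - move=> x _.
    have c1 : cont (fun a : C * R => (p + a.1 *: v, a.2)) (0, x).
      apply: cont_pair; last exact: cont_snd.
      apply: contVD; first exact: cont_cst.
      by apply: contVZ; [exact: cont_fst | exact: cont_cst].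
    apply: (@cont_comp _ _ _ (fun a : C * R => (p + a.1 *: v, a.2)) (fun b => K1 v b.1 b.2) _ c1).
    by rewrite /= p0; exact: cK1.
move=> p Dp; split.
  apply: contZ; apply: cont_cint; first exact: ltW.
    by apply: filterS (nD p Dp) => q Dq x; apply: (cont_slice (K := K)); exact: cK.
  by move=> x _; exact: cK.
move=> v Uv; split; first by have [] := der p v Dp Uv.
apply: (@near_cont _ _ (fun q => tau%:C^-1 * cint 0 tau (K1 v q))).
  by apply: filterS (nD p Dp) => q Dq; have [_ ->] := der q v Dq Uv.
apply: contZ; apply: cont_cint; first exact: ltW.
  by apply: filterS (nD p Dp) => q Dq x; apply: (cont_slice (K := K1 v)); exact: cK1.
by move=> x _; exact: cK1.
Qed.

Lemma cauchy_op_cont F p : nc (lam p) < rho ->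
  (forall x, cont F (circle_pt p x)) ->
  forall x, cont (fun x => F (circle_pt p x) * circle_kernel p x) x.
Proof.
move=> hp cF x; apply: (cont_slice (K := fun p x => F (circle_pt p x) * circle_kernel p x)).
by apply: contM; [exact: cont_circle_fun | exact: cont_circle_kernel].
Qed.

Lemma cauchy_op_bound F G p (M : R) : nc (lam p) <= rho / 2 -> 0 < rho ->
  (forall x, cont F (circle_pt p x)) -> (forall x, cont G (circle_pt p x)) ->
  (forall x, nc (F (circle_pt p x) - G (circle_pt p x)) <= M) ->
  nc (cauchy_op F p - cauchy_op G p) <= 4 * M.
Proof.
move=> hp rho0 cF cG FG.
have t0 := tau_gt0 R.
have hp' : nc (lam p) < rho by apply: le_lt_trans hp _; rewrite ltr_pdivrMr // ltr_pMr // ltr1n.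
rewrite /cauchy_op -mulrBr -cintB; [|exact: ltW|exact: cauchy_op_cont|exact: cauchy_op_cont].
rewrite ncM ncV ncR gtr0_norm // mulrC ler_pdivrMr //.
have -> : 4 * M * tau = 2 * (M * 2) * (tau - 0) by rewrite subr0; ring.
apply: cint_bound; first exact: ltW.
  by move=> x; apply: contB; exact: cauchy_op_cont.
move=> x _; rewrite -mulrBl ncM; apply: ler_pM; [exact: nc_ge0|exact: nc_ge0|exact: FG|].
rewrite /circle_kernel ncM ncV nc_rcis // ler_pdivrMr; last by rewrite nc_gt0 kernel_neq0.
have := nc_triangle (rho%:C * cis x) 0 (lam p).
rewrite !subr0 nc_rcis //; lra.
Qed.

End CauchyOperator.

Section HolomorphicApproximation.
Variables (R : realType) (n : nat).
Local Notation C := R[i].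
Local Notation E := (coords R n).
Local Notation tau := (pi *+ 2 : R).
Implicit Types (F G : E -> C) (D : set E) (p q u v w : E) (j : 'I_n).

Variables (z0 : 'rV[C]_n) (r r1 : R) (Om : set 'rV[C]_n) (D0 : set E) (f : E -> C).
Hypotheses (r0 : 0 < r) (rr1 : r < r1) (oOm : open Om) (oD0 : open D0).

Definition lam j p : C := p.1 0 j - z0 0 j.

(** The coordinates of l, those with respect to which a Cauchy integral has been
taken, are kept in a smaller disc, where the Cauchy kernel is bounded. *)
Definition polydisc (l : seq 'I_n) : set E :=
  [set p | (forall j, nc (lam j p) < r1) /\ Om p.2 /\
    forall j, j \in l -> nc (lam j p) < r / 2].

Hypothesis sub_D0 : polydisc [::] `<=` D0.
Hypothesis smooth_f : smooth D0 f.
Hypothesis hol_f : forall p (u : 'rV[C]_n), polydisc [::] p -> derivable f p (0, u).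

Lemma lamD j p v t : lam j (p + t *: v) = lam j p + t * v.1 0 j.
Proof. by rewrite /lam /= !mxE addrAC. Qed.

Lemma cont_lam j p : cont (lam j) p.
Proof.
apply: contB; last exact: cont_cst.
apply: (@cont_comp _ _ _ fst (fun z : 'rV[C]_n => z 0 j) _ (cont_fst _)).
by split; exact: coord_continuous.
Qed.

Lemma open_lt_lam j (s : R) : open [set p | nc (lam j p) < s].
Proof.
have -> : [set p | nc (lam j p) < s] = (fun p => nv (lam j p : C)) @^-1` [set x | x < s] by [].
apply: open_comp; last exact: open_lt.
move=> p _; apply: (@continuous_comp _ _ _ (lam j) (fun z : C => nv z)).
  by have [] := cont_lam j p.
exact: (@continuous_nv R C).
Qed.

Lemma near_forall (T : topologicalType) (p : T) (P : 'I_n -> T -> Prop) :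
  (forall j, \forall q \near p, P j q) -> \forall q \near p, forall j, P j q.
Proof. by move=> h; apply: (@filter_forall T 'I_n P (nbhs p) (nbhs_filter p)). Qed.

Lemma open_polydisc l : open (polydisc l).
Proof.
rewrite openE => p [h1 [h2 h3]].
have nlt j (s : R) : nc (lam j p) < s -> \forall q \near p, nc (lam j q) < s.
  by move=> h; apply: (@open_nbhs_nbhs E p [set q | nc (lam j q) < s]); split=> //; exact: open_lt_lam.
have n1 : \forall q \near p, forall j, nc (lam j q) < r1.
  apply: (@near_forall E p) => j; exact: nlt.
have n2 : \forall q \near p, Om q.2.
  have [c] := cont_snd p; exact: (c Om (open_nbhs_nbhs (conj oOm h2))).
have n3 : \forall q \near p, forall j, j \in l -> nc (lam j q) < r / 2.
  apply: (@near_forall E p) => j; have [jl|jl] := boolP (j \in l); last by apply: filterE.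
  by apply: filterS (nlt j (r / 2) (h3 j jl)) => q.
near=> q; split; first by near: q.
by split; near: q.
Unshelve. all: by end_near. Qed.

Let cop j := cauchy_op (re_dir R j) (lam j) r.

(** The iterated Cauchy integral of f over the distinguished boundary of a
polydisc, in the coordinates of l. *)
Definition holomorphic_approx (l : seq 'I_n) : E -> C := foldr cop f l.

Lemma lam_shift j k p (t : C) :
  lam k (p + t *: re_dir R j) = if k == j then lam k p + t else lam k p.
Proof.
rewrite lamD /re_dir /= mxE eqxx /= eq_sym.
by case: (j == k); rewrite ?mulr1 // mulr0 addr0.
Qed.

Lemma snd_shift j p (t : C) : (p + t *: re_dir R j).2 = p.2.
Proof. by rewrite /re_dir /= scaler0 addr0. Qed.

Lemma half_lt : r / 2 < r.
Proof. by rewrite ltr_pdivrMr // ltr_pMr // ltr1n. Qed.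

Lemma circle_pt_in j l p (w : C) : j \notin l -> polydisc l p -> nc w < r1 ->
  polydisc l (p + (w - lam j p) *: re_dir R j).
Proof.
move=> jl [h1 [h2 h3]] wr; split; last split.
- by move=> k; rewrite lam_shift; case: eqP => [->|//]; rewrite addrC subrK.
- by rewrite snd_shift.
- move=> k kl; rewrite lam_shift; case: eqP => [kj|_]; last exact: h3.
  by rewrite -kj kl in jl.
Qed.

Lemma polydisc_sub l j p : polydisc (j :: l) p -> polydisc l p.
Proof. by move=> [h1 [h2 h3]]; split=> //; split=> // k kl; apply: h3; rewrite in_cons kl orbT. Qed.

Lemma polydisc0 l p : polydisc l p -> polydisc [::] p.
Proof. by move=> [h1 [h2 h3]]; split=> //; split. Qed.

(** Each Cauchy integral makes the function holomorphic in one more variable. *)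
Lemma approx_dhol l : uniq l -> dhol (polydisc l)
  [set v : E | forall j, j \notin l -> v.1 0 j = 0] (holomorphic_approx l).
Proof.
have open_nil := @open_polydisc [::].
elim: l => [_ p Dp|j l IH /andP[jl ul]].
  have D0p := sub_D0 Dp; split; first exact: smooth_cont smooth_f D0p.
  move=> v v0; have {v0} v1 : v.1 = 0 by apply/rowP => j; rewrite mxE; exact: v0.
  have {v1} -> : v = (0, v.2) by rewrite -v1; case: (v).
  split; first exact: hol_f.
  apply: (@near_cont _ _ (rderive (0, v.2) f)).
    have := open_nbhs_nbhs (conj open_nil Dp); apply: filterS => q Dq.
    have H := derivable_cder (@hol_f q v.2 Dq).
    have := @rder_comp_cder R (fun t => f (q + t *: (0, v.2))) (fun x : R => x%:C) 0 1 _ H (rder_id 0).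
    by rewrite mul1r => /rder_rderive[].
  exact: smooth_cont (smooth_rderive _ smooth_f) D0p.
move=> p Dp.
have H := @cauchy_op_dhol R E (re_dir R j) (lam j) (fun v => v.1 0 j) r (lamD j) (cont_lam j)
  (polydisc l) (polydisc (j :: l)) _ (holomorphic_approx l) (@open_polydisc (j :: l)).
have {}H := H _ _ _ (IH ul).
have [|q x Dq|c1 c2] := H _ _ p Dp.
- move=> q [_ [_ /(_ j (mem_head _ _))]] hq; exact: lt_trans hq half_lt.
- apply: circle_pt_in (polydisc_sub Dq) _ => //; by rewrite nc_rcis.
split=> // v v0; apply: c2 => k kl /=.
rewrite !mxE eqxx /=; have [->|kj] := eqVneq k j; first by rewrite mulr1 subrr.
by rewrite mulr0 subr0; apply: v0; rewrite in_cons negb_or kj.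
Qed.

Lemma approx_ghol l : uniq l -> (forall j, j \in l) ->
  ghol (polydisc l) (holomorphic_approx l).
Proof.
move=> ul al p Dp; have [c1 c2] := approx_dhol ul Dp; split=> // v.
by apply: (c2 v _).1 => j; rewrite al.
Qed.

(** Each Cauchy integral adds a Cauchy-Pompeiu error, and multiplies the previous
error by the bound of the kernel. *)
Lemma approx_error l : uniq l -> exists2 K : R, 0 < K & forall p (M : R), polydisc l p -> 0 <= M ->
  (forall q j, polydisc [::] q -> q.2 = p.2 -> nc (dzbar j f q) <= M) ->
  nc (f p - holomorphic_approx l p) <= K * M.
Proof.
elim: l => [_|j l IH /andP[jl ul]].
  by exists 1 => // p M Dp M0 HM; rewrite subrr nc0 mul1r.
have [K K0 HK] := IH ul.
exists (8 * r + 4 * K) => [|p M Dp M0 HM]; first by rewrite addr_gt0 // mulr_gt0.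
have Dl := polydisc_sub Dp; have Dn := polydisc0 Dp.
have lj : nc (lam j p) < r / 2 by have [_ [_ /(_ j (mem_head _ _))]] := Dp.
apply: le_trans (nc_triangle _ _ (cop j f p)) _; rewrite mulrDl; apply: lerD.
  have inD (w : C) : nc w < r1 -> D0 (p + (w - lam j p) *: re_dir R j).
    by move=> wr; apply: sub_D0; apply: circle_pt_in.
  have := @cauchy_pompeiu R (fun w : C => f (p + (w - lam j p) *: re_dir R j))
    (fun w : C => dz j f (p + (w - lam j p) *: re_dir R j))
    (fun w : C => dzbar j f (p + (w - lam j p) *: re_dir R j)) r r1 M (lam j p) rr1 (lt_trans lj half_lt).
  have -> : p + (lam j p - lam j p) *: re_dir R j = p by rewrite subrr scale0r addr0.
  rewrite [8 * M * r]mulrAC; apply.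
  - by move=> w wr; apply: (smooth_rdiff oD0 smooth_f); exact: inD.
  - move=> w wr.
    have cl : cont (fun w : C => p + (w - lam j p) *: re_dir R j) w.
      apply: contVD; first exact: cont_cst.
      apply: contVZ; last exact: cont_cst.
      by apply: contB; [exact: cont_id | exact: cont_cst].
    have Dw := inD w wr; split.
    + exact: (@cont_comp _ _ _ _ f _ cl (smooth_cont smooth_f Dw)).
    + exact: (@cont_comp _ _ _ _ (dz j f) _ cl (smooth_cont (smooth_wirtinger (true, j) oD0 smooth_f) Dw)).
    + exact: (@cont_comp _ _ _ _ (dzbar j f) _ cl (smooth_cont (smooth_wirtinger (false, j) oD0 smooth_f) Dw)).
  - move=> w wr; apply: HM; last by rewrite snd_shift.
    by apply: circle_pt_in => //; exact: le_lt_trans rr1.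
rewrite -mulrA.
have cin x : polydisc l (circle_pt (re_dir R j) (lam j) r p x).
  by apply: circle_pt_in; rewrite ?nc_rcis.
apply: (cauchy_op_bound (cont_lam j) (ltW lj) r0).
- by move=> x; apply: smooth_cont smooth_f _; apply: sub_D0; exact: polydisc0 (cin x).
- by move=> x; have [] := approx_dhol ul (cin x).
- move=> x; apply: HK (cin x) M0 _ => q k Dq qp; apply: HM => //.
  by rewrite qp snd_shift.
Qed.

End HolomorphicApproximation.

(** * Coordinates on the cotangent bundle *)

Section ContinuityOfSets.

Lemma cont_near (T U : topologicalType) (f : T -> U) p (A : set U) :
  cont f p -> open A -> A (f p) -> \forall q \near p, A (f q).
Proof. by move=> [cf] oA Ap; exact: (cf A (open_nbhs_nbhs (conj oA Ap))). Qed.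

Lemma near_open (T : topologicalType) (A : set T) p : open A -> A p -> nbhs p A.
Proof. by move=> oA Ap; exact: open_nbhs_nbhs. Qed.

Lemma open_preimage (T U : topologicalType) (f : T -> U) (A : set T) (B : set U) :
  open A -> open B -> (forall p, A p -> cont f p) ->
  open [set p | A p /\ B (f p)].
Proof.
move=> oA oB cf; rewrite openE => p [Ap Bp].
apply: (@filterI T (nbhs p) (nbhs_filter p)); first exact: near_open.
by apply: cont_near => //; exact: cf.
Qed.

Lemma compact_image (T U : topologicalType) (f : T -> U) (A : set T) :
  (forall p, A p -> cont f p) -> compact A -> compact (f @` A).
Proof.
move=> cf cA; apply: continuous_compact => //.
by apply: continuous_in_subspaceT => p; rewrite inE => /cf[].
Qed.

End ContinuityOfSets.

Section Transitions.
Variables (R : realType) (n : nat) (X : complex_manifold R n).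
Local Notation C := R[i].
Local Notation Z := 'rV[C]_n.
Local Notation E := (coords R n).
Local Notation T := (cotangent X).
Implicit Types (c d e : chart R n X) (x : X) (z : Z).

Lemma chart_invP c z : (c @` chart_dom c) z ->
  chart_dom c (chart_inv c z) /\ c (chart_inv c z) = z.
Proof. by move=> [x cx <-]; rewrite chart_funK. Qed.

Lemma cont_chart_inv c z : (c @` chart_dom c) z -> cont (chart_inv c) z.
Proof. by move=> cz; split; exact: chart_inv_continuous. Qed.

Lemma cont_chart c x : chart_dom c x -> cont c x.
Proof. by move=> cx; split; exact: chart_fun_continuous. Qed.

Lemma near_chart_inv c d x : chart_dom c x -> chart_dom d x ->
  \forall z \near c x, (c @` chart_dom c) z /\ chart_dom d (chart_inv c z).
Proof.
move=> cx dx; have cz : (c @` chart_dom c) (c x) by exists x.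
apply: (@filterI _ (nbhs (c x)) (nbhs_filter _)).
  exact: near_open (@chart_codom_open _ _ _ c) cz.
by apply: (cont_near (cont_chart_inv cz) (@chart_dom_open _ _ _ d)); rewrite chart_funK.
Qed.

Lemma open_transition_dom c d : open (c @` (chart_dom c `&` chart_dom d)).
Proof.
have -> : c @` (chart_dom c `&` chart_dom d) =
    [set z | (c @` chart_dom c) z /\ chart_dom d (chart_inv c z)].
  apply/seteqP; split=> z /=; first by move=> [x [cx dx] <-]; rewrite chart_funK //; split=> //; exists x.
  by move=> [[x cx <-]]; rewrite chart_funK // => dx; exists x.
apply: open_preimage; [exact: chart_codom_open | exact: chart_dom_open |].
by move=> z; exact: cont_chart_inv.
Qed.

Lemma transition_differentiable c d x : atlas c -> atlas d ->
  chart_dom c x -> chart_dom d x -> differentiable (d \o chart_inv c) (c x).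
Proof. by move=> ac ad cx dx; apply: (atlas_holomorphic ac ad); exists x. Qed.

Lemma mulmx_inj (m : nat) (A B : 'M[C]_(n, m)) :
  (forall v : 'rV_n, v *m A = v *m B) -> A = B.
Proof. by move=> AB; apply/row_matrixP => i; rewrite !rowE AB. Qed.

Lemma mulmx_jacobian (m : nat) (f : Z -> 'rV[C]_m) z v : differentiable f z ->
  v *m jacobian f z = 'D_v f z.
Proof. by move=> df; have h := deriveEjacobian v df; exact: (esym h). Qed.

Lemma near_eq_jacobian (m : nat) (f g : Z -> 'rV[C]_m) z : differentiable f z ->
  differentiable g z -> (\forall w \near z, f w = g w) -> jacobian f z = jacobian g z.
Proof.
move=> df dg fg; apply: mulmx_inj => v.
exact: etrans (mulmx_jacobian v df) (etrans (near_eq_derive v fg) (esym (mulmx_jacobian v dg))).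
Qed.

Lemma jacobian_comp (f g : Z -> Z) z : differentiable f z -> differentiable g (f z) ->
  jacobian (g \o f) z = jacobian f z *m jacobian g (f z).
Proof.
move=> df dg; apply: mulmx_inj => v; rewrite mulmxA.
have h1 := mulmx_jacobian v (differentiable_comp df dg).
have h2 := congr1 (fun w => w *m jacobian g (f z)) (mulmx_jacobian v df).
have h3 := mulmx_jacobian ('D_v f z) dg.
apply: (etrans h1); apply: (etrans _ (esym (etrans h2 h3))).
apply: (etrans (deriveE _ (differentiable_comp df dg))).
by rewrite (diff_comp df dg) (deriveE _ df) (deriveE _ dg).
Qed.

(** The chain rule; matrices act on row vectors on the right, so that the factors
come in the order of composition. *)
Lemma jacobian_transition c d e x : atlas c -> atlas d -> atlas e ->
  chart_dom c x -> chart_dom d x -> chart_dom e x ->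
  jacobian (c \o chart_inv e) (e x) =
  jacobian (d \o chart_inv e) (e x) *m jacobian (c \o chart_inv d) (d x).
Proof.
move=> ac ad ae cx dx ex.
have dE : (d \o chart_inv e) (e x) = d x by rewrite /= chart_funK.
have d1 := transition_differentiable ae ad ex dx.
have d2 := transition_differentiable ad ac dx cx.
rewrite -dE -(jacobian_comp d1); last by rewrite dE.
apply: near_eq_jacobian.
- exact: transition_differentiable.
- by apply: (differentiable_comp d1); rewrite dE.
- apply: filterS (near_chart_inv ex dx) => z [ez dz] /=.
  by rewrite chart_funK.
Qed.

Lemma jacobian_chart c x : atlas c -> chart_dom c x ->
  jacobian (c \o chart_inv c) (c x) = 1%:M.
Proof.
move=> ac cx; apply: mulmx_inj => v; rewrite mulmx1 mulmx_jacobian; last exact: transition_differentiable.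
rewrite -[RHS](derive_id (c x) v); apply: near_eq_derive.
apply: filterS (near_chart_inv cx cx) => z [cz _] /=.
by have [] := chart_invP cz.
Qed.

Lemma covector_change_comp c d e x zeta : atlas c -> atlas d -> atlas e ->
  chart_dom c x -> chart_dom d x -> chart_dom e x ->
  covector_change d e x (covector_change c d x zeta) = covector_change c e x zeta.
Proof.
move=> ac ad ae cx dx ex; rewrite /covector_change -mulmxA -trmx_mul.
by rewrite -(jacobian_transition ac ad ae).
Qed.

Lemma covector_change_id c x zeta : atlas c -> chart_dom c x ->
  covector_change c c x zeta = zeta.
Proof. by move=> ac cx; rewrite /covector_change jacobian_chart // trmx1 mulmx1. Qed.

Lemma covector_changeZ c d x (a : C) zeta :
  covector_change c d x (a *: zeta) = a *: covector_change c d x zeta.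
Proof. by rewrite /covector_change scalemxAl. Qed.

Lemma chart_atP x : atlas (chart_at x) /\ chart_dom (chart_at x) x.
Proof. exact: (projT2 (cid (atlas_cover x))). Qed.

Definition chart_image c (A : set T) : set E :=
  [set w | (c @` chart_dom c) w.1 /\ A (of_coords c w)].

Lemma to_coordsK c (p : T) : atlas c -> over_chart c p ->
  of_coords c (to_coords c p) = p.
Proof.
case: p => x zeta ac cx; rewrite /of_coords /to_coords /= chart_funK //.
have [a1 a2] := chart_atP x.
by rewrite covector_change_comp // covector_change_id.
Qed.

Lemma of_coordsK c (w : E) : atlas c -> (c @` chart_dom c) w.1 ->
  to_coords c (of_coords c w) = w /\ over_chart c (of_coords c w).
Proof.
case: w => z zeta ac /= cz; rewrite /to_coords /of_coords /=.
have [cx cE] := chart_invP cz; have [a1 a2] := chart_atP (chart_inv c z).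
by rewrite covector_change_comp // covector_change_id // cE; split.
Qed.

Lemma chart_imageE c (A : set T) : atlas c ->
  to_coords c @` (A `&` over_chart c) = chart_image c A.
Proof.
move=> ac; apply/seteqP; split=> w /=.
  move=> [p [Ap cp] <-]; split; first by exists p.1.
  by rewrite to_coordsK.
by move=> [cw Aw]; have [wE ow] := of_coordsK ac cw; exists (of_coords c w).
Qed.

Lemma open_chart_image c (A : set T) : atlas c -> open A -> open (chart_image c A).
Proof. by move=> ac oA; exact: (oA c ac). Qed.

(** This is how the open sets of the cotangent bundle are defined. *)
Lemma cont_of_coords c (w : E) : atlas c -> (c @` chart_dom c) w.1 ->
  cont (of_coords c : E -> T) w.
Proof.
move=> ac cw; split=> A /=; rewrite nbhsE => -[B [oB Bw] BA].
apply: (@filterS _ (nbhs w) (nbhs_filter w) (chart_image c B)).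
  by move=> v [_ /BA].
exact: (near_open (open_chart_image ac oB) (conj cw Bw)).
Qed.

Definition coord_change d c (w : E) : E := to_coords c (of_coords d w).

Lemma coord_changeE d c (w : E) : atlas c -> atlas d -> (d @` chart_dom d) w.1 ->
  chart_dom c (chart_inv d w.1) -> coord_change d c w =
  (c (chart_inv d w.1), w.2 *m (jacobian (d \o chart_inv c) (c (chart_inv d w.1)))^T).
Proof.
move=> ac ad dw cw; rewrite /coord_change /to_coords /of_coords /=.
have [dx dE] := chart_invP dw; have [a1 a2] := chart_atP (chart_inv d w.1).
by rewrite covector_change_comp.
Qed.

End Transitions.

Section CoordinateFunctions.
Variables (R : realType) (n : nat).
Local Notation C := R[i].
Local Notation Z := 'rV[C]_n.
Local Notation E := (coords R n).

Lemma ghol_eq (V : normedModType C) (D : set V) (F G : V -> C) : open D ->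
  (forall p, D p -> F p = G p) -> ghol D F -> ghol D G.
Proof.
move=> oD FG hF p Dp; have [cF dF] := hF p Dp.
have nFG : \forall q \near p, F q = G q.
  by apply: filterS (near_open oD Dp) => q Dq; exact: FG.
split; first exact: near_cont nFG cF.
by move=> v; apply: near_eq_derivable nFG (dF v).
Qed.

Lemma differentiable_row (V : normedModType C) (f : V -> Z) (p : V) :
  (forall j, differentiable (fun q => f q 0 j : C) p) -> differentiable f p.
Proof.
move=> df.
have -> : f = \sum_(j < n) (fun q => f q 0 j *: (delta_mx 0 j : Z)).
  by apply/funext => q; rewrite fct_sumE [LHS]row_sum_delta.
apply: differentiable_sum => j; exact: differentiableZl (df j).
Qed.

Lemma differentiable_fst (V W : normedModType C) (p : V * W) : differentiable fst p.
Proof. by apply: (@linear_differentiable _ _ _ fst) => q; exact: cvg_fst. Qed.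

Lemma differentiable_snd (V W : normedModType C) (p : V * W) : differentiable snd p.
Proof. by apply: (@linear_differentiable _ _ _ snd) => q; exact: cvg_snd. Qed.

Lemma differentiable_entry (V : normedModType C) (f : V -> Z) (p : V) j :
  differentiable f p -> differentiable (fun q => f q 0 j : C) p.
Proof. by move=> df; exact: differentiable_comp df (differentiable_coord _ 0 j). Qed.

(** The entries are derivatives of the coordinates of f, which are holomorphic by
Cauchy's formula. *)
Lemma ghol_jacobian (D : set Z) (f : Z -> Z) i j : open D -> holomorphic D f ->
  ghol D (fun z => jacobian f z i j).
Proof.
move=> oD hf.
have hj : ghol D (fun z => f z 0 j).
  by apply: holomorphic_ghol => z Dz; apply: differentiable_entry; exact: hf.
apply: (ghol_eq oD _ (ghol_derive (delta_mx 0 i) oD hj)) => z Dz.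
have h := mulmx_jacobian (delta_mx 0 i) (hf z Dz).
have -> : jacobian f z i j = (delta_mx (0 : 'I_1) i *m jacobian f z) 0 j.
  have h1 := congr1 (fun M : Z => M 0 j) (rowE i (jacobian f z)).
  by rewrite mxE in h1; exact: h1.
apply: etrans (esym (congr1 (fun M : Z => M 0 j) h)).
have dv : derivable f z (delta_mx 0 i) by apply: diff_derivable; exact: hf.
have cv := cvg_comp _ _ dv (@coord_continuous C 1 n 0 j ('D_(delta_mx 0 i) f z)).
have h2 := cvg_lim (@norm_hausdorff _ C) cv.
rewrite -h2 /derive.
apply: (congr1 (fun g : C -> C => lim (g @ 0^'))).
by apply/funext => t; rewrite /= !mxE.
Qed.

End CoordinateFunctions.

Section CoordinateChanges.
Variables (R : realType) (n : nat) (X : complex_manifold R n).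
Local Notation C := R[i].
Local Notation Z := 'rV[C]_n.
Local Notation E := (coords R n).
Local Notation T := (cotangent X).
Implicit Types (c d e : chart R n X) (x : X) (z : Z).

Definition change_dom d c : set E :=
  [set w | (d @` chart_dom d) w.1 /\ chart_dom c (chart_inv d w.1)].

Lemma open_change_dom d c : open (change_dom d c).
Proof.
have -> : change_dom d c = [set w | setT w /\ (d @` (chart_dom d `&` chart_dom c)) w.1].
  apply/seteqP; split=> w /=.
    by move=> [[x dx <-]]; rewrite chart_funK // => cx; split=> //; exists x.
  move=> [_ [x [dx cx] dxw]]; rewrite /change_dom /= -dxw.
  by split; [exists x | rewrite chart_funK].
apply: open_preimage; [exact: openT | exact: open_transition_dom |].
by move=> w _; exact: cont_fst.
Qed.

(** The base component is a transition map of the manifold; the fibre component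
is linear, and its coefficients are entries of the Jacobian matrix of the
inverse transition map. *)
Lemma coord_change_differentiable d c (w : E) : atlas c -> atlas d ->
  change_dom d c w -> differentiable (coord_change d c : E -> E) w.
Proof.
move=> ac ad; move: w.
pose D := c @` (chart_dom c `&` chart_dom d).
have oD : open D := open_transition_dom (c := c) (d := d).
have hD (w : E) : change_dom d c w -> D (c (chart_inv d w.1)).
  by move=> [dw cw]; have [dx _] := chart_invP dw; exists (chart_inv d w.1).
have dtau (w : E) : change_dom d c w -> differentiable (fun w : E => c (chart_inv d w.1)) w.
  move=> [dw cw]; have [dx dE] := chart_invP dw.
  apply: (@differentiable_comp _ _ _ _ fst (c \o chart_inv d)).
    exact: differentiable_fst.
  by rewrite -dE; exact: transition_differentiable.
pose Jt i k z := jacobian (d \o chart_inv c) z i k : C.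
have dJ i k (w : E) : change_dom d c w ->
    differentiable (fun w : E => Jt i k (c (chart_inv d w.1))) w.
  move=> Dw; apply: (@differentiable_comp _ _ _ _ _ (Jt i k)); first exact: dtau.
  apply: (ghol_differentiable oD) (hD w Dw); apply: (ghol_jacobian _ _ oD).
  by move=> z [x [cx dx] <-]; exact: transition_differentiable.
have g1 j : ghol (change_dom d c) (fun w : E => (coord_change d c w).1 0 j).
  apply: (@ghol_eq R E _ (fun w : E => (c (chart_inv d w.1) : Z) 0 j)).
  - exact: open_change_dom.
  - by move=> w [dw cw]; rewrite coord_changeE.
  - by apply: holomorphic_ghol => w Dw; apply: differentiable_entry; exact: dtau.
have g2 j : ghol (change_dom d c) (fun w : E => (coord_change d c w).2 0 j).
  apply: (@ghol_eq R E _ (\sum_(k < n) (fun w : E => w.2 0 k * Jt j k (c (chart_inv d w.1))))).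
  - exact: open_change_dom.
  - move=> w [dw cw]; rewrite coord_changeE // fct_sumE /= mxE.
    by apply: eq_bigr => k _; rewrite [in RHS]mxE.
  - apply: holomorphic_ghol => w Dw; apply: differentiable_sum => k.
    apply: differentiableM; last exact: dJ.
    by apply: differentiable_entry; exact: differentiable_snd.
move=> w Dw.
rewrite (_ : coord_change d c = fun w => ((coord_change d c w).1, (coord_change d c w).2)); last first.
  by apply/funext => v; case: (coord_change d c v).
have oE := @open_change_dom d c.
apply: differentiable_pair; apply: differentiable_row => j.
  exact: ghol_differentiable oE (g1 j) Dw.
exact: ghol_differentiable oE (g2 j) Dw.
Qed.

Lemma cont_to_coords c (p : T) : atlas c -> over_chart c p -> cont (to_coords c : T -> E) p.
Proof.
move=> ac cp; split=> A /=; rewrite nbhsE => -[B [oB Bw] BA].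
apply: (@filterS _ (nbhs p) (nbhs_filter p) [set q | over_chart c q /\ B (to_coords c q)]).
  by move=> q [_ /BA].
apply: near_open; last by split.
move=> d ad.
rewrite (_ : [set w | _] = [set w | change_dom d c w /\ B (coord_change d c w)]).
  apply: open_preimage; [exact: open_change_dom | exact: oB |].
  by move=> w Dw; apply: differentiable_cont; exact: coord_change_differentiable.
apply/seteqP; split=> w /=.
  by move=> [dw [cw Bc]]; split=> //; split.
by move=> [[dw cw] Bc].
Qed.

Lemma cont_base (p : T) : cont (base X : T -> X) p.
Proof.
split=> A /=; rewrite nbhsE => -[B [oB Bp] BA].
apply: (@filterS _ (nbhs p) (nbhs_filter p) (base X @^-1` B)); first by move=> q /BA.
suff oBB : open (base X @^-1` B : set T) by exact: near_open oBB Bp.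
move=> d ad.
rewrite (_ : [set w | _] = [set w | (fst @^-1` (d @` chart_dom d)) w /\ B (chart_inv d w.1)]) //.
apply: open_preimage => //.
  by apply: open_comp; [move=> w _; exact: cvg_fst | exact: chart_codom_open].
move=> w dw; apply: (@cont_comp _ _ _ fst (chart_inv d)); first exact: cont_fst.
exact: cont_chart_inv.
Qed.

Lemma open_base (U : set X) : open U -> open (base X @^-1` U).
Proof.
by move=> oU; apply: open_comp => // p _; have [] := cont_base p.
Qed.

Lemma open_over_chart c : open (over_chart c : set T).
Proof. exact: open_base (@chart_dom_open _ _ _ c). Qed.

(** Distinct base points are separated in X, distinct covectors at the same point
by their coordinates. *)
Lemma cotangent_hausdorff : hausdorff_space T.
Proof.
move=> p q pq; have bpq : p.1 = q.1.
  apply: (@manifold_hausdorff _ _ X) => A B Ap Bq.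
  have nb (r : T) (D : set X) : nbhs r.1 D -> nbhs r (base X @^-1` D).
    by move=> Dr; have [cb] := cont_base r; exact: (cb D Dr).
  have [r [/= Ar Br]] := pq _ _ (nb p A Ap) (nb q B Bq).
  by exists (base X r).
have [ac cp] := chart_atP p.1; set c := chart_at p.1 in ac cp.
have cq : over_chart c q by rewrite /over_chart /base /= -bpq.
have : to_coords c p = to_coords c q.
  apply: (@norm_hausdorff _ E) => A B Ap Bq.
  have nb (r : T) (D : set E) : over_chart c r -> nbhs (to_coords c r) D ->
      nbhs r (to_coords c @^-1` D).
    by move=> cr Dr; have [cb] := cont_to_coords ac cr; exact: (cb D Dr).
  have [r [/= Ar Br]] := pq _ _ (nb p A cp Ap) (nb q B cq Bq).
  by exists (to_coords c r).
move=> pqE; rewrite -(to_coordsK ac cp) -(to_coordsK ac cq).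
exact: (congr1 (of_coords c) pqE).
Qed.

Lemma of_coords_scale c (w : E) (t : R) :
  of_coords c (w.1, t%:C *: w.2) = scale t (of_coords c w) :> T.
Proof. by rewrite /of_coords /scale /= covector_changeZ. Qed.

Lemma to_coords_scale c (p : T) (t : R) :
  to_coords c (scale t p) = ((to_coords c p).1, t%:C *: (to_coords c p).2).
Proof. by rewrite /to_coords /scale /= covector_changeZ. Qed.

Lemma to_coords0 c (p : T) : p.2 = 0 -> (to_coords c p).2 = 0.
Proof. by rewrite /to_coords /= => ->; rewrite /covector_change mul0mx. Qed.

Lemma of_coords0 c (w : E) : w.2 = 0 -> (of_coords c w : T).2 = 0.
Proof. by rewrite /of_coords /= => ->; rewrite /covector_change mul0mx. Qed.

Lemma scale_scale (s t : R) (p : T) : scale s (scale t p) = scale (s * t) p.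
Proof. by rewrite /scale /= scalerA rmorphM. Qed.

Lemma scale1 (p : T) : scale 1 p = p.
Proof. by case: p => x z; rewrite /scale /= scale1r. Qed.

Lemma cont_scale (t : R) (p : T) : cont (scale t : T -> T) p.
Proof.
have [ac cp] := chart_atP p.1; set c := chart_at p.1 in ac cp.
apply: (@near_cont _ _ (fun q : T => of_coords c ((to_coords c q).1, t%:C *: (to_coords c q).2) : T)).
  apply: filterS (near_open (@open_over_chart c) (cp : over_chart c p)) => q cq.
  by rewrite of_coords_scale to_coordsK.
apply: (@cont_comp _ _ _ (fun q : T => ((to_coords c q).1, t%:C *: (to_coords c q).2) : E) (of_coords c)); last first.
  by apply: cont_of_coords => //; exists p.1.
have ct := cont_to_coords ac cp.
apply: cont_pair; first exact: cont_comp ct (cont_fst _).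
apply: contVZ; first exact: cont_cst.
exact: cont_comp ct (cont_snd _).
Qed.

End CoordinateChanges.

(** * Cones, wedges and fibre norms *)

Section Compactness.

(** Compactness in the form in which a property that holds locally on K, for all
indices near the limit, holds on the whole of K. *)
Lemma compact_uniform (T : topologicalType) (K : set T) (I : Type)
    (F : set_system I) (P : I -> T -> Prop) : Filter F -> compact K ->
  (forall x, K x -> exists A B, [/\ nbhs x A, F B & forall y i, A y -> B i -> P i y]) ->
  F [set i | forall x, K x -> P i x].
Proof.
move=> FF /compact_near_coveringP cK H; apply: (cK I F P FF) => x Kx.
have [A [B [nA FB AB]]] := H x Kx; exists (A, B) => //= -[y i] [/= Ay Bi].
exact: AB.
Qed.

Lemma compact_cball (R : realType) (m : nat) (r : R) :
  compact [set v : 'rV[R[i]]_m | nv v <= r].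
Proof.
have [r0|r0] := leP 0 r; last first.
  rewrite (_ : mkset _ = set0); first exact: compact0.
  apply/seteqP; split=> v //= h.
  by have := le_lt_trans (le_trans (nv_ge0 v) h) r0; rewrite ltxx.
have := @rV_compact R[i] m (fun=> [set z : R[i] | nc z <= r]) (fun=> @compact_cdisc R r).
congr compact; apply/seteqP; split=> v /= h; first exact: nv_le_coord.
by move=> j; apply: le_trans h; exact: nv_coord.
Qed.

Lemma rcontD (R : realType) (T : topologicalType) (f g : T -> R) p :
  cont f p -> cont g p -> cont (fun x => f x + g x) p.
Proof. by case=> cf [cg]; split; exact: cvgD cf cg. Qed.

Lemma rcontM (R : realType) (T : topologicalType) (f g : T -> R) p :
  cont f p -> cont g p -> cont (fun x => f x * g x) p.
Proof. by case=> cf [cg]; split; exact: cvgM cf cg. Qed.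

Lemma rcontB (R : realType) (T : topologicalType) (f g : T -> R) p :
  cont f p -> cont g p -> cont (fun x => f x - g x) p.
Proof. by case=> cf [cg]; split; exact: cvgB cf cg. Qed.

End Compactness.

Section FiberNorm.
Variables (R : realType) (n : nat).
Local Notation C := R[i].
Local Notation Z := 'rV[C]_n.

Lemma cnormZ (a : C) (v : Z) : cnorm (a *: v) = nc a * cnorm v.
Proof.
rewrite /cnorm (eq_bigr (fun j => nc a ^+ 2 * nc (v 0 j) ^+ 2)); last first.
  by move=> j _; rewrite mxE ncM exprMn.
by rewrite -mulr_sumr sqrtrM ?sqr_ge0 // sqrtr_sqr ger0_norm ?nc_ge0.
Qed.

Lemma cnorm_ge0 (v : Z) : 0 <= cnorm v. Proof. exact: sqrtr_ge0. Qed.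

Lemma cnorm_gt0 (v : Z) : v != 0 -> 0 < cnorm v.
Proof.
move=> v0; rewrite sqrtr_gt0 lt_neqAle sumr_ge0 ?andbT; last by move=> j _; exact: sqr_ge0.
apply: contra v0; rewrite eq_sym => h.
have h2 := psumr_eq0P (fun j _ => sqr_ge0 (nc (v 0 j))) (eqP h).
apply/eqP/rowP => j; rewrite mxE; apply: nc_eq0.
by have /eqP := h2 j isT; rewrite sqrf_eq0 => /eqP.
Qed.

Lemma cont_cnorm (v : Z) : cont (@cnorm R n) v.
Proof.
apply: (@cont_comp _ _ _ (fun v : Z => \sum_j nc (v 0 j) ^+ 2) Num.sqrt); last by split; exact: sqrt_continuous.
elim: (index_enum _) => [|j l IH].
  by apply: near_cont (cont_cst 0 v); apply: filterE => w; rewrite big_nil.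
have h : cont (fun v : Z => nc (v 0 j)) v.
  apply: (@cont_comp _ _ _ (fun v : Z => v 0 j) (fun z : C => nv z)).
    by split; exact: coord_continuous.
  by split; exact: (@continuous_nv R C).
apply: near_cont (rcontD (rcontM h h) IH); apply: filterE => w.
by rewrite big_cons expr2.
Qed.

End FiberNorm.

Section Wedges.
Variables (R : realType) (n : nat) (X : complex_manifold R n).
Local Notation C := R[i].
Local Notation Z := 'rV[C]_n.
Local Notation E := (coords R n).
Local Notation T := (cotangent X).
Implicit Types (c d : chart R n X) (V W K : set T) (p q : T).

(** The cotangent bundle is Hausdorff, so that its compact sets are closed. *)
Lemma rcompact_sub K K' V : K `<=` K' -> compact K' -> K' `<=` V -> relatively_compact K V.
Proof.
move=> KK' cK' KV; have cl : closed K' := compact_closed (@cotangent_hausdorff _ _ X) cK'.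
have sub : closure K `<=` K' by rewrite ((closure_id K').1 cl); exact: closure_subset.
split; first exact: subclosed_compact (closed_closure (A := K)) cK' sub.
exact: subset_trans sub KV.
Qed.

Lemma rcompact_le K V V' : V `<=` V' -> relatively_compact K V -> relatively_compact K V'.
Proof. by move=> VV' [cK KV]; split=> //; exact: subset_trans VV'. Qed.

Lemma rcompact_in K V : relatively_compact K V -> K `<=` V.
Proof. by move=> [_ KV]; apply: subset_trans KV; exact: subset_closure. Qed.

Lemma wedge_sub V V' W : open V' -> V' `<=` V -> conic V' -> wedge V W -> wedge V' (W `&` V').
Proof.
move=> oV' VV' cV' [oW WV hW]; split; [exact: openI | by move=> p [] | move=> K KV'].
have [d [d0 hd]] := hW K (rcompact_le VV' KV').
exists d; split=> // p t Kp dt; split; first exact: hd.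
by apply: cV'; [exact: rcompact_in KV' p Kp | exact: lt_trans dt].
Qed.

Lemma wedge_cap V W W' : wedge V W -> wedge V W' -> wedge V (W `&` W').
Proof.
move=> [oW WV hW] [oW' WV' hW']; split; [exact: openI | by move=> p [/WV] | move=> K KV].
have [d [d0 hd]] := hW K KV; have [d' [d0' hd']] := hW' K KV.
exists (Num.max d d'); split; first by rewrite lt_max d0.
by move=> p t Kp; rewrite gt_max => /andP[dt dt']; split; [exact: hd | exact: hd'].
Qed.

Lemma wedge_self V : open_conic V -> wedge V V.
Proof.
move=> [oV cV]; split=> // K KV; exists 1; split=> // p t Kp t1.
by apply: cV; [exact: rcompact_in KV p Kp | exact: lt_trans t1].
Qed.

(** The open sets of the p such that scale t p lies in W increase with t and cover
V, so that one of them contains a given compact set. *)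
Lemma wedge_upward V W : open W -> W `<=` V ->
  (forall p (t : R), W p -> 1 <= t -> W (scale t p)) ->
  (forall p, V p -> exists2 t : R, 0 < t & W (scale t p)) -> wedge V W.
Proof.
move=> oW WV upW hV; split=> // K [cK KV].
have := @compact_uniform _ (closure K) R +oo (fun t p => W (scale t p)) _ cK.
case.
  move=> p /KV/hV[t t0 Wt].
  exists (scale t @^-1` W), [set s | t < s]; split.
  - have [ct] := cont_scale t p; exact: (ct W (near_open oW Wt)).
  - by exists t; split; [exact: num_real | move=> s].
  - move=> q s /= Wq ts.
    have -> : scale s q = scale (s / t) (scale t q).
      by rewrite scale_scale mulfVK // gt_eqF.
    by apply: upW => //; rewrite ler_pdivlMr // mul1r ltW.
move=> M [Mr hM]; exists (Num.max M 1); split; first by rewrite lt_max ltr01 orbT.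
move=> p t Kp; rewrite gt_max => /andP[Mt _].
by apply: hM => //; exact: subset_closure.
Qed.

Lemma conic_sub V' V : conic V -> cone_relatively_compact V' V -> V' `<=` V.
Proof.
move=> cV [K [KV ->]] _ [p [t [Kp t0 ->]]]; apply: cV => //.
exact: rcompact_in KV p Kp.
Qed.

Lemma cone_rc_le V' V V1 : V `<=` V1 -> cone_relatively_compact V' V ->
  cone_relatively_compact V' V1.
Proof. by move=> VV1 [K [KV ->]]; exists K; split=> //; exact: rcompact_le KV. Qed.

Lemma conic_over V c : conic V -> conic (V `&` over_chart c).
Proof. by move=> cV p t [Vp cp] t0; split; [exact: cV|]. Qed.

Lemma fiber_norm_scale c (t : R) p : 0 <= t -> fiber_norm c (scale t p) = t * fiber_norm c p.
Proof. by move=> t0; rewrite /fiber_norm to_coords_scale /= cnormZ ncR ger0_norm. Qed.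

Lemma fiber_norm_gt0 c p : atlas c -> over_chart c p -> p.2 != 0 -> 0 < fiber_norm c p.
Proof.
move=> ac cp p0; apply: cnorm_gt0; apply: contra p0 => /eqP h.
by rewrite -(to_coordsK ac cp) of_coords0.
Qed.

Lemma cont_fiber_norm c p : atlas c -> over_chart c p -> cont (fiber_norm c : T -> R) p.
Proof.
move=> ac cp; apply: (@cont_comp _ _ _ (fun q : T => (to_coords c q).2) (@cnorm R n)).
  exact: cont_comp (cont_to_coords ac cp) (cont_snd _).
exact: cont_cnorm.
Qed.

(** The quotient of the two norms is homogeneous of degree zero, and locally
bounded because the cone avoids the zero section. *)
Lemma fiber_norm_compare c d V V' : atlas c -> atlas d -> V `<=` ~` zero_section X ->
  cone_relatively_compact V' (V `&` over_chart c `&` over_chart d) ->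
  exists2 M : R, 0 < M & forall p, V' p -> fiber_norm d p <= M * fiber_norm c p.
Proof.
move=> ac ad V0 [K [[cK KV] ->]].
have := @compact_uniform _ (closure K) R +oo (fun M p => fiber_norm d p <= M * fiber_norm c p) _ cK.
case.
  move=> p /KV[[Vp cp] dp].
  have Np : 0 < fiber_norm c p by apply: fiber_norm_gt0 => //; apply/eqP; exact: V0.
  pose M0 : R := fiber_norm d p / fiber_norm c p + 1.
  have hp : fiber_norm d p < M0 * fiber_norm c p.
    by rewrite -ltr_pdivrMr // /M0 ltrDl.
  exists [set q | 0 < M0 * fiber_norm c q - fiber_norm d q /\ 0 < fiber_norm c q], [set s | M0 < s]; split.
  - apply: (@filterI _ (nbhs p) (nbhs_filter p)).
      apply: (@cont_near _ _ (fun q : T => M0 * fiber_norm c q - fiber_norm d q) p [set x | 0 < x]).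
      + apply: rcontB (cont_fiber_norm ad dp).
        exact: rcontM (cont_cst M0 p) (cont_fiber_norm ac cp).
      + exact: open_gt.
      + by rewrite /= subr_gt0.
    apply: (@cont_near _ _ (fiber_norm c : T -> R) p [set x | 0 < x] (cont_fiber_norm ac cp)); [exact: open_gt | exact: Np].
  - by exists M0; split; [exact: num_real | move=> s].
  - move=> q s /= [h1 h2] Ms; rewrite subr_gt0 in h1.
    by apply: le_trans (ltW h1) _; rewrite ler_pM2r // ltW.
move=> M [Mr hM]; exists (Num.max M 0 + 1); first by rewrite ltr_pwDr // le_max lexx orbT.
move=> _ [p [t [Kp t0 ->]]]; rewrite !fiber_norm_scale ?(ltW t0) //.
rewrite mulrCA ler_pM2l //; apply: hM; last exact: subset_closure.
by rewrite ltr_pwDr // le_max lexx.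
Qed.

End Wedges.

(** * Fattening cones in the base directions *)

Lemma open_nv_ball (R : realType) (V : normedModType R[i]) (w0 : V) (s : R) :
  open [set v | nv (v - w0) < s].
Proof.
rewrite openE => v /= hv; apply/nbhs_nvP; exists (s - nv (v - w0)); rewrite ?subr_gt0 // => u hu.
by apply: le_lt_trans (nv_triangle _ _ v) _; rewrite -ltrBrDr.
Qed.

Section Fattening.
Variables (R : realType) (n : nat) (X : complex_manifold R n).
Local Notation C := R[i].
Local Notation Z := 'rV[C]_n.
Local Notation E := (coords R n).
Local Notation T := (cotangent X).
Implicit Types (c d : chart R n X) (V W K : set T) (p q : T).

Lemma nv_fst (v : Z) (e : R) : 0 < e -> nv v < e -> nv ((v, 0) : E) < e.
Proof. by move=> e0 ve; rewrite nv_pair ve nv0. Qed.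

Lemma scaleVK p (t : R) : 0 < t -> scale t (scale t^-1 p) = p.
Proof. by move=> t0; rewrite scale_scale divff ?gt_eqF // scale1. Qed.

Lemma scaleKV p (t : R) : 0 < t -> scale t^-1 (scale t p) = p.
Proof. by move=> t0; rewrite scale_scale mulVf ?gt_eqF // scale1. Qed.

Lemma cone_over_conic (N : set T) : conic (cone_over N).
Proof.
move=> _ s [p [t [Np t0 ->]]] s0; exists p, (s * t); split=> //; first exact: mulr_gt0.
by rewrite scale_scale.
Qed.

Lemma open_cone_over_set (N : set T) : open N -> N `<=` ~` zero_section X -> open_cone (cone_over N).
Proof.
move=> oN N0; split; last first.
  move=> _ [p [t [Np t0 ->]]] /= h; apply: (N0 p Np).
  have tn : t%:C != 0 :> C by rewrite -nc_gt0 ncR normr_gt0 gt_eqF.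
  by move/eqP: h; rewrite /= scaler_eq0 (negbTE tn) /= => /eqP.
split; last exact: cone_over_conic.
rewrite openE => _ [p [t [Np t0 ->]]].
apply: (@filterS _ (nbhs (scale t p)) (nbhs_filter _) (scale t^-1 @^-1` N)).
  by move=> q Nq; exists (scale t^-1 q), t; split=> //; rewrite scaleVK.
by apply: (@cont_near _ _ (scale t^-1 : T -> T) (scale t p) N (cont_scale _ _)); rewrite ?scaleKV.
Qed.

Definition box c (w0 : E) (s : R) : set T :=
  [set p | over_chart c p /\ nv (to_coords c p - w0) < s].

Lemma open_box c (w0 : E) (s : R) : atlas c -> open (box c w0 s).
Proof.
move=> ac.
apply: (@open_preimage _ _ (to_coords c : T -> E) (over_chart c) [set v | nv (v - w0) < s]).
- exact: open_over_chart.
- exact: open_nv_ball.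
- by move=> p cp; exact: cont_to_coords.
Qed.

Lemma compact_fatten (L O : set E) : compact L -> open O -> L `<=` O ->
  exists2 e : R, 0 < e & forall l w, L l -> nv w <= e -> O (l + w).
Proof.
move=> cL oO LO.
have := @compact_uniform _ L R 0^'+ (fun e l => forall w, nv w <= e -> O (l + w)) _ cL.
case.
  move=> l /LO Ol; have /nbhs_nvP[e e0 he] := near_open oO Ol.
  have e2 : 0 < e / 2 by rewrite divr_gt0.
  exists [set l' | nv (l' - l) < e / 2], [set x : R | x < e / 2]; split.
  - by apply/nbhs_nvP; exists (e / 2).
  - exact: nbhs_right_lt.
  - move=> l' x /= hl hx w hw; apply: he.
    have -> : l' + w - l = (l' - l) + w by rewrite addrAC.
    apply: le_lt_trans (nvD _ _) _; rewrite [e]splitr.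
    exact: ltrD hl (le_lt_trans hw hx).
move=> d /= d0 hd; exists (d / 2); first by rewrite divr_gt0.
move=> l w Ll; apply: hd => //=; last by rewrite divr_gt0.
by rewrite sub0r normrN gtr0_norm ?divr_gt0 // ltr_pdivrMr // ltr_pMr // ltr1n.
Qed.

(** A translation in the coordinates of c: it moves the base point and keeps the
components of the covector. *)
Definition shift_base c (v : Z) (p : T) : T := of_coords c (to_coords c p + (v, 0)).

Lemma cont_shift_base c (v : Z) p : atlas c -> over_chart c p ->
  (c @` chart_dom c) ((to_coords c p).1 + v) ->
  cont (fun a : Z * T => shift_base c a.1 a.2) (v, p).
Proof.
move=> ac cp cv.
apply: (@cont_comp _ _ _ (fun a : Z * T => to_coords c a.2 + (a.1, 0) : E) (of_coords c : E -> T)).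
  apply: contVD.
    have cs : cont (snd : Z * T -> T) (v, p) by exact: cont_snd.
    exact: (@cont_comp (Z * T)%type T E snd (to_coords c) (v, p) cs (cont_to_coords ac cp)).
  by apply: cont_pair; [exact: cont_fst | exact: cont_cst].
exact: cont_of_coords.
Qed.

Lemma shift_base_scale c (v : Z) p (t : R) :
  shift_base c v (scale t p) = scale t (shift_base c v p).
Proof.
rewrite /shift_base -of_coords_scale to_coords_scale; congr of_coords.
by apply/pair_equal_spec; split => //=; rewrite !addr0.
Qed.

Lemma rcompact_thickening c (L : set E) (s : R) V : atlas c -> compact L ->
  (forall l w, L l -> nv w <= s -> chart_image c V (l + w)) ->
  relatively_compact (\bigcup_(l in L) box c l s) (V `&` over_chart c).
Proof.
move=> ac cL hV; pose B := [set v : Z | nv v <= s].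
have LB (a : E * (Z * Z)) : (L `*` (B `*` B)) a -> chart_image c V (a.1 + a.2).
  case: a => l [w1 w2] [/= Ll [/= B1 B2]].
  apply: hV => //; apply/ler_addgt0Pl => x x0; apply: ltW.
  have sx : s < x + s by rewrite ltrDr.
  by rewrite nv_pair (le_lt_trans B1 sx) (le_lt_trans B2 sx).
apply: (@rcompact_sub _ _ _ _ ((fun a : E * (Z * Z) => of_coords c (a.1 + a.2) : T) @` (L `*` (B `*` B)))).
- move=> p [l Ll [cp hp]].
  exists (l, ((to_coords c p - l).1, (to_coords c p - l).2)).
    split; first exact: Ll.
    move: hp; case: (to_coords c p - l) => v1 v2.
    by rewrite nv_pair => /andP[/ltW h1 /ltW h2]; split.
  rewrite [X in _ + X](_ : _ = to_coords c p - l); last by case: (_ - _).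
  by rewrite addrC subrK to_coordsK.
- apply: compact_image; last by apply: compact_setX => //; apply: compact_setX; exact: compact_cball.
  move=> a La; have [h1 _] := LB a La.
  apply: (@cont_comp _ _ _ (fun a : E * (Z * Z) => a.1 + a.2 : E) (of_coords c : E -> T)).
    exact: (contVD (V := E) (cont_fst _) (cont_snd _)).
  exact: cont_of_coords.
- move=> _ [a La <-]; have [h1 h2] := LB a La.
  by split=> //; have [] := of_coordsK ac h1.
Qed.

Lemma rcompact_box c (w0 : E) (s s' : R) V : atlas c -> s < s' ->
  (forall w, nv (w - w0) < s' -> chart_image c V w) ->
  relatively_compact (box c w0 s) (V `&` over_chart c).
Proof.
move=> ac ss hV.
have := @rcompact_thickening c [set w0] s V ac (@compact_set1 E w0).
rewrite bigcup_set1; apply => _ w -> ws; apply: hV.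
by rewrite addrC addKr; exact: le_lt_trans ws ss.
Qed.

(** Estimates of derivatives in z at a point need bounds on a disc of fixed size
around it.  V'' is the cone over a neighbourhood of the compact base of V'. *)
Lemma fatten_cone V c V' : open_cone V -> atlas c ->
  cone_relatively_compact V' (V `&` over_chart c) ->
  exists e V'', [/\ 0 < e, open_cone V'',
    cone_relatively_compact V'' (V `&` over_chart c) &
    forall v p, V' p -> nv v <= e ->
      (c @` chart_dom c) ((to_coords c p).1 + v) /\ V'' (shift_base c v p)].
Proof.
move=> [[oV cV] V0] ac [K [[cK KV] ->]].
pose L := to_coords c @` closure K.
have cL : compact L.
  by apply: (compact_image _ cK) => p /KV[_ cp]; exact: cont_to_coords ac cp.
have oO := open_chart_image ac oV.
have LO : L `<=` chart_image c V.
  move=> _ [p /KV[Vp cp] <-]; split; first by exists p.1.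
  by rewrite to_coordsK.
have [e e0 he] := compact_fatten cL oO LO.
pose N := \bigcup_(l in L) box c l e.
have rN : relatively_compact N (V `&` over_chart c) by exact: rcompact_thickening.
have NV : N `<=` V `&` over_chart c := rcompact_in rN.
exists (e / 2), (cone_over N); split; first by rewrite divr_gt0.
- apply: open_cone_over_set; first by apply: bigcup_open => l _; exact: open_box.
  by move=> p /NV[/V0].
- by exists N.
- move=> v _ [p [t [Kp t0 ->]]] hv.
  have Ll : L (to_coords c p) by exists p => //; exact: subset_closure.
  have hv' : nv ((v, 0) : E) < e.
    by apply: nv_fst => //; apply: le_lt_trans hv _; rewrite ltr_pdivrMr // ltr_pMr // ltr1n.
  have [h1 h2] := he _ _ Ll (ltW hv'); split; first by rewrite to_coords_scale.
  rewrite shift_base_scale; exists (shift_base c v p), t; split=> //.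
  have [e1 e2] := of_coordsK ac h1; exists (to_coords c p); first exact: Ll.
  split; first exact: e2.
  by rewrite /shift_base e1 addrC addKr.
Qed.

(** The translates of a compact part of V' by the vectors of a ball form a compact
part of V'', to which the wedge property of W'' applies. *)
Lemma fatten_wedge c V' V'' (e : R) W'' : atlas c -> open_conic V' ->
  V' `<=` over_chart c ->
  (forall v p, V' p -> nv v <= e ->
      (c @` chart_dom c) ((to_coords c p).1 + v) /\ V'' (shift_base c v p)) ->
  wedge V'' W'' ->
  exists W', wedge V' W' /\ forall v p, W' p -> nv v <= e -> W'' (shift_base c v p).
Proof.
move=> ac [oV' cV'] V'c hV [oW'' WV'' hW''].
pose B := [set v : Z | nv v <= e].
have cB : compact B by exact: compact_cball.
exists [set p | V' p /\ forall v, B v -> W'' (shift_base c v p)]; split; last first.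
  by move=> v p [_ h] hv; exact: h.
split; last first.
- move=> K1 K1V'; have [cK1 clV'] := K1V'.
  pose K2 := (fun a : Z * T => shift_base c a.1 a.2) @` (B `*` closure K1).
  have cK2 : compact K2.
    apply: compact_image; last exact: compact_setX.
    move=> [v p] [/= Bv /clV' Vp]; have [h1 h2] := hV v p Vp Bv.
    by apply: cont_shift_base => //; exact: V'c.
  have K2V : K2 `<=` V'' by move=> _ [[v p] [/= Bv /clV' Vp] <-]; have [] := hV v p Vp Bv.
  have [d [d0 hd]] := hW'' K2 (rcompact_sub (@subset_refl _ K2) cK2 K2V).
  exists d; split=> // p t K1p dt; have V'p := rcompact_in K1V' K1p; split.
    by apply: cV' => //; exact: lt_trans dt.
  move=> v Bv; rewrite shift_base_scale; apply: hd => //.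
  by exists (v, p) => //; split=> //=; exact: subset_closure.
- by move=> p [].
- rewrite openE => p [Vp hp].
  apply: (@filterI _ (nbhs p) (nbhs_filter _)); first exact: near_open.
  apply: (@compact_uniform _ B T (nbhs p) (fun q v => W'' (shift_base c v q))) => // v Bv.
  have [h1 _] := hV v p Vp Bv.
  have [cs] := cont_shift_base ac (V'c p Vp) h1.
  have [[A A'] /= [nA nA'] AA] := cs W'' (near_open oW'' (hp v Bv)).
  by exists A, A'; split=> // u q Au Aq; exact: (AA (u, q)).
Qed.

End Fattening.

(** * Growth conditions and regularity in charts *)

Section LinearityOfWords.
Variables (R : realType) (n : nat).
Local Notation C := R[i].
Local Notation Z := 'rV[C]_n.
Local Notation E := (coords R n).
Implicit Types (F G : E -> C) (D : set E) (p q w : E) (j : 'I_n).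
Implicit Types (x : bool * 'I_n) (l : seq (bool * 'I_n)).

Lemma word_lincomb l D F G (a b : C) : open D -> smooth D F -> smooth D G ->
  forall p, D p -> wordD l (fun q => a * F q + b * G q) p = a * wordD l F p + b * wordD l G p.
Proof.
move=> oD sF sG; elim: l => [//|x l IH] p Dp /=.
have sL := smooth_word l oD (smooth_lincomb a b oD sF sG).
have sF' := smooth_word l oD sF; have sG' := smooth_word l oD sG.
rewrite (wirtinger_local x oD sL IH Dp) !wirtingerE /real_op.
have hr v := rder_lincomb a b (smooth_rderivable (v := v) sF' Dp) (smooth_rderivable (v := v) sG' Dp).
rewrite (hr _).2 (hr _).2.
move: (if x.1 then _ else _) => s.
have alg (A B s1 s2 k k' : C) : k * (a * A + b * B) + k' * (a * s1 + b * s2) =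
  a * (k * A + k' * s1) + b * (k * B + k' * s2) by ring.
exact: alg.
Qed.

Lemma ghol_cst (V : normedModType C) (D : set V) (a : C) : ghol D (fun=> a).
Proof. by move=> p _; split; [exact: cont_cst | move=> v; exact: derivable_cst]. Qed.

Lemma smooth0 D : open D -> smooth D (fun=> 0 : C).
Proof. by move=> oD; exact: ghol_smooth oD (ghol_cst _). Qed.

Lemma word0 l D p : open D -> D p -> wordD l (fun=> 0 : C) p = 0.
Proof.
move=> oD Dp; have s0 := smooth0 oD.
have E0 : (fun q : E => 0 * 0 + 0 * 0 : C) = fun=> 0.
  by apply/funext => q; rewrite mul0r addr0.
have H := word_lincomb l 0 0 oD s0 s0 Dp.
by rewrite -E0 H !mul0r addr0.
Qed.

Lemma multi0 F : multi (@dz R n) (fun=> 0%N) (multi (@dzbar R n) (fun=> 0%N) F) = F.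
Proof.
have H (op : 'I_n -> (E -> C) -> E -> C) G : multi op (fun=> 0%N) G = G.
  by rewrite /multi; elim: (enum _).
by rewrite !H.
Qed.

End LinearityOfWords.

Section Symbols.
Variables (R : realType) (n : nat) (X : complex_manifold R n).
Local Notation C := R[i].
Local Notation Z := 'rV[C]_n.
Local Notation E := (coords R n).
Local Notation T := (cotangent X).
Implicit Types (c d : chart R n X) (V W : set T) (p q : T) (f g : T -> C).

Lemma bounded_byP c W f (K h : R) : bounded_by c W f K h <->
  forall p, W p -> nc (f p) <= K * expR (h * fiber_norm c p).
Proof. by split=> H p Wp; have := H p Wp; rewrite normr_nc lecR. Qed.

Lemma bounded_sub c W W' f (K h : R) : W' `<=` W -> bounded_by c W f K h ->
  bounded_by c W' f K h.
Proof. by move=> sub H p /sub; exact: H. Qed.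

Lemma bounded_mono c W f (K h h' : R) : 0 <= K -> h <= h' ->
  bounded_by c W f K h -> bounded_by c W f K h'.
Proof.
move=> K0 hh /bounded_byP H; apply/bounded_byP => p Wp.
apply: le_trans (H p Wp) _; apply: ler_wpM2l => //.
by rewrite ler_expR ler_wpM2r //; exact: cnorm_ge0.
Qed.

Lemma bounded_lincomb c W f g (a : C) (K K' h : R) : bounded_by c W f K h ->
  bounded_by c W g K' h ->
  bounded_by c W (fun p => a * f p + g p) (nc a * K + K') h.
Proof.
move=> /bounded_byP hf /bounded_byP hg; apply/bounded_byP => p Wp.
apply: le_trans (ncD _ _) _; rewrite mulrDl ncM -mulrA; apply: lerD; last exact: hg.
by apply: ler_wpM2l; [exact: nc_ge0 | exact: hf].
Qed.

(** The common shape of the growth conditions of all symbol classes. *)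
Definition growth V W (Phi : chart R n X -> set T -> Prop) := forall c V',
  atlas c -> open_cone V' -> cone_relatively_compact V' (V `&` over_chart c) ->
  exists W', [/\ wedge V' W', W' `<=` W & Phi c W'].

Definition hereditary (Phi : chart R n X -> set T -> Prop) :=
  forall c W W', W' `<=` W -> Phi c W -> Phi c W'.

Lemma growth_impl V W Phi Psi : conic V ->
  (forall c W', atlas c -> W' `<=` W -> W' `<=` over_chart c -> Phi c W' -> Psi c W') ->
  growth V W Phi -> growth V W Psi.
Proof.
move=> cV H hg c V' ac oV' rV'; have [W' [wW' W'W PW']] := hg c V' ac oV' rV'.
exists W'; split=> //; apply: H => //.
have [_ W'V' _] := wW'; move=> p /W'V' V'p.
by have [] := conic_sub (conic_over cV) rV' V'p.
Qed.

Lemma growth_cap V W1 W2 Phi1 Phi2 : hereditary Phi1 -> hereditary Phi2 ->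
  growth V W1 Phi1 -> growth V W2 Phi2 ->
  growth V (W1 `&` W2) (fun c W' => Phi1 c W' /\ Phi2 c W').
Proof.
move=> h1 h2 g1 g2 c V' ac oV' rV'.
have [A [wA AW PA]] := g1 c V' ac oV' rV'; have [B [wB BW PB]] := g2 c V' ac oV' rV'.
exists (A `&` B); split; first exact: wedge_cap.
  by move=> p [/AW ? /BW].
by split; [apply: h1 PA => p [] | apply: h2 PB => p []].
Qed.

Lemma growth_sub V V1 W Phi : V1 `<=` V -> conic V1 -> growth V W Phi -> growth V1 (W `&` V1) Phi.
Proof.
move=> V1V cV1 hg c V' ac oV' rV'.
have [|W' [wW' W'W PW']] := hg c V' ac oV'.
  by apply: cone_rc_le rV' => p [/V1V].
exists W'; split=> // p W'p; split; first exact: W'W.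
have [_ W'V' _] := wW'.
by have [] := conic_sub (conic_over cV1) rV' (W'V' p W'p).
Qed.

Lemma growth_trivial V W : open_cone V -> wedge V W -> growth V W (fun _ _ => True).
Proof.
move=> [[oV cV] _] wW c V' ac [[oV' cV'] _] rV'.
have V'V : V' `<=` V by move=> p /(conic_sub (conic_over cV) rV')[].
exists (W `&` V'); split=> //; first exact: wedge_sub wW.
Qed.

Definition subexp f c W := forall h : R, 0 < h -> exists K, 0 < K /\ bounded_by c W f K h.
Definition expdecay f c W := exists h K : R, [/\ 0 < h, 0 < K & bounded_by c W f K (- h)].

Lemma subexp_hereditary f : hereditary (subexp f).
Proof.
move=> c W W' sub H h h0; have [K [K0 HK]] := H h h0.
by exists K; split=> //; exact: bounded_sub HK.
Qed.

Lemma expdecay_hereditary f : hereditary (expdecay f).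
Proof.
move=> c W W' sub [h [K [h0 K0 HK]]].
by exists h, K; split=> //; exact: bounded_sub HK.
Qed.

Lemma subexp_lincomb f g c W (a : C) : subexp f c W -> subexp g c W ->
  subexp (fun p => a * f p + g p) c W.
Proof.
move=> hf hg h h0; have [K [K0 HK]] := hf h h0; have [K' [K'0 HK']] := hg h h0.
exists (nc a * K + K'); split; last exact: bounded_lincomb.
by rewrite ltr_wpDl // mulr_ge0 ?nc_ge0 // ltW.
Qed.

Lemma expdecay_lincomb f g c W (a : C) : expdecay f c W -> expdecay g c W ->
  expdecay (fun p => a * f p + g p) c W.
Proof.
move=> [h [K [h0 K0 HK]]] [h' [K' [h'0 K'0 HK']]].
exists (Num.min h h'), (nc a * K + K'); split.
- by rewrite lt_min h0.
- by rewrite ltr_wpDl // mulr_ge0 ?nc_ge0 // ltW.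
- apply: bounded_lincomb; [apply: bounded_mono HK | apply: bounded_mono HK'];
    rewrite ?(ltW K0) ?(ltW K'0) // lerN2 ge_min lexx ?orbT //.
Qed.

Lemma expdecay_ext f g c W : (forall p, W p -> f p = g p) -> expdecay f c W -> expdecay g c W.
Proof.
move=> fg [h [K [h0 K0 HK]]]; exists h, K; split=> // p Wp.
by rewrite -fg //; exact: HK.
Qed.

Lemma subexp_ext f g c W : (forall p, W p -> f p = g p) -> subexp f c W -> subexp g c W.
Proof.
move=> fg hf h h0; have [K [K0 HK]] := hf h h0; exists K; split=> // p Wp.
by rewrite -fg //; exact: HK.
Qed.

Lemma chart_image_to c W p : atlas c -> over_chart c p -> W p -> chart_image c W (to_coords c p).
Proof. by move=> ac cp Wp; rewrite -chart_imageE //; exists p. Qed.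

Lemma chart_imageS c W W' : W' `<=` W -> chart_image c W' `<=` chart_image c W.
Proof. by move=> sub w [cw Ww]; split=> //; exact: sub. Qed.

Lemma holomorphic_on_ghol W f c : atlas c -> holomorphic_on W f ->
  ghol (chart_image c W) (in_chart c f).
Proof. by move=> ac hf; rewrite -chart_imageE //; exact: holomorphic_ghol (hf c ac). Qed.

Lemma slice_differentiable (D : set E) (F : E -> C) (w : E) : differentiable F w ->
  differentiable (fun zeta => F (w.1, zeta)) w.2.
Proof.
case: w => z zeta dF /=.
apply: (@differentiable_comp _ _ _ _ (fun zeta : Z => (z, zeta) : E) F) => //.
Qed.

Lemma holomorphic_smooth W f : open W -> holomorphic_on W f -> smooth_holomorphic_on W f.
Proof.
move=> oW hf c ac; split.
  rewrite chart_imageE //; apply: ghol_smooth; first exact: open_chart_image.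
  exact: holomorphic_on_ghol.
move=> p Wp cp; apply: (@slice_differentiable setT); apply: (hf c ac).
by exists p.
Qed.

Lemma holomorphic_on_sub W W' f : W' `<=` W -> holomorphic_on W f -> holomorphic_on W' f.
Proof.
move=> sub hf c ac _ [p [Wp cp] <-]; apply: (hf c ac).
by exists p => //; split=> //; exact: sub.
Qed.

Lemma smooth_holomorphic_sub W W' f : W' `<=` W -> smooth_holomorphic_on W f ->
  smooth_holomorphic_on W' f.
Proof.
move=> sub hf c ac; have [sf df] := hf c ac; split.
  by apply: smooth_sub sf => _ [p [Wp cp] <-]; exists p => //; split=> //; exact: sub.
by move=> p /sub; exact: df.
Qed.

Lemma holomorphic_on_lincomb W f g (a : C) : holomorphic_on W f -> holomorphic_on W g ->
  holomorphic_on W (fun p => a * f p + g p).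
Proof.
move=> hf hg c ac w Dw.
exact: differentiableD (differentiableZ a (hf c ac w Dw)) (hg c ac w Dw).
Qed.

Lemma smooth_on W f c : atlas c -> smooth_holomorphic_on W f ->
  smooth (chart_image c W) (in_chart c f).
Proof. by move=> ac hf; rewrite -chart_imageE //; have [] := hf c ac. Qed.

Lemma smooth_holomorphic_lincomb W f g (a : C) : open W -> smooth_holomorphic_on W f ->
  smooth_holomorphic_on W g -> smooth_holomorphic_on W (fun p => a * f p + g p).
Proof.
move=> oW hf hg c ac; have oD := open_chart_image ac oW; split.
  rewrite chart_imageE //.
  have := smooth_lincomb a 1 oD (smooth_on ac hf) (smooth_on ac hg).
  by congr smooth; apply/funext => w; rewrite mul1r.
move=> p Wp cp; have [_ df] := hf c ac; have [_ dg] := hg c ac.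
exact: differentiableD (differentiableZ a (df p Wp cp)) (dg p Wp cp).
Qed.

Lemma smooth_holomorphic_eq W f g : open W -> (forall p, W p -> f p = g p) ->
  smooth_holomorphic_on W f -> smooth_holomorphic_on W g.
Proof.
move=> oW fg hf c ac; have oD := open_chart_image ac oW.
have fgD w : chart_image c W w -> in_chart c f w = in_chart c g w by move=> [_ /fg].
split; first by rewrite chart_imageE //; exact: smooth_eq oD fgD (smooth_on ac hf).
move=> p Wp cp; have Dp := chart_image_to ac cp Wp.
pose S := [set zeta : Z | setT zeta /\ chart_image c W ((to_coords c p).1, zeta)].
have oS : open S.
  apply: open_preimage openT oD _.
  by move=> zeta _; apply: cont_pair; [exact: cont_cst | exact: cont_id].
have hS : ghol S (fun zeta => in_chart c f ((to_coords c p).1, zeta)).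
  apply: holomorphic_ghol => zeta [_ Dz]; have [cz Wz] := Dz.
  have [tz oz] := of_coordsK ac cz.
  by have := (hf c ac).2 _ Wz oz; rewrite tz.
apply: (ghol_differentiable oS); last first.
  by split=> //; case: (to_coords c p) Dp.
by apply: ghol_eq oS _ hS => zeta [_ /fgD].
Qed.

Lemma derivative_word c a b f : derivative c a b f = wordD (canonical_word a b) (in_chart c f) \o to_coords c.
Proof. by rewrite /derivative multi_word. Qed.

Lemma derivative0 c f p : atlas c -> over_chart c p ->
  derivative c (fun=> 0%N) (fun=> 0%N) f p = f p.
Proof. by move=> ac cp; rewrite /derivative multi0 /= /in_chart /= to_coordsK. Qed.

Lemma derivative_lincomb W c (a : C) al be f g p : atlas c -> open W ->
  smooth_holomorphic_on W f -> smooth_holomorphic_on W g -> W p -> over_chart c p ->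
  derivative c al be (fun p => a * f p + g p) p =
  a * derivative c al be f p + derivative c al be g p.
Proof.
move=> ac oW hf hg Wp cp; rewrite !derivative_word /=.
have := word_lincomb (canonical_word al be) a 1 (open_chart_image ac oW)
  (smooth_on ac hf) (smooth_on ac hg) (chart_image_to ac cp Wp).
rewrite mul1r => <-; congr wordD.
by apply/funext => w; rewrite mul1r.
Qed.

Lemma derivative_eq W c al be f g p : atlas c -> open W ->
  smooth_holomorphic_on W f -> (forall q, W q -> f q = g q) -> W p -> over_chart c p ->
  derivative c al be f p = derivative c al be g p.
Proof.
move=> ac oW hf fg Wp cp; rewrite !derivative_word /=.
apply: (word_local _ (open_chart_image ac oW) (smooth_on ac hf)); last exact: chart_image_to.
by move=> w [_ /fg].
Qed.

End Symbols.

(** * Classes of symbols *)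

Section SymbolClasses.
Variables (R : realType) (n : nat) (X : complex_manifold R n).
Local Notation C := R[i].
Local Notation Z := 'rV[C]_n.
Local Notation E := (coords R n).
Local Notation T := (cotangent X).
Implicit Types (c d : chart R n X) (V W : set T) (p q : T) (f g : T -> C).

Definition subexp_derivatives f c (W : set T) := forall al be, subexp (derivative c al be f) c W.
Definition decaying_derivatives f c (W : set T) := forall al be, expdecay (derivative c al be f) c W.

Lemma decaying_derivatives_hereditary f : hereditary (decaying_derivatives f).
Proof. by move=> c W W' sub H al be; apply: expdecay_hereditary sub (H al be). Qed.

Lemma open_conic_over V c : open_conic V -> open_conic (V `&` over_chart c).
Proof. by move=> [oV cV]; split; [apply: openI => //; exact: open_over_chart | exact: conic_over]. Qed.

Lemma open_cone_over V c : open_cone V -> open_cone (V `&` over_chart c).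
Proof. by move=> [oV V0]; split; [exact: open_conic_over | move=> p [/V0]]. Qed.

Lemma frakS_on_sub V V1 W f : open_conic V1 -> V1 `<=` V -> frakS_on V f W ->
  frakS_on V1 f (W `&` V1).
Proof.
move=> [oV1 cV1] V1V [wW hW gW]; split; first exact: wedge_sub wW.
  by apply: holomorphic_on_sub hW => p [].
exact: growth_sub V1V cV1 gW.
Qed.

Lemma frakS_sub V V1 f : open_conic V1 -> V1 `<=` V -> frakS V f -> frakS V1 f.
Proof. by move=> oV1 V1V [W hW]; exists (W `&` V1); exact: frakS_on_sub hW. Qed.

Lemma frakN_sub V V1 f : open_conic V1 -> V1 `<=` V -> frakN V f -> frakN V1 f.
Proof.
move=> oV1 V1V [W [hW gW]]; exists (W `&` V1); split; first exact: frakS_on_sub hW.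
exact: (growth_sub (Phi := expdecay f) V1V oV1.2 gW).
Qed.

Lemma frakNoo_sub V V1 f : open_conic V1 -> V1 `<=` V -> frakNoo V f -> frakNoo V1 f.
Proof.
move=> [oV1 cV1] V1V [W [wW sW gW]]; exists (W `&` V1); split; first exact: wedge_sub wW.
  by apply: smooth_holomorphic_sub sW => p [].
exact: (growth_sub (Phi := decaying_derivatives f) V1V cV1 gW).
Qed.

Lemma frakSoo_sub V V1 f : open_conic V1 -> V1 `<=` V -> frakSoo V f -> frakSoo V1 f.
Proof.
move=> [oV1 cV1] V1V [W [wW sW gW dW]]; exists (W `&` V1); split; first exact: wedge_sub wW.
- by apply: smooth_holomorphic_sub sW => p [].
- exact: (growth_sub (Phi := subexp_derivatives f) V1V cV1 gW).
- move=> c j ac; apply: frakNoo_sub (dW c j ac); first exact: open_conic_over.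
  by move=> p [/V1V].
Qed.

Lemma frakS_lincomb V f g (a : C) : frakS V f -> frakS V g ->
  frakS V (fun p => a * f p + g p).
Proof.
move=> [W [wW hW gW]] [W' [wW' hW' gW']]; exists (W `&` W'); split.
- exact: wedge_cap.
- by apply: holomorphic_on_lincomb;
    [apply: holomorphic_on_sub hW => p [] | apply: holomorphic_on_sub hW' => p []].
- have G := growth_cap (@subexp_hereditary _ _ X f) (@subexp_hereditary _ _ X g) gW gW'.
  move=> c V' ac oV' rV'; have [A [wA AW [hf hg]]] := G c V' ac oV' rV'.
  by exists A; split=> //; exact: subexp_lincomb.
Qed.

Lemma frakN_lincomb V f g (a : C) : frakN V f -> frakN V g ->
  frakN V (fun p => a * f p + g p).
Proof.
move=> [W [[wW hW gW] nW]] [W' [[wW' hW' gW'] nW']]; exists (W `&` W'); split; first split.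
- exact: wedge_cap.
- by apply: holomorphic_on_lincomb;
    [apply: holomorphic_on_sub hW => p [] | apply: holomorphic_on_sub hW' => p []].
- have G := growth_cap (@subexp_hereditary _ _ X f) (@subexp_hereditary _ _ X g) gW gW'.
  move=> c V' ac oV' rV'; have [A [wA AW [hf hg]]] := G c V' ac oV' rV'.
  by exists A; split=> //; exact: subexp_lincomb.
- have G := growth_cap (@expdecay_hereditary _ _ X f) (@expdecay_hereditary _ _ X g) nW nW'.
  move=> c V' ac oV' rV'; have [A [wA AW [hf hg]]] := G c V' ac oV' rV'.
  by exists A; split=> //; exact: expdecay_lincomb.
Qed.

Lemma smooth_wedge_lincomb V W W' f g (a : C) : wedge V W -> wedge V W' ->
  smooth_holomorphic_on W f -> smooth_holomorphic_on W' g ->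
  smooth_holomorphic_on (W `&` W') (fun p => a * f p + g p).
Proof.
move=> [oW _ _] [oW' _ _] sW sW'; apply: smooth_holomorphic_lincomb; first exact: openI.
  by apply: smooth_holomorphic_sub sW => p [].
by apply: smooth_holomorphic_sub sW' => p [].
Qed.

(** Q is one of the two growth conditions, subexponential or decaying. *)
Lemma growth_derivative_lincomb V W W' f g (a : C) (Q : (T -> C) -> chart R n X -> set T -> Prop) :
  conic V -> wedge V W -> wedge V W' ->
  smooth_holomorphic_on W f -> smooth_holomorphic_on W' g ->
  (forall f, hereditary (Q f)) ->
  (forall f g c A, Q f c A -> Q g c A -> Q (fun p => a * f p + g p) c A) ->
  (forall f g c (A : set T), (forall p, A p -> f p = g p) -> Q f c A -> Q g c A) ->
  growth V W (fun c A => forall al be, Q (derivative c al be f) c A) ->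
  growth V W' (fun c A => forall al be, Q (derivative c al be g) c A) ->
  growth V (W `&` W') (fun c A => forall al be, Q (derivative c al be (fun p => a * f p + g p)) c A).
Proof.
move=> cV wW wW' sW sW' hQ lQ eQ gW gW'.
have [oW _ _] := wW; have [oW' _ _] := wW'.
have hQ' (k : T -> C) : hereditary (fun c A => forall al be, Q (derivative c al be k) c A).
  by move=> c A B BA H al be; apply: hQ BA (H al be).
apply: growth_impl cV _ (growth_cap (hQ' f) (hQ' g) gW gW') => c A ac AW Ac [hf hg] al be.
apply: eQ (lQ _ _ _ _ (hf al be) (hg al be)) => p Ap.
rewrite (@derivative_lincomb _ _ _ (W `&` W')) //; [exact: openI | | | exact: AW | exact: Ac].
  by apply: smooth_holomorphic_sub sW => q [].
by apply: smooth_holomorphic_sub sW' => q [].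
Qed.

Lemma frakNoo_lincomb V f g (a : C) : conic V -> frakNoo V f -> frakNoo V g ->
  frakNoo V (fun p => a * f p + g p).
Proof.
move=> cV [W [wW sW gW]] [W' [wW' sW' gW']]; exists (W `&` W'); split.
- exact: wedge_cap.
- exact: smooth_wedge_lincomb wW wW' sW sW'.
- apply: (growth_derivative_lincomb (Q := @expdecay _ _ X) cV wW wW' sW sW' _ _ _ gW gW').
  + by move=> k; exact: expdecay_hereditary.
  + by move=> k k' c A; exact: expdecay_lincomb.
  + by move=> k k' c A; exact: expdecay_ext.
Qed.

(** Only the values on a wedge matter. *)
Lemma frakNoo_eq V W0 f g : conic V -> wedge V W0 -> (forall p, W0 p -> f p = g p) ->
  frakNoo V f -> frakNoo V g.
Proof.
move=> cV wW0 fg [W [wW sW gW]]; exists (W `&` W0).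
have wI := wedge_cap wW wW0; have [oI _ _] := wI.
have sI : smooth_holomorphic_on (W `&` W0) f by apply: smooth_holomorphic_sub sW => p [].
have fgI p : (W `&` W0) p -> f p = g p by move=> [_ /fg].
split=> //; first exact: smooth_holomorphic_eq oI fgI sI.
move=> c V' ac oV' rV'; have [A [wA AW hA]] := gW c V' ac oV' rV'.
have [_ WV0 _] := wW0; have [_ AV' _] := wA.
have V'V : V' `<=` V `&` over_chart c := conic_sub (conic_over cV) rV'.
have wW0' : wedge V' (W0 `&` V').
  by apply: wedge_sub wW0 => //; [exact: oV'.1.1 | move=> p /V'V[] | exact: oV'.1.2].
exists (A `&` (W0 `&` V')); split; first exact: wedge_cap.
  by move=> p [/AW Wp [W0p _]].
move=> al be; apply: (@expdecay_ext _ _ X (derivative c al be f)).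
  move=> p [/AW Wp [W0p V'p]]; apply: (derivative_eq al be ac oI sI fgI) => //.
  by have [] := V'V p V'p.
by apply: expdecay_hereditary (hA al be) => p [].
Qed.

Lemma holomorphic_on0 W : holomorphic_on W (fun _ : T => 0 : C).
Proof. by move=> c ac w _; exact: differentiable_cst. Qed.

Lemma bounded0 c W (h : R) : bounded_by c W (fun _ : T => 0 : C) 1 h.
Proof. by apply/bounded_byP => p _; rewrite nc0 mul1r expR_ge0. Qed.

Lemma frakN0 V : open_cone V -> frakN V (fun=> 0).
Proof.
move=> oV; have wV := wedge_self oV.1; exists V; split; first split.
- exact: wV.
- exact: holomorphic_on0.
- apply: growth_impl oV.1.2 _ (growth_trivial oV wV) => c A _ _ _ _ h h0.
  by exists 1; split=> //; exact: bounded0.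
- apply: (growth_impl oV.1.2 _ (growth_trivial oV wV)) => c A _ _ _ _.
  by exists 1, 1; split=> //; exact: bounded0.
Qed.

Lemma frakNoo0 V W f : open_cone V -> wedge V W -> (forall p, W p -> f p = 0) -> frakNoo V f.
Proof.
move=> oV wW f0; apply: (@frakNoo_eq V W (fun=> 0)) wW _ _; first exact: oV.1.2.
  by move=> p /f0.
have wV := wedge_self oV.1; exists V; split.
- exact: wV.
- by apply: holomorphic_smooth; [exact: oV.1.1 | exact: holomorphic_on0].
- apply: (growth_impl oV.1.2 _ (growth_trivial oV wV)) => c A ac AV Ac _ al be.
  exists 1, 1; split; [exact: ltr01 | exact: ltr01 |].
  apply/bounded_byP => p Ap; rewrite derivative_word /=.
  have -> : in_chart c (fun _ : T => 0 : C) = fun=> 0 by [].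
  rewrite (word0 _ (open_chart_image ac oV.1.1)); last by apply: chart_image_to; auto.
  by rewrite nc0 mul1r expR_ge0.
Qed.

Lemma frakSoo_lincomb V f g (a : C) : conic V -> frakSoo V f -> frakSoo V g ->
  frakSoo V (fun p => a * f p + g p).
Proof.
move=> cV [W [wW sW gW dW]] [W' [wW' sW' gW' dW']]; exists (W `&` W').
have [oW _ _] := wW; have [oW' _ _] := wW'; split.
- exact: wedge_cap.
- exact: smooth_wedge_lincomb wW wW' sW sW'.
- apply: (growth_derivative_lincomb (Q := @subexp _ _ X) cV wW wW' sW sW' _ _ _ gW gW').
  + by move=> k; exact: subexp_hereditary.
  + by move=> k k' c A; exact: subexp_lincomb.
  + by move=> k k' c A; exact: subexp_ext.
- move=> c j ac; have cVc := conic_over (c := c) cV.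
  have := frakNoo_lincomb a cVc (dW c j ac) (dW' c j ac).
  have oc := @open_over_chart _ _ X c.
  have oI : open (W `&` W') by exact: openI.
  have sI : smooth_holomorphic_on (W `&` W') f by apply: smooth_holomorphic_sub sW => q [].
  have sI' : smooth_holomorphic_on (W `&` W') g by apply: smooth_holomorphic_sub sW' => q [].
  have wI : wedge (V `&` over_chart c) ((W `&` W') `&` over_chart c).
    have [_ WV hW] := wedge_cap wW wW'; split; [exact: openI | | ].
      by move=> p [/WV Vp cp].
    move=> K rK; have [|d [d0 hd]] := hW K; first by apply: rcompact_le rK => p [].
    exists d; split=> // p t Kp dt; split; first exact: hd.
    by have [_ cp] := rcompact_in rK Kp.
  apply: (frakNoo_eq cVc wI) => p [Wp cp].
  have H := word_lincomb [:: (false, j)] a 1 (open_chart_image ac oI)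
    (smooth_on ac sI) (smooth_on ac sI') (chart_image_to ac cp Wp).
  rewrite mul1r in H; apply: (etrans (esym H)).
  apply: (congr1 (fun F : E -> C => dzbar j F (to_coords c p))).
  by apply/funext => w; rewrite mul1r.
Qed.

Lemma fiber_norm_shift c v p : atlas c -> (c @` chart_dom c) ((to_coords c p).1 + v) ->
  fiber_norm c (shift_base c v p) = fiber_norm c p.
Proof.
move=> ac h; rewrite /fiber_norm /shift_base.
by have [-> _] := of_coordsK (w := to_coords c p + (v, 0)) ac h; rewrite /= addr0.
Qed.

Lemma shift_base0 c p : atlas c -> over_chart c p -> shift_base c 0 p = p.
Proof. by move=> ac cp; rewrite /shift_base -[(0, 0)]/(0 : E) addr0 to_coordsK. Qed.

(** Decay of the values alone is enough: the derivatives of a smooth symbol grow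
less than any exponential, so that Landau's inequality makes them decay. *)
Lemma frakNoo_decay V f : open_cone V -> frakSoo V f ->
  (exists2 W, wedge V W & growth V W (expdecay f)) -> frakNoo V f.
Proof.
move=> oV [W [wW sW gW dW]] [W1 wW1 gW1]; exists W; split=> // c V' ac oV' rV'.
have V'V : V' `<=` V `&` over_chart c := conic_sub (conic_over oV.1.2) rV'.
have [e [V'' [e0 oV'' rV'' hV'']]] := fatten_cone oV ac rV'.
have [A [wA AW hA]] := gW c V'' ac oV'' rV''.
have [B [wB BW hB]] := gW1 c V'' ac oV'' rV''.
have V'c : V' `<=` over_chart c by move=> p /V'V[].
have [W' [wW' hW']] := fatten_wedge ac oV'.1 V'c hV'' (wedge_cap wA wB).
have [_ W'V' _] := wW'; have [oW _ _] := wW.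
have W'W : W' `<=` W.
  move=> p W'p; rewrite -(@shift_base0 c p) //; last by apply: V'c; exact: W'V'.
  by apply: AW; have [] := hW' 0 p W'p (eq_ind_r (fun x => x <= e) (ltW e0) (nv0 _)).
exists W'; split=> // al be; rewrite derivative_word.
have inC p v : W' p -> nv v <= e -> (c @` chart_dom c) ((to_coords c p).1 + v).
  by move=> /W'V' V'p hv; have [] := hV'' v p V'p hv.
have toD p v : W' p -> nv v <= e ->
    to_coords c (shift_base c v p) = to_coords c p + (v, 0) /\ over_chart c (shift_base c v p).
  by move=> W'p hv; exact: (@of_coordsK _ _ X c (to_coords c p + (v, 0)) ac (inC p v W'p hv)).
have oD := open_chart_image ac oW; have sD := smooth_on ac sW.
have inD p v : W' p -> nv v <= e -> chart_image c W (to_coords c p + (v, 0)).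
  by move=> W'p hv; split; [exact: inC | exact: AW (hW' v p W'p hv).1].
have := @words_decay R n (chart_image c W) (in_chart c f) (fun w => cnorm w.2)
  (to_coords c @` W') e (canonical_word al be) oD sD e0.
case.
- by move=> q; exact: cnorm_ge0.
- by move=> q v; rewrite /= addr0.
- by move=> _ v [p W'p <-] hv; exact: inD.
- have [h [K [h0 K0 /bounded_byP HK]]] := hB; exists h, K; split=> // _ v [p W'p <-] hv.
  have := HK _ (hW' v p W'p hv).2; rewrite fiber_norm_shift //; exact: inC.
- move=> l h h0; have [al' [be' Hl]] := @word_multi R n l.
  have [K [K0 /bounded_byP HK]] := hA al' be' h h0; exists K => _ v [p W'p <-] hv.
  have := HK _ (hW' v p W'p hv).1; rewrite fiber_norm_shift //; last exact: inC.
  rewrite /derivative /= (toD p v W'p hv).1.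
  by rewrite -(Hl _ _ _ oD sD (inD p v W'p hv)).
move=> h [K [h0 K0 HK]]; exists h, K; split=> //; apply/bounded_byP => p W'p.
by apply: HK; exists p.
Qed.

(** Cauchy's estimates on discs of fixed size in z bound the derivatives by the
symbol, and the derivatives in zbar vanish. *)
Lemma frakS_frakSoo V f : open_cone V -> frakS V f -> frakSoo V f.
Proof.
move=> oV [W [wW hW gW]]; have [oW WV _] := wW; exists W; split=> //.
- exact: holomorphic_smooth.
- move=> c V' ac oV' rV'.
  have V'V : V' `<=` V `&` over_chart c := conic_sub (conic_over oV.1.2) rV'.
  have [e [V'' [e0 oV'' rV'' hV'']]] := fatten_cone oV ac rV'.
  have [A [wA AW hA]] := gW c V'' ac oV'' rV''.
  have V'c : V' `<=` over_chart c by move=> p /V'V[].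
  have [W' [wW' hW']] := fatten_wedge ac oV'.1 V'c hV'' wA.
  have [_ W'V' _] := wW'.
  have W'W : W' `<=` W.
    move=> p W'p; rewrite -(@shift_base0 c p) //; last by apply: V'c; exact: W'V'.
    by apply: AW; exact: hW' 0 p W'p (eq_ind_r (fun x => x <= e) (ltW e0) (nv0 _)).
  exists W'; split=> // al be h h0; rewrite derivative_word.
  have [k k0 Hk] := word_cauchy (n := n) (canonical_word al be) e0.
  have [K [K0 /bounded_byP HK]] := hA h h0.
  exists (k * K); split; first exact: mulr_gt0.
  apply/bounded_byP => p W'p; rewrite -mulrA.
  apply: (Hk (chart_image c W)); [exact: open_chart_image | exact: holomorphic_on_ghol |].
  move=> v hv; have [h1 _] := hV'' v p (W'V' p W'p) hv; have Av := hW' v p W'p hv.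
  split; first by split=> //; exact: AW.
  by have := HK _ Av; rewrite fiber_norm_shift.
- move=> c j ac; apply: (@frakNoo0 _ (W `&` over_chart c)); first exact: open_cone_over.
    split; [by apply: openI => //; exact: open_over_chart | by move=> p [/WV] |].
    move=> K rK; have [_ _ hK] := wW.
    have [|d [d0 hd]] := hK K; first by apply: rcompact_le rK => p [].
    exists d; split=> // p t Kp dt; split; first exact: hd.
    by have [_ cp] := rcompact_in rK Kp.
  move=> p [Wp cp] /=.
  exact: (word_dzbar_ghol j (open_chart_image ac oW) (holomorphic_on_ghol ac hW) (chart_image_to ac cp Wp)).
Qed.

Lemma frakN_frakNoo V f : open_cone V -> frakN V f -> frakNoo V f.
Proof.
move=> oV [W [hW gW]]; apply: frakNoo_decay => //.
  by apply: frakS_frakSoo => //; exists W.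
by exists W => //; have [] := hW.
Qed.

(** The derivative of order zero already gives the decay required of f. *)
Lemma frakS_frakNoo_frakN V f : open_cone V -> frakS V f -> frakNoo V f -> frakN V f.
Proof.
move=> oV [W hW] [W1 [wW1 sW1 gW1]].
have [wW holW gW] := hW; have wI := wedge_cap wW wW1; have [oI _ _] := wI.
exists (W `&` W1); split.
  split=> //; first by apply: holomorphic_on_sub holW => p [].
  have G := growth_cap (@subexp_hereditary _ _ X f) (@decaying_derivatives_hereditary f) gW gW1.
  by apply: growth_impl oV.1.2 _ G => c A _ _ _ [].
have G := growth_cap (@subexp_hereditary _ _ X f) (@decaying_derivatives_hereditary f) gW gW1.
apply: (growth_impl (Psi := expdecay f) oV.1.2 _ G) => c A ac AW Ac [_ hA].
apply: expdecay_ext (hA (fun=> 0%N) (fun=> 0%N)) => p Ap.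
by rewrite derivative0 //; exact: Ac.
Qed.

End SymbolClasses.

(** * Local holomorphic representatives *)

Lemma nv_coords_le (R : realType) (n : nat) (a b : coords R n) :
  nv (a.1 - b.1) <= nv (a - b) /\ nv (a.2 - b.2) <= nv (a - b).
Proof.
case: a b => [a1 a2] [b1 b2] /=.
suff H x : 0 < x -> nv (a1 - b1) < x + nv ((a1, a2) - (b1, b2) : coords R n) /\
    nv (a2 - b2) < x + nv ((a1, a2) - (b1, b2) : coords R n).
  by split; apply/ler_addgt0Pl => x x0; apply: ltW; have [] := H x x0.
move=> x0.
have : nv ((a1, a2) - (b1, b2) : coords R n) < x + nv ((a1, a2) - (b1, b2) : coords R n) by rewrite ltrDr.
by rewrite {1}/GRing.add /= nv_pair => /andP[].
Qed.

Section Transfer.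
Variables (R : realType) (n : nat) (X : complex_manifold R n).
Local Notation C := R[i].
Local Notation T := (cotangent X).
Implicit Types (c d : chart R n X) (V W : set T) (p q : T) (f g : T -> C).

(** Estimates in one chart give estimates in all others, since the fibre norms
are equivalent on relatively compact cones. *)
Lemma growth_change V W c (P : chart R n X -> set T -> Prop) : open_cone V -> atlas c ->
  V `<=` over_chart c -> wedge V W -> hereditary P ->
  (forall d A (M M' : R), 0 < M -> 0 < M' ->
     (forall p, A p -> fiber_norm d p <= M * fiber_norm c p) ->
     (forall p, A p -> fiber_norm c p <= M' * fiber_norm d p) ->
     P c A -> P d A) ->
  P c W -> growth V W P.
Proof.
move=> oV ac Vc wW hP tP Pc d V' ad [[oV' cV'] _] rV'.
have V'V : V' `<=` V `&` over_chart d := conic_sub (conic_over oV.1.2) rV'.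
have rcd : cone_relatively_compact V' (V `&` over_chart c `&` over_chart d).
  by apply: cone_rc_le rV' => p [Vp dp]; split=> //; split=> //; exact: Vc.
have rdc : cone_relatively_compact V' (V `&` over_chart d `&` over_chart c).
  by apply: cone_rc_le rV' => p [Vp dp]; split=> //; exact: Vc.
have [M M0 HM] := fiber_norm_compare ac ad oV.2 rcd.
have [M' M'0 HM'] := fiber_norm_compare ad ac oV.2 rdc.
exists (W `&` V'); split; [by apply: wedge_sub wW => // p /V'V[] | by move=> p [] |].
apply: (tP d _ M M') => //.
- by move=> p [_ /HM].
- by move=> p [_ /HM'].
- by apply: hP Pc => p [].
Qed.

Lemma ler_rescale (h M x y : R) : 0 < h -> 0 < M -> x <= M * y -> h / M * x <= h * y.
Proof. by move=> h0 M0 xy; rewrite -mulrA ler_pM2l // ler_pdivrMl. Qed.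

Lemma subexp_growth V W c f : open_cone V -> atlas c -> V `<=` over_chart c ->
  wedge V W -> subexp f c W -> growth V W (subexp f).
Proof.
move=> oV ac Vc wW.
apply: (growth_change (P := subexp f) oV ac Vc wW (@subexp_hereditary _ _ X f)).
move=> d A M M' M0 M'0 _ cd hf h h0; have [K [K0 /bounded_byP HK]] := hf _ (divr_gt0 h0 M'0).
exists K; split=> //; apply/bounded_byP => p Ap; apply: le_trans (HK p Ap) _.
rewrite (ler_pM2l K0) ler_expR; exact: ler_rescale h0 M'0 (cd p Ap).
Qed.

Lemma expdecay_growth V W c f : open_cone V -> atlas c -> V `<=` over_chart c ->
  wedge V W -> expdecay f c W -> growth V W (expdecay f).
Proof.
move=> oV ac Vc wW.
apply: (growth_change (P := expdecay f) oV ac Vc wW (@expdecay_hereditary _ _ X f)).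
move=> d A M M' M0 M'0 dc _ [h [K [h0 K0 /bounded_byP HK]]].
exists (h / M), K; split=> //; first exact: divr_gt0.
apply/bounded_byP => p Ap; apply: le_trans (HK p Ap) _.
rewrite (ler_pM2l K0) ler_expR !mulNr lerN2; exact: ler_rescale h0 M0 (dc p Ap).
Qed.

End Transfer.

Section LocalRepresentative.
Variables (R : realType) (n : nat) (X : complex_manifold R n).
Local Notation C := R[i].
Local Notation Z := 'rV[C]_n.
Local Notation E := (coords R n).
Local Notation T := (cotangent X).
Implicit Types (c d : chart R n X) (V W : set T) (p q : T) (f g : T -> C).

(** One wedge and one rate of decay for all the derivatives in zbar. *)
Lemma dzbar_decay V W f c V' (l : seq 'I_n) : open_cone V -> frakSoo V f -> atlas c ->
  open_cone V' -> cone_relatively_compact V' (V `&` over_chart c) -> wedge V' W ->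
  exists B, [/\ wedge V' B, B `<=` W & exists h K : R, [/\ 0 < h, 0 < K &
    forall j p, j \in l -> B p ->
      nc (dzbar j (in_chart c f) (to_coords c p)) <= K * expR (- h * fiber_norm c p)]].
Proof.
move=> oV hf ac oV' rV' wW; elim: l => [|j l [B [wB BW [h [K [h0 K0 HK]]]]]].
  by exists W; split=> //; exists 1, 1.
have [W0 [_ _ _ dW]] := hf; have [W1 [wW1 sW1 gW1]] := dW c j ac.
have [|A [wA AW1 hA]] := gW1 c V' ac oV'.
  by apply: cone_rc_le rV' => p [Vp cp].
have V'V : V' `<=` V `&` over_chart c := conic_sub (conic_over oV.1.2) rV'.
exists (B `&` A); split; [exact: wedge_cap | by move=> p [/BW] |].
have [h' [K' [h'0 K'0 /bounded_byP HK']]] := hA (fun=> 0%N) (fun=> 0%N).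
exists (Num.min h h'), (K + K'); split; [by rewrite lt_min h0 | exact: addr_gt0 |].
have e1 p : expR (- h * fiber_norm c p) <= expR (- Num.min h h' * fiber_norm c p).
  by rewrite ler_expR ler_wpM2r ?cnorm_ge0 // lerN2 ge_min lexx.
have e2 p : expR (- h' * fiber_norm c p) <= expR (- Num.min h h' * fiber_norm c p).
  by rewrite ler_expR ler_wpM2r ?cnorm_ge0 // lerN2 ge_min lexx orbT.
move=> k p; rewrite in_cons mulrDl => /orP[/eqP ->|kl] [Bp Ap]; last first.
  apply: ler_wpDr; first by rewrite mulr_ge0 ?expR_ge0 // ltW.
  by apply: le_trans (HK k p kl Bp) _; rewrite ler_pM2l.
apply: ler_wpDl; first by rewrite mulr_ge0 ?expR_ge0 // ltW.
have V'p : V' p by have [_ AV' _] := wA; exact: AV'.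
have := HK' p Ap; rewrite derivative0 //; last by have [] := V'V p V'p.
by move=> /le_trans; apply; rewrite ler_pM2l.
Qed.

Lemma slice_derivable (F : E -> C) (w : E) (u : Z) :
  differentiable (fun zeta => F (w.1, zeta)) w.2 -> derivable F w (0, u).
Proof.
move=> dF; have H := derivable_cder (diff_derivable (v := u) dF).
suff : is_derive w ((0, u) : E) F ('D_u (fun zeta => F (w.1, zeta)) w.2) by case.
apply/is_derive_cder; rewrite (_ : (fun t => _) = fun t => F (w.1, w.2 + t *: u)) //.
apply/funext => t; congr F; apply/pair_equal_spec; split=> //=.
by rewrite scaler0 addr0.
Qed.

Lemma differentiable_change d c (G : E -> C) (w : E) : atlas c -> atlas d ->
  change_dom d c w -> differentiable G (coord_change d c w) ->
  differentiable (fun w => G (coord_change d c w)) w.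
Proof.
move=> ac ad dc dG.
exact: (@differentiable_comp C E E C (coord_change d c) G w (coord_change_differentiable ac ad dc) dG).
Qed.

Lemma holomorphic_on_chart W c (D : set E) (G : E -> C) : atlas c -> open D -> ghol D G ->
  W `<=` over_chart c -> (forall p, W p -> D (to_coords c p)) ->
  holomorphic_on W (G \o to_coords c).
Proof.
move=> ac oD gG Wc WD d ad _ [p [Wp dp] <-]; have cp := Wc p Wp.
have dc : change_dom d c (to_coords d p).
  by split; [exists p.1 | rewrite /= chart_funK].
have d2 : differentiable G (coord_change d c (to_coords d p)).
  have -> : coord_change d c (to_coords d p) = to_coords c p by rewrite /coord_change to_coordsK.
  exact: ghol_differentiable oD gG (WD p Wp).
have -> : in_chart d (G \o to_coords c) = fun w => G (coord_change d c w) by [].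
exact: differentiable_change ac ad dc d2.
Qed.

(** In a chart, f is replaced by its iterated Cauchy integral over a polydisc of
the base.  The covector is a parameter and the polydisc does not depend on it,
so that the result F is holomorphic on a wedge; the error is bounded by the
derivatives of f in zbar, which decay exponentially in the covector.  Hence f - F
decays, F grows no more than f, and both facts extend to derivatives by Cauchy's
and Landau's inequalities. *)
Lemma local_holomorphic V f p0 : open_cone V -> frakSoo V f -> V p0 ->
  exists V1 F, [/\ open_cone V1, V1 p0, V1 `<=` V, frakS V1 F &
    frakNoo V1 (fun p => -1 * F p + f p)].
Proof.
move=> oV hf Vp0; have [ac cp0] := chart_atP p0.1; set c := chart_at p0.1 in ac cp0.
have cp : over_chart c p0 by [].
pose w0 := to_coords c p0.
have oD : open (chart_image c V) := open_chart_image ac oV.1.1.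
have /nbhs_nvP[s s0 hs] := near_open oD (chart_image_to ac cp Vp0).
have [W [wW sW gW dW]] := hf.
have boxV (s' : R) : s' <= s -> box c w0 s' `<=` V `&` over_chart c.
  move=> ss p [cp' hp]; have [_ h] := hs _ (lt_le_trans hp ss).
  by rewrite to_coordsK in h.
have s20 : 0 < s / 2 by rewrite divr_gt0.
have s2s : s / 2 < s by rewrite ltr_pdivrMr // ltr_pMr // ltr1n.
have s42 : s / 4 < s / 2 by rewrite ltr_pM2l // ltf_pV2 ?posrE // ltr_nat.
have s84 : s / 8 < s / 4 by rewrite ltr_pM2l // ltf_pV2 ?posrE // ltr_nat.
have s168 : s / 16 < s / 8 by rewrite ltr_pM2l // ltf_pV2 ?posrE // ltr_nat.
have off0 (s' : R) : s' <= s -> box c w0 s' `<=` ~` zero_section X.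
  by move=> ss p /(boxV s' ss)[Vp _]; exact: oV.2.
(* growth conditions are only available on a relatively compact subcone V',
   and uniformly in t only over a smaller box, of size s / 4 *)
pose V' := cone_over (box c w0 (s / 2)).
have oV' : open_cone V' by apply: open_cone_over_set; [exact: open_box | exact: off0 (ltW s2s)].
have rV' : cone_relatively_compact V' (V `&` over_chart c).
  exists (box c w0 (s / 2)); split=> //.
  exact: rcompact_box ac s2s hs.
have V'V : V' `<=` V `&` over_chart c := conic_sub (conic_over oV.1.2) rV'.
have [A [wA AW hA]] := gW c V' ac oV' rV'.
have [B [wB BA [h [K [h0 K0 HK]]]]] := dzbar_decay (enum 'I_n) oV hf ac oV' rV' wA.
have [oB BV' hB] := wB.
have [|de [de0 hde]] := hB (box c w0 (s / 4)).
  have hV' w : nv (w - w0) < s / 2 -> chart_image c V' w.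
    move=> hw; have [h1 h2] := hs w (lt_trans hw s2s); have [e1 e2] := of_coordsK ac h1.
    split; first exact: h1.
    exists (of_coords c w), 1; split; [| exact: ltr01 | by rewrite scale1].
    by split; [exact: e2 | rewrite e1].
  by apply: rcompact_le (rcompact_box ac s42 hV') => p [].
(* the covectors far out on the rays over the fibre part of that box *)
pose Om := [set zeta : Z | exists t : R, de < t /\ nv (t^-1%:C *: zeta - w0.2) < s / 4].
have oOm : open Om.
  rewrite openE => zeta [t [dt hz]].
  apply: (@filterS _ (nbhs zeta) (nbhs_filter _) [set u : Z | nv (t^-1%:C *: u - w0.2) < s / 4]).
    by move=> u hu; exists t.
  apply: (@cont_near _ _ (fun u : Z => t^-1%:C *: u) zeta [set v | nv (v - w0.2) < s / 4]).
  - exact: contVZ (cont_cst _ _) (cont_id _).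
  - exact: open_nv_ball.
  - exact: hz.
(* the sup norm of z being only bounded non-strictly by its coordinates, r1 is
   taken strictly smaller than s / 4; circles have radius r *)
pose r1 := s / 8; pose r := s / 16.
pose P l := polydisc w0.1 r r1 Om l.
have r0 : 0 < r by rewrite divr_gt0.
have D0 : P [::] `<=` chart_image c B.
  move=> [z zeta] [h1 [/= [t [dt hz]] _]].
  have hz1 : nv (z - w0.1) < s / 4.
    apply: le_lt_trans s84; apply: nv_le_coord; first by rewrite divr_ge0 // ltW.
    by move=> j; have := ltW (h1 j); rewrite /lam /= !mxE.
  have hq : nv ((z, t^-1%:C *: zeta) - w0 : E) < s / 4.
    by move: hz hz1; case: (w0) => a b /= hz hz1; rewrite nv_pair hz1 hz.
  have t0 : 0 < t by exact: lt_trans dt.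
  have [h2 h3] := hs _ (lt_trans hq (lt_trans s42 s2s)); have [e1 e2] := of_coordsK ac h2.
  split=> //.
  have Nq : box c w0 (s / 4) (of_coords c (z, t^-1%:C *: zeta)).
    by split; [exact: e2 | rewrite e1].
  have := hde _ t Nq dt; rewrite -of_coords_scale /= scalerA -rmorphM divff ?gt_eqF //.
  by rewrite scale1r.
have sB : smooth (chart_image c B) (in_chart c f).
  apply: smooth_sub (smooth_on ac sW); apply: chart_imageS.
  exact: subset_trans BA AW.
have hol (p : E) (u : Z) : P [::] p -> derivable (in_chart c f) p (0, u).
  move=> /D0[h1 h2]; have [e1 e2] := of_coordsK ac h1; apply: slice_derivable.
  by have := (sW c ac).2 _ (AW _ (BA _ h2)) e2; rewrite e1.
pose Fh := holomorphic_approx w0.1 r (in_chart c f) (enum 'I_n).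
have all_in j : j \in enum 'I_n by rewrite mem_enum.
have gF : ghol (P (enum 'I_n)) Fh.
  by apply: (approx_ghol r0 s168 oOm D0 sB hol); [exact: enum_uniq | exact: all_in].
have [K1 K10 HK1] := approx_error r0 s168 oOm (open_chart_image ac oB) D0 sB hol (enum_uniq 'I_n).
have errF w : P (enum 'I_n) w -> nc (in_chart c f w - Fh w) <= K1 * (K * expR (- h * cnorm w.2)).
  move=> Pw; apply: HK1 => //; first by rewrite mulr_ge0 ?expR_ge0 // ltW.
  move=> q j /D0[h1 h2] qw; have [e1 e2] := of_coordsK ac h1.
  by have := HK j _ (all_in j) h2; rewrite /fiber_norm e1 qw.
have P0 w : P (enum 'I_n) w -> P [::] w by exact: polydisc0.
pose F := Fh \o to_coords c.
(* over this cone the base coordinates are within r / 2 of the centre, as the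
   bound of the Cauchy kernel requires *)
pose V1 := cone_over (box c w0 (r / 2)).
have r2s : r / 2 < s / 4.
  by apply: lt_trans (half_lt r0) _; exact: lt_trans s168 s84.
have r2le : r / 2 <= s by rewrite ltW // (lt_trans r2s) // (lt_trans s42).
have r20 : 0 < r / 2 by rewrite divr_gt0.
have oV1 : open_cone V1 by apply: open_cone_over_set; [exact: open_box | exact: off0].
have V1c : V1 `<=` V `&` over_chart c.
  move=> _ [p [t [/(boxV _ r2le)[Vp cp'] t0 ->]]]; split=> //.
  exact: oV.1.2.
pose W1 := [set p | V1 p /\ Om (to_coords c p).2].
have W1P p : W1 p -> P (enum 'I_n) (to_coords c p).
  move=> [[q [t [[cq hq] t0 pE]]] Op].
  have lq j : nc (lam w0.1 j (to_coords c p)) < r / 2.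
    rewrite pE; apply: le_lt_trans hq; rewrite /lam /=.
    apply: (@le_trans _ _ (nv ((to_coords c q).1 - w0.1))).
      by have := nv_coord ((to_coords c q).1 - w0.1) j; rewrite !mxE.
    exact: (nv_coords_le (to_coords c q) w0).1.
  split; last split=> //.
  by move=> j; apply: lt_trans (lq j) _; apply: lt_trans (half_lt r0) s168.
have oW1 : open W1.
  apply: (@open_preimage _ _ (fun p : T => (to_coords c p).2) V1 Om oV1.1.1 oOm).
  by move=> p /V1c[_ cp']; exact: cont_comp (cont_to_coords ac cp') (cont_snd _).
have wW1 : wedge V1 W1.
  apply: (wedge_upward oW1); first by move=> p [].
  - move=> p t [V1p [t' [dt' ht']]] t1; have t0 : 0 < t by exact: lt_le_trans t1.
    have t'0 : 0 < t' by exact: lt_trans dt'.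
    split; first exact: oV1.1.2.
    exists (t * t'); split; first by apply: lt_le_trans dt' _; rewrite ler_peMl // ltW.
    have tt : (t * t')^-1 * t = t'^-1.
      by rewrite invfM mulrC mulrA mulfV ?mul1r // gt_eqF.
    by rewrite to_coords_scale /= scalerA -rmorphM tt.
  - move=> _ [q [t [[cq hq] t0 ->]]].
    have d1 : 0 < de + 1 by exact: addr_gt0.
    exists ((de + 1) / t); first exact: divr_gt0.
    rewrite scale_scale mulfVK ?gt_eqF //; split; first by exists q, (de + 1).
    exists (de + 1); split; first by rewrite ltrDl.
    rewrite to_coords_scale /= scalerA -rmorphM mulVf ?gt_eqF // scale1r.
    exact: le_lt_trans (nv_coords_le (to_coords c q) w0).2 (lt_trans hq r2s).
have holF : holomorphic_on W1 F.
  apply: (holomorphic_on_chart ac _ gF) => [|p W1p|]; last exact: W1P.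
    exact: (@open_polydisc R n w0.1 r r1 Om oOm (enum 'I_n)).
  by have [] := V1c p W1p.1.
have errP p : W1 p -> nc (-1 * F p + f p) <= K1 * K * expR (- h * fiber_norm c p).
  move=> W1p; have [Vp cp'] := V1c p W1p.1.
  have := errF _ (W1P p W1p); rewrite /in_chart /= to_coordsK // mulrA.
  by rewrite mulN1r addrC.
have decF : growth V1 W1 (expdecay (fun p => -1 * F p + f p)).
  have V1c' : V1 `<=` over_chart c by move=> p /V1c[].
  apply: (expdecay_growth oV1 ac V1c' wW1).
  exists h, (K1 * K); split; [exact: h0 | exact: mulr_gt0 | exact/bounded_byP].
have W1A p : W1 p -> A p.
  move=> W1p; have [Vp cp'] := V1c p W1p.1.
  by have [_] := D0 _ (P0 _ (W1P p W1p)); rewrite to_coordsK // => /BA.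
have SF : frakS V1 F.
  have V1c' : V1 `<=` over_chart c by move=> p /V1c[].
  exists W1; split; [exact: wW1 | exact: holF | apply: (subexp_growth oV1 ac V1c' wW1)].
  have hf0 : subexp f c W1.
    have : subexp (derivative c (fun=> 0%N) (fun=> 0%N) f) c W1.
      exact: subexp_hereditary W1A (hA _ _).
    by apply: subexp_ext => p /W1A Ap; rewrite derivative0 //; have [_ AV' _] := wA; have [] := V'V p (AV' p Ap).
  have hd0 : subexp (fun p => -1 * F p + f p) c W1.
    move=> h' h'0; exists (K1 * K); split; first exact: mulr_gt0.
    apply/bounded_byP => p W1p; apply: le_trans (errP p W1p) _.
    rewrite (ler_pM2l (mulr_gt0 K10 K0)) ler_expR; apply: ler_wpM2r; first exact: cnorm_ge0.
    by rewrite ltW // (lt_trans _ h'0) // oppr_lt0.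
  by apply: subexp_ext (subexp_lincomb (-1) hd0 hf0) => p _; ring.
exists V1, F; split; [exact: oV1 | | | exact: SF |].
- exists p0, 1; split; [| exact: ltr01 | by rewrite scale1].
  by split; [exact: cp | rewrite subrr nv0].
- by move=> p /V1c[].
- apply: (frakNoo_decay oV1); last by exists W1.
  apply: (frakSoo_lincomb _ oV1.1.2 (frakS_frakSoo oV1 SF)).
  by apply: frakSoo_sub hf; [exact: oV1.1 | move=> p /V1c[]].
Qed.

End LocalRepresentative.

(** * Quotient sheaves *)

Section QuotientSheaves.
Variables (R : realType) (n : nat) (X : complex_manifold R n).
Local Notation C := R[i].
Local Notation T := (cotangent X).
Variable M : lmodType C.
Implicit Types (A B : set T -> set M) (O V : set T) (s t : T -> set M) (u v w g : M).

(** What the formalities below need to know of a presheaf of subspaces of M. *)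
Record subspaces B : Prop := Subspaces {
  subspaces0 : B setT 0;
  subspaces_lincomb : forall V (a : C) u v, open_conic V -> B V u -> B V v -> B V (a *: u + v);
  subspaces_sub : forall V V' u, open_conic V' -> V' `<=` V -> B V u -> B V' u }.

Lemma open_conicI V V' : open_conic V -> open_conic V' -> open_conic (V `&` V').
Proof.
move=> [oV cV] [oV' cV']; split; first exact: openI.
by move=> p t [Vp V'p] t0; split; [exact: cV | exact: cV'].
Qed.

Lemma open_conicT : open_conic (setT : set T).
Proof. by split; [exact: openT |]. Qed.

Lemma germs0 B p : subspaces B -> germs B p 0.
Proof. by move=> hB; exists setT; split=> //; [exact: open_conicT | exact: subspaces0]. Qed.

Lemma germs_lincomb B p (a : C) u v : subspaces B -> germs B p u -> germs B p v ->
  germs B p (a *: u + v).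
Proof.
move=> hB [V [oV Vp Bu]] [V' [oV' V'p Bv]]; have oI := open_conicI oV oV'.
exists (V `&` V'); split=> //; apply: (subspaces_lincomb hB _ oI).
  by apply: (subspaces_sub hB oI _ Bu) => q [].
by apply: (subspaces_sub hB oI _ Bv) => q [].
Qed.

Lemma germsD B p u v : subspaces B -> germs B p u -> germs B p v -> germs B p (u + v).
Proof. by move=> hB hu hv; rewrite -[u]scale1r; exact: germs_lincomb. Qed.

Lemma germsN B p u : subspaces B -> germs B p u -> germs B p (- u).
Proof.
move=> hB hu; rewrite -scaleN1r -[_ *: _]addr0.
by apply: germs_lincomb => //; exact: germs0.
Qed.

Lemma germsB B p u v w : subspaces B -> germs B p (u - w) -> germs B p (w - v) -> germs B p (u - v).
Proof. by move=> hB h1 h2; have := germsD hB h1 h2; rewrite addrA subrK. Qed.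

Lemma germs_sub B B' p : (forall V, open_conic V -> B V `<=` B' V) -> germs B p `<=` germs B' p.
Proof. by move=> BB' u [V [oV Vp Bu]]; exists V; split=> //; exact: BB'. Qed.

Lemma stalk_class_eq B p u v : subspaces B -> germs B p (u - v) ->
  stalk_class B p u = stalk_class B p v.
Proof.
move=> hB uv; apply/seteqP; split=> w /= hw; first exact: germsB uv.
by apply: germsB hw _ => //; rewrite -opprB; exact: germsN.
Qed.

Lemma induced_map_class B B' s p u : subspaces B -> subspaces B' ->
  (forall V, open_conic V -> B V `<=` B' V) -> s p = stalk_class B p u ->
  induced_map B' s p = stalk_class B' p u.
Proof.
move=> hB hB' BB' sp; apply/seteqP; split=> v /=.
  move=> [w []]; rewrite sp => /(germs_sub BB') hw hv; exact: germsB hv hw.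
by move=> hv; exists u; rewrite sp /stalk_class /= subrr; split=> //; exact: germs0.
Qed.

(** Injectivity holds because A meets B' in B, and surjectivity because A' is
locally A + B'.  The preimage of a section t is its intersection with the germs
of A, taken modulo B. *)
Lemma quotient_sheaf_isomorphism A B A' B' :
  subspaces A -> subspaces B -> subspaces A' -> subspaces B' ->
  (forall V, open_conic V -> A V `<=` A' V) ->
  (forall V, open_conic V -> B V `<=` B' V) ->
  (forall V u, open_conic V -> A V u -> B' V u -> B V u) ->
  (forall V u p, open_conic V -> A' V u -> V p ->
     exists V1 g, [/\ open_conic V1, V1 p, A V1 g & B' V1 (u - g)]) ->
  sheaf_isomorphism A B A' B' (induced_map B').
Proof.
move=> hA hB hA' hB' AA' BB' ABB' dec.
have germsAB' p u : germs A p u -> germs B' p u -> germs B p u.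
  move=> [V [oV Vp Au]] [V' [oV' V'p Bu]]; have oI := open_conicI oV oV'.
  exists (V `&` V'); split=> //; apply: ABB' => //.
    by apply: (subspaces_sub hA oI _ Au) => q [].
  by apply: (subspaces_sub hB' oI _ Bu) => q [].
have empty_map s p : s p = set0 -> induced_map B' s p = set0.
  by move=> sp; apply/seteqP; split=> v //= -[w []]; rewrite sp.
split.
- move=> O oO; split.
  + move=> s [s0 sl]; split; first by move=> p /s0/empty_map.
    move=> p /sl[V [u [oV Vp Au su]]]; exists V, u; split=> //; first exact: AA'.
    by apply: filterS su => q; exact: induced_map_class.
  + move=> s1 s2; rewrite !inE => -[s10 s1l] [s20 s2l] s12; apply/funext => p.
    have [Op|nOp] := pselect (O p); last by rewrite s10 ?s20.
    have [V1 [u1 [oV1 V1p Au1 /nbhs_singleton su1]]] := s1l p Op.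
    have [V2 [u2 [oV2 V2p Au2 /nbhs_singleton su2]]] := s2l p Op.
    have := congr1 (fun s => s p) s12.
    rewrite (induced_map_class hB hB' BB' su1) (induced_map_class hB hB' BB' su2) => h12.
    have hu : germs B' p (u1 - u2).
      have : stalk_class B' p u1 u1 by rewrite /stalk_class /= subrr; exact: germs0.
      by rewrite h12.
    rewrite su1 su2; apply: stalk_class_eq => //; apply: germsAB' => //.
    by apply: germsD => //; [exists V1 | apply: germsN => //; exists V2].
  + move=> t [t0 tl].
    pose s p := [set v | exists g, [/\ germs A p g, t p g & germs B p (v - g)]].
    have sE p : O p -> exists V1 g, [/\ open_conic V1, V1 p, A V1 g &
        \forall q \near p, s q = stalk_class B q g /\ t q = stalk_class B' q g].
      move=> /tl[V [u [oV Vp Au tu]]].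
      have [V1 [g [oV1 V1p Ag Bug]]] := dec V u p oV Au Vp.
      exists V1, g; split=> //.
      have nV1 := open_nbhs_nbhs (conj oV1.1 V1p).
      apply: (@filterS _ (nbhs p) (nbhs_filter p) _ _ _ (filterI nV1 tu)) => q [V1q tq].
      have ug : germs B' q (u - g) by exists V1.
      have tg : t q = stalk_class B' q g by rewrite tq; exact: stalk_class_eq.
      split=> //; apply/seteqP; split=> v /=.
        move=> [g' [Ag' tg' Bg']]; rewrite tg in tg'.
        apply: germsB Bg' _ => //; apply: germsAB' => //.
        by apply: germsD => //; apply: germsN => //; exists V1.
      move=> Bv; exists g; split=> //; first by exists V1.
      by rewrite tg /stalk_class /= subrr; exact: germs0.
    exists s.
      split.
        by move=> p /t0 tp; apply/seteqP; split=> v //= -[g []]; rewrite tp.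
      move=> p /sE[V1 [g [oV1 V1p Ag st]]]; exists V1, g; split=> //.
      by apply: filterS st => q [].
    apply/funext => p; have [Op|nOp] := pselect (O p).
      have [V1 [g [oV1 V1p Ag /nbhs_singleton[sp tp]]]] := sE p Op.
      by rewrite (induced_map_class hB hB' BB' sp).
    rewrite t0 //; apply: empty_map; apply/seteqP; split=> v //= -[g []].
    by rewrite t0.
- move=> O O' s oO oO' O'O hs; apply/funext => p; apply/seteqP; split=> v /=.
    by move=> [u [] [Op su] hv]; split=> //; exists u.
  by move=> [Op [u [su hv]]]; exists u.
- move=> O a s1 s2 oO hs1 hs2; apply/funext => p; apply/seteqP; split=> v /=.
    move=> [w [] [u1 [u2 [su1 su2 /(germs_sub BB') hw]]] hv]; exists u1, u2; split.
    + by exists u1; rewrite subrr; split=> //; exact: germs0.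
    + by exists u2; rewrite subrr; split=> //; exact: germs0.
    + exact: germsB hv hw.
  move=> [v1 [v2 []]] [u1 [su1 h1]] [u2 [su2 h2]] hv.
  exists (a *: u1 + u2); split.
    by exists u1, u2; rewrite subrr; split=> //; exact: germs0.
  apply: germsB hv _ => //.
  have -> : a *: v1 + v2 - (a *: u1 + u2) = a *: (v1 - u1) + (v2 - u2).
    by rewrite scalerBr opprD addrACA.
  exact: germs_lincomb.
Qed.

End QuotientSheaves.

(** * Sections on conic open sets *)

Section Sections.
Variables (R : realType) (n : nat) (X : complex_manifold R n).
Local Notation C := R[i].
Local Notation Z := 'rV[C]_n.
Local Notation E := (coords R n).
Local Notation T := (cotangent X).
Implicit Types (c d : chart R n X) (V W : set T) (U : set X) (p q : T) (f g : T -> C).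
Implicit Types (u v : rep X).

Lemma open_off_zero : open (~` zero_section X).
Proof.
rewrite openE => p p0.
have [ac cp0] := chart_atP p.1; set c := chart_at p.1 in ac cp0.
have cp : over_chart c p by [].
have Np : 0 < fiber_norm c p by apply: fiber_norm_gt0 => //; apply/eqP.
apply: (@filterS _ (nbhs p) (nbhs_filter p) [set q | 0 < fiber_norm c q]).
  move=> q /= hq q0; move: hq; rewrite /fiber_norm to_coords0 // -(scale0r (0 : Z)) cnormZ nc0 mul0r.
  by rewrite ltxx.
exact: (@cont_near _ _ (fiber_norm c : T -> R) p [set x | 0 < x] (cont_fiber_norm ac cp) (@open_gt _ _)).
Qed.

Lemma off_zero_cone V : open_conic V -> open_cone (off_zero V).
Proof.
move=> [oV cV]; split; last by move=> p [].
split; first by apply: openI => //; exact: open_off_zero.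
move=> p t [Vp p0] t0; split; first exact: cV.
move=> /= /eqP; rewrite /= scaler_eq0 => /orP[/eqP h|/eqP//].
have : nc (t%:C : C) = 0 by rewrite h nc0.
by rewrite ncR gtr0_norm // => /eqP; rewrite gt_eqF.
Qed.

Lemma cont_zero_point (x : X) : cont (fun y => (y, 0) : T) x.
Proof.
have [ac cx] := chart_atP x; set c := chart_at x in ac cx.
apply: (@near_cont _ _ (fun y : X => of_coords c (c y, 0) : T)).
  apply: filterS (near_open (@chart_dom_open _ _ _ c) cx) => y cy.
  by rewrite /of_coords /= chart_funK // /covector_change mul0mx.
apply: (@cont_comp _ _ _ (fun y : X => (c y, 0) : E) (of_coords c : E -> T)).
  by apply: cont_pair; [exact: cont_chart | exact: cont_cst].
by apply: cont_of_coords => //; exists x.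
Qed.

Lemma open_zero_trace V : open V -> open (zero_trace V).
Proof.
move=> oV; rewrite openE => x Vx.
exact: (cont_near (cont_zero_point x) oV Vx).
Qed.

Lemma open_conic_base U : open U -> open_conic (base X @^-1` U).
Proof. by move=> oU; split; [exact: open_base | move=> p t]. Qed.

Lemma off_zeroS V V' : V' `<=` V -> off_zero V' `<=` off_zero V.
Proof. by move=> sub p [/sub]. Qed.

Lemma off_zero_trace V : open_conic V -> open_cone (off_zero (base X @^-1` zero_trace V)).
Proof. by move=> [oV _]; apply: off_zero_cone; apply: open_conic_base; exact: open_zero_trace. Qed.

Lemma frakS_zero_sub U U' g : U' `<=` U -> frakS_zero U g -> frakS_zero U' g.
Proof.
move=> sub [hg bg]; split; first by apply: holomorphic_on_sub hg => p /sub.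
by move=> c K h ac cK KU; apply: bg => // x /KU[/sub].
Qed.

Lemma frakN_zero_sub U U' g : U' `<=` U -> frakN_zero U g -> frakN_zero U' g.
Proof. by move=> sub hg p /sub; exact: hg. Qed.

Lemma frakS_zero_lincomb U (a : C) f g : frakS_zero U f -> frakS_zero U g ->
  frakS_zero U (fun p => a * f p + g p).
Proof.
move=> [hf bf] [hg bg]; split; first exact: holomorphic_on_lincomb.
move=> c K h ac cK KU h0; have [k [k0 Hk]] := bf c K h ac cK KU h0.
have [k' [k'0 Hk']] := bg c K h ac cK KU h0.
exists (nc a * k + k'); split; last exact: bounded_lincomb.
by rewrite ltr_wpDl // mulr_ge0 ?nc_ge0 // ltW.
Qed.

Lemma frakN_zero_lincomb U (a : C) f g : frakN_zero U f -> frakN_zero U g ->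
  frakN_zero U (fun p => a * f p + g p).
Proof. by move=> hf hg p Up; rewrite hf // hg // mulr0 addr0. Qed.

Lemma glue_subspaces (A : set T -> set (T -> C)) (A0 : set X -> set (T -> C)) :
  (forall V, open_cone V -> A V (fun=> 0)) -> (forall U, A0 U (fun=> 0)) ->
  (forall V (a : C) f g, open_cone V -> A V f -> A V g -> A V (fun p => a * f p + g p)) ->
  (forall U (a : C) f g, A0 U f -> A0 U g -> A0 U (fun p => a * f p + g p)) ->
  (forall V V' f, open_cone V' -> V' `<=` V -> A V f -> A V' f) ->
  (forall U U' f, U' `<=` U -> A0 U f -> A0 U' f) ->
  subspaces (Defs.glue A A0 : set T -> set (rep X)).
Proof.
move=> hA0 hA00 lA lA0 sA sA0; split.
- split; [exact: hA0 (off_zero_cone (open_conicT X)) | exact: hA00 |].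
  exists (off_zero (base X @^-1` zero_trace (setT : set T))); split=> //.
  exact: wedge_self (off_zero_trace (open_conicT X)).1.
- move=> V a u v oV [Au A0u [W [wW Wu]]] [Av A0v [W' [wW' W'v]]]; split.
  + exact: lA (off_zero_cone oV) Au Av.
  + exact: lA0 A0u A0v.
  + exists (W `&` W'); split; first exact: wedge_cap.
    by move=> p [/Wu e1 /W'v e2]; rewrite /= -[LHS]/(a * u.1 p + v.1 p) e1 e2.
- move=> V V' u oV' V'V [Au A0u [W [wW Wu]]]; split.
  + by apply: sA Au; [exact: off_zero_cone | exact: off_zeroS].
  + by apply: sA0 A0u => x /V'V.
  + have [[oO cO] _] := off_zero_trace oV'.
    exists (W `&` off_zero (base X @^-1` zero_trace V')); split; last by move=> p [/Wu].
    by apply: wedge_sub wW => //; apply: off_zeroS => p /V'V.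
Qed.

Lemma frakS_zero0 U : frakS_zero U (fun _ : T => 0 : C).
Proof.
split; first exact: holomorphic_on0.
by move=> c K h _ _ _ _; exists 1; split; [exact: ltr01 | exact: bounded0].
Qed.

Lemma frakS_0 V : open_cone V -> frakS V (fun _ : T => 0 : C).
Proof. by move=> oV; have [W [hW _]] := frakN0 oV; exists W. Qed.

Lemma sections_S_subspaces : subspaces (@sections_S R n X).
Proof.
apply: glue_subspaces.
- exact: frakS_0.
- exact: frakS_zero0.
- by move=> V a f g _; exact: frakS_lincomb.
- by move=> U a f g; exact: frakS_zero_lincomb.
- by move=> V V' f oV'; apply: frakS_sub; exact: oV'.1.
- by move=> U U' f; exact: frakS_zero_sub.
Qed.

Lemma sections_N_subspaces : subspaces (@sections_N R n X).
Proof.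
apply: glue_subspaces.
- exact: frakN0.
- by [].
- by move=> V a f g _; exact: frakN_lincomb.
- by move=> U a f g; exact: frakN_zero_lincomb.
- by move=> V V' f oV'; apply: frakN_sub; exact: oV'.1.
- by move=> U U' f; exact: frakN_zero_sub.
Qed.

Lemma sections_Soo_subspaces : subspaces (@sections_Soo R n X).
Proof.
apply: glue_subspaces.
- by move=> V oV; apply: frakS_frakSoo => //; exact: frakS_0.
- exact: frakS_zero0.
- by move=> V a f g oV; apply: frakSoo_lincomb; exact: oV.1.2.
- by move=> U a f g; exact: frakS_zero_lincomb.
- by move=> V V' f oV'; apply: frakSoo_sub; exact: oV'.1.
- by move=> U U' f; exact: frakS_zero_sub.
Qed.

Lemma sections_Noo_subspaces : subspaces (@sections_Noo R n X).
Proof.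
apply: glue_subspaces.
- by move=> V oV; apply: frakN_frakNoo => //; exact: frakN0.
- by [].
- by move=> V a f g oV; apply: frakNoo_lincomb; exact: oV.1.2.
- by move=> U a f g; exact: frakN_zero_lincomb.
- by move=> V V' f oV'; apply: frakNoo_sub; exact: oV'.1.
- by move=> U U' f; exact: frakN_zero_sub.
Qed.

Lemma sections_S_Soo V : open_conic V -> sections_S V `<=` sections_Soo V.
Proof. by move=> oV u [Su Zu Wu]; split=> //; apply: frakS_frakSoo => //; exact: off_zero_cone. Qed.

Lemma sections_N_Noo V : open_conic V -> sections_N V `<=` sections_Noo V.
Proof. by move=> oV u [Su Zu Wu]; split=> //; apply: frakN_frakNoo => //; exact: off_zero_cone. Qed.

Lemma sections_S_Noo V u : open_conic V -> sections_S V u -> sections_Noo V u -> sections_N V u.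
Proof.
move=> oV [Su _ _] [Nu Zu Wu]; split=> //; apply: frakS_frakNoo_frakN => //.
exact: off_zero_cone.
Qed.

(** A relatively compact cone projects to a relatively compact set of the base,
over which g is bounded on the whole fibres. *)
Lemma frakS_zero_frakS V g : open_conic V -> frakS_zero (zero_trace V) g ->
  frakS (off_zero (base X @^-1` zero_trace V)) g.
Proof.
move=> oV [hg bg]; have oO := off_zero_trace oV.
exists (off_zero (base X @^-1` zero_trace V)); split.
- exact: wedge_self oO.1.
- by apply: holomorphic_on_sub hg => p [].
- move=> c V' ac oV' [K [[cK KV] V'E]]; exists V'; split.
  + exact: wedge_self oV'.1.
  + have rc : cone_relatively_compact V' (off_zero (base X @^-1` zero_trace V) `&` over_chart c) by exists K.
    by move=> p /(conic_sub (conic_over oO.1.2) rc)[].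
  + move=> h h0.
    have cB : compact (base X @` closure K) by apply: compact_image => // p _; exact: cont_base.
    have BU : base X @` closure K `<=` zero_trace V `&` chart_dom c.
      by move=> _ [p /KV[[Vp _] cp] <-].
    have [k [k0 Hk]] := bg c _ h ac cB BU h0; exists k; split=> //.
    apply: bounded_sub Hk; rewrite V'E => _ [p [t [Kp t0 ->]]].
    by exists p => //; exact: subset_closure.
Qed.

(** At a point of the zero section, u.1 agrees on a wedge with u.2, which is
holomorphic: the decomposition is u = (u.2, u.2) + (u.1 - u.2, 0).  Elsewhere the
trace of a small cone on the zero section is empty, and u.1 has a holomorphic
representative. *)
Lemma sections_local_decomposition V u p : open_conic V -> sections_Soo V u -> V p ->
  exists V1 v, [/\ open_conic V1, V1 p, sections_S V1 v & sections_Noo V1 (u - v)].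
Proof.
move=> oV [Su Zu [W [wW Wu]]] Vp.
have [p0|p0] := pselect (zero_section X p).
- pose V1 : set T := base X @^-1` zero_trace V.
  have oV1 : open_conic V1 by apply: open_conic_base; apply: open_zero_trace; exact: oV.1.
  have tV1 : zero_trace V1 = zero_trace V by [].
  have oO : open_cone (off_zero V1) := off_zero_trace oV.
  exists V1, ((u.2, u.2) : rep X); split=> //.
  + by move: Vp p0; case: (p) => x z /= Vp p0; rewrite /V1 /zero_trace /= -p0.
  + split; [exact: frakS_zero_frakS | by rewrite tV1 |].
    by exists (off_zero V1); split=> //; exact: wedge_self oO.1.
  + split.
    * by apply: (frakNoo0 oO wW) => q /Wu e; rewrite /= -[LHS]/(u.1 q - u.2 q) e subrr.
    * by move=> q _ /=; rewrite -[LHS]/(u.2 q - u.2 q) subrr.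
    * exists W; split=> // q /Wu e; rewrite /= -[LHS]/(u.1 q - u.2 q) -[RHS]/(u.2 q - u.2 q).
      by rewrite e.
- have oO := off_zero_cone oV.
  have [V1 [F [oV1 V1p V1V SF NF]]] := local_holomorphic oO Su (conj Vp p0).
  have off : off_zero V1 = V1 by apply/seteqP; split=> q; [case | move=> V1q; split=> //; exact: oV1.2].
  have tr0 : zero_trace V1 = set0 by apply/seteqP; split=> x // V1x; exact: (oV1.2 _ V1x).
  have gl (a b : T -> C) : exists W, wedge (off_zero (base X @^-1` zero_trace V1)) W /\
      forall q, W q -> a q = b q.
    rewrite tr0; exists set0; split=> //; split=> [|q []//|K rK]; first exact: open0.
    exists 1; split=> // q t Kq _; by have [] := rcompact_in rK Kq.
  exists V1, ((F, fun=> 0) : rep X); split; [exact: oV1.1 | exact: V1p | |].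
    by split; [rewrite off | exact: frakS_zero0 | exact: gl].
  split; [| by rewrite tr0 | exact: gl].
  rewrite off (_ : (u - _).1 = fun q => -1 * F q + u.1 q) //.
  by apply/funext => q; rewrite -[LHS]/(u.1 q - F q) mulN1r addrC.
Qed.

End Sections.

Theorem theorem3p17 (R : realType) (n : nat) (X : complex_manifold R n) :
  (forall V : set (cotangent X), open_conic V ->
     sections_S V `<=` sections_Soo V /\ sections_N V `<=` sections_Noo V) /\
  sheaf_isomorphism (@sections_S R n X) (@sections_N R n X)
    (@sections_Soo R n X) (@sections_Noo R n X)
    (induced_map (@sections_Noo R n X)).
Proof.
split; first by move=> V oV; split; [exact: sections_S_Soo | exact: sections_N_Noo].
apply: quotient_sheaf_isomorphism.
- exact: sections_S_subspaces.
- exact: sections_N_subspaces.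
- exact: sections_Soo_subspaces.
- exact: sections_Noo_subspaces.
- exact: sections_S_Soo.
- exact: sections_N_Noo.
- exact: sections_S_Noo.
- exact: sections_local_decomposition.
Qed.
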